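(* Let $1<p<\infty$, let $(a,b)$ be a matching pair with subordinated pair $(c,d)$, and suppose that $T(c)$ and $T(d)$ are Fredholm on $H^p$ with indices $\kappa_c=\mathrm{ind}\,T(c)>0$ and $\kappa_d=\mathrm{ind}\,T(d)<0$. Let $c_\pm,d_\pm$ be the factorization factors in the Wiener--Hopf factorizations (in $H^p$) of $c$ and $d$, respectively. If $f\in H^p$ satisfies the conditions $$\int_{\mathbb{T}}\overline{d_-^{-1}(t)}\,t^j\,\overline{f(t)}\,|dt|=0,\qquad j=0,1,\dots,-\kappa_d-1,$$ then the equation $(T(a)+H(b))\varphi=f$ is solvable in $H^p$ and all solutions of this equation are given by the formula $$\varphi=T_r^{-1}(c)T(\widetilde a^{-1})T_l^{-1}(d)f-JQc\,T_r^{-1}(c)T(\widetilde a^{-1})T_l^{-1}(d)f+JQ\widetilde a^{-1}T_l^{-1}(d)f+c_+^{-1}\sum_{k=0}^{\kappa(1)}r_k^{(1)}u_k^{(\kappa(1),-)},$$ where $r_k^{(1)}$, $k=0,1,\dots,\kappa(1)$, are arbitrary complex numbers and $$\kappa(1)=m-1,\quad u_k^{(\kappa(1),-)}(t)=t^{m-k-1}-\boldsymbol{\sigma}(c)\,t^{m+k}\qquad\text{if }\kappa_c=2m,$$ $$\kappa(1)=m,\quad u_k^{(\kappa(1),-)}(t)=t^{m+k}-\boldsymbol{\sigma}(c)\,t^{m-k}\qquad\text{if }\kappa_c=2m+1.$$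
   Context: Let $\mathbb{T}$ be the unit circle, $1<p<\infty$, $1/p+1/q=1$, $L^p=L^p(\mathbb{T})$, $H^p=\{f\in L^p:\widehat f_n=0\ \forall n<0\}$, $\overline{H^p}=\{f\in L^p:\widehat f_n=0\ \forall n>0\}$. $P:\sum_{n\in\mathbb{Z}}\widehat f_nt^n\mapsto\sum_{n\ge0}\widehat f_nt^n$ is the Riesz projection on $L^p$, $Q=I-P$, and $(Jf)(t)=t^{-1}f(t^{-1})$. For $g\in L^\infty$: $\widetilde g(t)=g(1/t)$; $T(g)=PgP$ and $H(g)=PgQJ$ on $H^p$ are the Toeplitz and Hankel operators. Matching pair: $a,b\in L^\infty$, $a$ (and hence $b$) invertible in $L^\infty$, with $a\widetilde a=b\widetilde b$ on $\mathbb{T}$. Its subordinated pair is $(c,d)$ with $c=ab^{-1}=\widetilde b\,\widetilde a^{-1}$ and $d=b\,\widetilde a^{-1}=\widetilde b^{-1}a$; one has $c\widetilde c=1=d\widetilde d$. Wiener--Hopf factorization in $H^p$: for $g\in L^\infty$ with $T(g)$ Fredholm on $H^p$, there is a unique factorization $g=g_-t^ng_+$ with $n=-\mathrm{ind}\,T(g)$, $g_+\in H^q$, $g_+^{-1}\in H^p$, $g_-\in\overline{H^p}$, $g_-^{-1}\in\overline{H^q}$, $g_-(\infty)=1$ (zeroth Fourier coefficient of $g_-$ equal to $1$), such that $g_+^{-1}Pg_-^{-1}I$, defined on polynomials, extends to a bounded operator on $H^p$, denoted $T(g_+^{-1})T(g_-^{-1})$. If $g\widetilde g=1$, it is known that $g_-=\boldsymbol{\sigma}(g)\,\widetilde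 g_+^{-1}$, where $\boldsymbol{\sigma}(g):=g_+(0)=\pm1$ is the factorization signature. If $n\ge0$ (i.e. $\mathrm{ind}\,T(g)\le0$), $T_l^{-1}(g):=T(t^{-n})T(g_+^{-1})T(g_-^{-1})$, a left inverse of $T(g)$. If $n\le0$, $T_r^{-1}(g):=T(g_+^{-1})T(g_-^{-1})T(t^{-n})$, a right inverse of $T(g)$. *)

(* Defs.v *)
From HB Require Import structures.
From mathcomp Require Import all_boot all_order all_algebra.
From mathcomp Require Import complex.
From mathcomp Require Import all_classical all_reals all_analysis.

Set Implicit Arguments.
Unset Strict Implicit.
Unset Printing Implicit Defensive.

Import Order.TTheory GRing.Theory Num.Theory.
Import numFieldNormedType.Exports.
Import Normc.

Local Open Scope classical_set_scope.
Local Open Scope ring_scope.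

Definition circle (R : realType) : Type := {z : R[i] | `|z| == 1}.

Section Circle.
Context {R : realType}.
Implicit Types (t : circle R) (x : R).

Lemma circle_inv_subproof t : `|(val t)^-1| == 1.
Proof. by rewrite normfV (eqP (valP t)) invr1. Qed.

Definition circle_inv t : circle R := exist _ (val t)^-1 (circle_inv_subproof t).

Lemma cis_subproof x : `|(cos x +i* sin x)%C| == 1.
Proof. by rewrite normc_def /= cos2Dsin2 sqrtr1. Qed.

Definition cis x : circle R := exist _ (cos x +i* sin x)%C (cis_subproof x).

End Circle.

(* Arc length |dt|, in the angle coordinate t = cis x with x in [-pi, pi].    *)
Definition arc_length (R : realType) : {measure set (measurableTypeR R) -> \bar R} :=
  mrestr (@lebesgue_measure R) (measurable_itv `[- pi, pi]).

Section HardySpaces.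
Context {R : realType}.
Local Notation C := (R[i]).
(* Elements of L^p are represented by functions; equality in L^p is [aeq].    *)
Local Notation F := (circle R -> C).
Implicit Types (f g u v gm gp : F) (U V : set F) (A B : F -> F) (p : R) (n k : int).

Definition aeq f g : Prop := {ae arc_length R, forall x, f (cis x) = g (cis x)}.

Definition cmeasurable f : Prop :=
  measurable_fun [set: measurableTypeR R] (fun x => complex.Re (f (cis x))) /\
  measurable_fun [set: measurableTypeR R] (fun x => complex.Im (f (cis x))).

Definition Lp_norm (p : \bar R) f : \bar R :=
  Lnorm (arc_length R) p (fun x => (normc (f (cis x)))%:E).

(* [p] ranges over the extended reals: L^oo is [Lp +oo].                      *)
Definition Lp (p : \bar R) f : Prop := cmeasurable f /\ (Lp_norm p f < +oo)%E.

Definition circle_int f : C :=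
  ((\int[arc_length R]_x complex.Re (f (cis x))) +i* (\int[arc_length R]_x complex.Im (f (cis x))))%C.

Definition zexp n : F := fun t => (val t) ^ n.

Definition fourier f n : C := (2 * pi)^-1%:C%C * circle_int (f \* zexp (- n)).

Definition Hardy p f : Prop := Lp p%:E f /\ forall n, n < 0 -> fourier f n = 0.

Definition coHardy p f : Prop := Lp p%:E f /\ forall n, 0 < n -> fourier f n = 0.

(* The function of L^p whose Fourier coefficients are those of f for n >= 0   *)
(* and 0 for n < 0: unique up to [aeq], and for 1 < p < oo it exists for      *)
(* every f in L^p (M. Riesz); 0 if there is none.                             *)
Definition riesz p f : F :=
  xget ((fun=> 0) : F) [set g : F | Lp p%:E g /\
    forall n, fourier g n = if 0 <= n then fourier f n else 0].

Definition coriesz p f : F := f \- riesz p f.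

Definition tilde f : F := fun t => f (circle_inv t).

Definition recip f : F := fun t => (f t)^-1.

Definition Jop f : F := fun t => (val t)^-1 * f (circle_inv t).

Definition toeplitz p g f : F := riesz p (g \* riesz p f).

Definition hankel p g f : F := riesz p (g \* coriesz p (Jop f)).

(* dim (U / V) = m, for subspaces V of U: some e_1, ..., e_m in U induce a    *)
(* basis of the quotient.                                                     *)
Definition quot_dim U V (m : nat) : Prop :=
  exists2 e : 'I_m -> F, (forall i, U (e i)) &
    forall u, U u ->
      exists! x : 'rV[C]_m, V (fun t => u t - \sum_i x 0 i * e i t).

(* A bounded operator whose range has finite codimension has closed range,    *)
(* so closedness is not listed. Quotienting by null functions accounts for    *)
(* elements of H^p being classes.                                             *)
Definition fredholm_of_index p A k : Prop :=
  exists n m : nat,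
  [/\ quot_dim [set u | Hardy p u /\ aeq (A u) (fun=> 0)]
               [set u | Hardy p u /\ aeq u (fun=> 0)] n,
      quot_dim [set u | Hardy p u]
               [set u | Hardy p u /\ exists2 v, Hardy p v & aeq u (A v)] m &
      k = n%:Z - m%:Z].

Definition bounded_op p A : Prop :=
  [/\ forall u, Hardy p u -> Hardy p (A u),
      forall (z : C) u v, Hardy p u -> Hardy p v ->
        aeq (A (fun t => z * u t + v t)) (fun t => z * A u t + A v t) &
      exists M : R, forall u, Hardy p u ->
        (Lp_norm p%:E (A u) <= M%:E * Lp_norm p%:E u)%E].

Definition polyfun (r : {poly C}) : F := fun t => r.[val t].

(* A is a bounded operator on H^p that extends g_+^{-1} P g_-^{-1} I.         *)
Definition wh_extension p gm gp A : Prop :=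
  bounded_op p A /\
  forall r : {poly C},
    aeq (A (polyfun r)) (recip gp \* riesz p (recip gm \* polyfun r)).

(* T(g_+^{-1}) T(g_-^{-1}); as polynomials are dense in H^p, the extension is *)
(* unique up to [aeq].                                                        *)
Definition wh_op p gm gp : F -> F := xget (fun u : F => u) [set A : F -> F | wh_extension p gm gp A].

(* g = g_- t^n g_+ is the Wiener-Hopf factorization of g in H^p, q being the  *)
(* conjugate exponent. Since 0^-1 = 0 here, invertibility of the factors has  *)
(* to be required separately.                                                 *)
Record wh_factorization p q g n gm gp : Prop := WHFactorization {
  whf_index : fredholm_of_index p (toeplitz p g) (- n);
  whf_eq : aeq g (gm \* zexp n \* gp);
  whf_plus_neq0 : {ae arc_length R, forall x, gp (cis x) != 0};
  whf_minus_neq0 : {ae arc_length R, forall x, gm (cis x) != 0};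
  whf_plus : Hardy q gp;
  whf_plusV : Hardy p (recip gp);
  whf_minus : coHardy p gm;
  whf_minusV : coHardy q (recip gm);
  whf_minus_infty : fourier gm 0 = 1;
  whf_bounded : exists A, wh_extension p gm gp A
}.

(* g_+(0), where g_+ is the plus factor.                                      *)
Definition signature gp : C := fourier gp 0.

(* For g = g_- t^n g_+, a left inverse of T(g) if n >= 0.                     *)
Definition toeplitz_linv p n gm gp f : F :=
  toeplitz p (zexp (- n)) (wh_op p gm gp f).

(* For g = g_- t^n g_+, a right inverse of T(g) if n <= 0.                    *)
Definition toeplitz_rinv p n gm gp f : F :=
  wh_op p gm gp (toeplitz p (zexp (- n)) f).

Definition Linfty_unit g : Prop :=
  Lp +oo%E g /\ exists2 h, Lp +oo%E h & aeq (g \* h) (fun=> 1).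

(* Invertibility of b follows.                                                *)
Definition matching_pair a b : Prop :=
  [/\ Linfty_unit a, Lp +oo%E b & aeq (a \* tilde a) (b \* tilde b)].

Definition subord_c a b : F := a \* recip b.

Definition subord_d a b : F := b \* recip (tilde a).

(* kappa(1) and u_k^{(kappa(1),-)}, as functions of N = kappa_c > 0, with     *)
(* N = 2 m or N = 2 m + 1; s stands for the factorization signature.          *)
Definition kappa1 (N : nat) : nat := if odd N then N./2 else N./2.-1.

Definition u_minus (s : C) (N k : nat) : F :=
  let m := N./2%:Z in
  if odd N then fun t => zexp (m + k%:Z) t - s * zexp (m - k%:Z) t
  else fun t => zexp (m - k%:Z - 1) t - s * zexp (m + k%:Z) t.

End HardySpaces.

(* Main.v *)
Require Import Defs.
From HB Require Import structures.
From mathcomp Require Import all_boot all_order all_algebra.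
From mathcomp Require Import complex ring lra zify.
From mathcomp Require Import all_classical all_reals all_analysis.
From mathcomp Require Import measurable_realfun.

(** Notation of the comments: g~ is the reflection t |-> g(1/t), J f is
    t^-1 f~, and frequencies are indices of Fourier coefficients.

    For phi in H^p the function J phi has only negative frequencies, so that
    (T(a) + H(b)) phi = f says that S phi - f has only negative frequencies,
    where S phi = a phi + b J phi. The matching condition a a~ = b b~ makes
    every computation with S a pointwise identity.

    Existence. The conditions on f say that d_-^-1 f has no frequency in
    [0, -kappa_d), which is what makes psi = T_l^-1(d) f a solution of
    P (d psi) = f (toeplitz_linvP). Next, s = T_r^-1(c) T(a~^-1) psi solves
    P (c s) = P (a~^-1 psi) (toeplitz_rinvP). The first three terms of the
    formula then reduce to s - c~ J s + a^-1 J psi, whose image under S is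
    J psi + d psi: this differs from f by negative frequencies only
    (unprojected_particular).

    Kernel. If eta = S phi has only negative frequencies, then eta = d J eta;
    with d = d_- t^(-kappa_d) d_+ this reads d_-^-1 eta = t^(-kappa_d) d_+ J eta,
    where one side has nonpositive and the other positive frequencies, so
    eta = 0 (unprojected_eq0). From S phi = 0 follows c phi = - J phi. As c c~ = 1,
    the factors of c satisfy c_- = sigma / c_+~ (signatureP), and u = c_+ phi
    satisfies sigma t^(-kappa_c) u = - J u. Comparing Fourier coefficients, u is
    a polynomial of degree less than kappa_c that is symmetric up to - sigma,
    that is, a combination of the u_k (unprojected_kernel_complete).

    What this needs from analysis is built from integrals over the circle.
    - The Riesz projection is bounded on L^p for 1 < p < oo. For an analytic
      polynomial F with real mean and positive real part, and for l > 0, the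
      real part of F^2 / (F + l) has nonnegative mean, which is the value of
      this function at 0. Adding these inequalities over dyadic l with weights
      l^(p - 1) compares the integrals of |F|^p and |F|^(p - 1) Re F when
      1 < p < 2 (riesz_positive). A smooth approximation of the absolute value
      removes the sign condition, and F^2 passes from p to 2 p (riesz_boundT).
    - A class of functions that contains the trigonometric polynomials and is
      closed under bounded limits contains all indicators (blc_indic): iterating
      y |-> (3 y - y^3) / 2 on a suitable trigonometric polynomial produces the
      indicator of a ray. Hence Fourier coefficients determine an integrable
      function (fourier_uniqueness), and trigonometric polynomials are dense in
      L^p (dense_Lp). With completeness (Lp_complete) the Riesz projection
      exists on L^p, and analytic polynomials are dense in H^p (riesz_exists).
    - Products of Hardy functions with conjugate exponents have no negative
      frequencies and a multiplicative mean, and the bounded extension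
      T(g_+^-1) T(g_-^-1) solves P (g t^-n y) = f: both are checked on
      polynomials and extended by continuity (hardy_cont_eq, wh_op_fourier). *)

Set Implicit Arguments.
Unset Strict Implicit.
Unset Printing Implicit Defensive.

Import Order.TTheory GRing.Theory Num.Theory.
Import numFieldNormedType.Exports.
Import Normc HBNNSimple.
Local Open Scope classical_set_scope.
Local Open Scope ring_scope.

(** * Complex numbers *)

Section ComplexNumbers.
Context {R : realType}.
Local Notation C := (R[i]).
Implicit Types (z w : C) (x : R).

Lemma cReD z w : complex.Re (z + w) = complex.Re z + complex.Re w.
Proof. by case: z w => [a b] [c d]. Qed.

Lemma cImD z w : complex.Im (z + w) = complex.Im z + complex.Im w.
Proof. by case: z w => [a b] [c d]. Qed.

Lemma cReN z : complex.Re (- z) = - complex.Re z.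
Proof. by case: z. Qed.

Lemma cImN z : complex.Im (- z) = - complex.Im z.
Proof. by case: z. Qed.

Lemma cReM z w : complex.Re (z * w) =
  complex.Re z * complex.Re w - complex.Im z * complex.Im w.
Proof. by case: z w => [a b] [c d]. Qed.

Lemma cImM z w : complex.Im (z * w) =
  complex.Re z * complex.Im w + complex.Im z * complex.Re w.
Proof. by case: z w => [a b] [c d]. Qed.

Lemma cReV z : complex.Re z^-1 =
  complex.Re z / (complex.Re z ^+ 2 + complex.Im z ^+ 2).
Proof. by case: z. Qed.

Lemma cImV z : complex.Im z^-1 =
  - (complex.Im z / (complex.Re z ^+ 2 + complex.Im z ^+ 2)).
Proof. by case: z. Qed.

Lemma complexP z w :
  complex.Re z = complex.Re w -> complex.Im z = complex.Im w -> z = w.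
Proof. by case: z w => [a b] [c d] /= -> ->. Qed.

Lemma normc2E z : normc z ^+ 2 = complex.Re z ^+ 2 + complex.Im z ^+ 2.
Proof. by case: z => a b /=; rewrite sqr_sqrtr ?addr_ge0 ?sqr_ge0. Qed.

Lemma normc_ge0 z : 0 <= normc z.
Proof. by case: z => a b /=; exact: sqrtr_ge0. Qed.

Lemma le_Re_normc z : `|complex.Re z| <= normc z.
Proof.
by case: z => a b /=; rewrite -sqrtr_sqr ler_wsqrtr // lerDl sqr_ge0.
Qed.

Lemma le_Im_normc z : `|complex.Im z| <= normc z.
Proof.
by case: z => a b /=; rewrite -sqrtr_sqr ler_wsqrtr // lerDr sqr_ge0.
Qed.

Lemma normc_real x : normc x%:C%C = `|x|.
Proof. by rewrite /= expr0n /= addr0 sqrtr_sqr. Qed.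

Lemma normc_imag x : normc (x *i)%C = `|x|.
Proof. by rewrite /= expr0n /= add0r sqrtr_sqr. Qed.

Lemma le_normc_ReIm z : normc z <= `|complex.Re z| + `|complex.Im z|.
Proof.
case: z => a b.
have -> : (a +i* b)%C = a%:C%C + (b *i)%C.
  by apply: complexP => /=; rewrite ?addr0 ?add0r.
apply: le_trans (le_normcD _ _) _; rewrite normc_real normc_imag.
by rewrite cReD cImD /= addr0 add0r.
Qed.

Lemma normc_conj z : normc (z^*)%C = normc z.
Proof. by case: z => a b /=; rewrite sqrrN. Qed.

Lemma normcX z n : normc (z ^+ n) = normc z ^+ n.
Proof. by elim: n => [|n IH]; rewrite ?expr0 ?normc1 // !exprS normcM IH. Qed.

Lemma normc_eq0 z : (normc z == 0) = (z == 0).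
Proof.
apply/eqP/eqP => [|->]; [exact: eq0_normc|by rewrite normc0].
Qed.

Lemma normc_gt0 z : (0 < normc z) = (z != 0).
Proof. by rewrite lt0r normc_eq0 normc_ge0 andbT. Qed.

(** How an estimate up to an arbitrary error becomes an equality: limits are
    taken throughout in this form. *)
Lemma normc_le_eps z (K : R) : 0 <= K ->
  (forall e, 0 < e -> normc z <= K * e) -> z = 0.
Proof.
move=> K0 H; apply/eqP; rewrite -normc_eq0 eq_le normc_ge0 andbT.
apply/ler_addgt0Pr => e e0; rewrite add0r.
have K1 : 0 < K + 1 by lra.
apply: le_trans (H (e / (K + 1)) _) _; first by rewrite divr_gt0.
rewrite mulrCA ler_piMr ?(ltW e0)// ler_pdivrMr// mul1r; lra.
Qed.

End ComplexNumbers.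

(** * The circle and its angle coordinate *)

Section Angle.
Context {R : realType}.
Local Notation C := (R[i]).
Local Notation T := (measurableTypeR R).
Local Notation mu := (arc_length R).
Implicit Types (x y : R) (n : int) (t : circle R).

Lemma val_neq0 t : val t != 0.
Proof.
by case: t => z /= /eqP z1; apply/eqP => z0; move/eqP: z1;
  rewrite z0 normr0 eq_sym oner_eq0.
Qed.

Lemma normc_val t : normc (val t) = 1.
Proof. by case: t => [[a b]] /= /eqP[]. Qed.

Lemma conj_val t : (val t)^*%C = (val t)^-1.
Proof.
apply: complexP; rewrite ?cReV ?cImV -normc2E normc_val expr1n divr1;
  by case: (val t).
Qed.

Lemma val_cisD x y : val (cis (x + y)) = val (cis x) * val (cis y) :> C.
Proof.
by apply: complexP; rewrite /= ?cosD ?sinD// addrC.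
Qed.

Lemma cisN x : cis (- x) = circle_inv (cis x).
Proof.
apply: val_inj; rewrite /= -[RHS]/((val (cis x))^-1) -conj_val.
by apply: complexP; rewrite /= ?cosN ?sinN.
Qed.

Lemma val_cisX x (k : nat) : val (cis x) ^+ k = val (cis (k%:R * x)) :> C.
Proof.
elim: k => [|k IH]; first by apply: complexP; rewrite /= mul0r ?cos0 ?sin0.
by rewrite exprS IH -val_cisD -{1}[x]mul1r -mulrDl -nat1r.
Qed.

Lemma zexp_cis n x : zexp n (cis x) = val (cis (n%:~R * x)).
Proof.
case: n => k; first by rewrite /zexp -exprnP val_cisX.
rewrite /zexp NegzE -exprnN val_cisX mulrNz mulNr cisN.
by [].
Qed.

Lemma normc_zexp n t : normc (zexp n t) = 1.
Proof.
rewrite /zexp; case: n => k; rewrite ?NegzE ?exprnN -?exprnP.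
  by rewrite normcX normc_val expr1n.
by rewrite normcV normcX normc_val expr1n invr1.
Qed.

Lemma zexpD n m t : zexp (n + m) t = zexp n t * zexp m t.
Proof. by rewrite /zexp expfzDr// val_neq0. Qed.

Lemma zexp0 t : zexp 0 t = 1. Proof. by []. Qed.

Lemma zexpN_inv n t : zexp (- n) t = (zexp n t)^-1.
Proof. by rewrite /zexp invr_expz. Qed.

Lemma zexp_neq0 n t : zexp n t != 0.
Proof. by rewrite -normc_gt0 normc_zexp. Qed.

Lemma zexp_inv n t : zexp n (circle_inv t) = zexp (- n) t.
Proof. by rewrite /zexp /= exprz_inv. Qed.

Lemma conj_zexp n t : (zexp n t)^*%C = zexp (- n) t.
Proof.
rewrite /zexp; case: n => k; rewrite ?NegzE ?opprK -?exprnN -?exprnP.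
  by rewrite rmorphXn /= conj_val exprVn.
by rewrite fmorphV rmorphXn /= conj_val exprVn invrK.
Qed.

Lemma sin_int_pi n : sin (n%:~R * pi) = 0 :> R.
Proof.
have : complex.Im (zexp n (cis (pi : R))) = 0.
  have E : val (cis (pi : R)) = (-1)%:C%C :> C.
    by apply: complexP; rewrite /= ?cospi ?sinpi.
  rewrite /zexp E; case: n => k; rewrite ?NegzE -?exprnN -?exprnP -rmorphXn//.
  by rewrite -fmorphV.
by rewrite zexp_cis.
Qed.

(** ** Arc length *)

Lemma pi2_gt0 : 0 < 2 * pi :> R.
Proof. by rewrite mulr_gt0// pi_gt0. Qed.

Lemma pi2_neq0 : 2 * pi != 0 :> R.
Proof. by rewrite gt_eqF// pi2_gt0. Qed.

Lemma arc_lengthE (A : set T) :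
  mu A = lebesgue_measure (A `&` [set` `[- pi, pi : R]]).
Proof. by []. Qed.

Lemma arc_lengthT : mu setT = (2 * pi)%:E.
Proof.
rewrite arc_lengthE setTI lebesgue_measure_itv /= lte_fin.
by rewrite gtrN ?pi_gt0// -EFinB opprK mulr_natl mulr2n.
Qed.

Lemma arc_length_fin : (mu setT < +oo)%E.
Proof. by rewrite arc_lengthT ltry. Qed.

Lemma arc_length_itvC : mu (~` [set` `[- pi, pi : R]]) = 0%E.
Proof. by rewrite arc_lengthE setICl measure0. Qed.

Lemma aeW (P : R -> Prop) : (forall x, P x) -> {ae mu, forall x, P x}.
Proof. by move=> H; exists set0; split=> // x []. Qed.

Lemma ae_imply (P Q : R -> Prop) : (forall x, P x -> Q x) ->
  {ae mu, forall x, P x} -> {ae mu, forall x, Q x}.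
Proof. by move=> H; apply: negligibleS => x /=; apply: contra_not; exact: H. Qed.

Lemma ae_imply2 (P P' Q : R -> Prop) : (forall x, P x -> P' x -> Q x) ->
  {ae mu, forall x, P x} -> {ae mu, forall x, P' x} -> {ae mu, forall x, Q x}.
Proof.
move=> H h1 h2; apply: (negligibleS _ (negligibleU h1 h2)) => x /= nQ.
by apply: contrapT => /not_orP[/contrapT p1 /contrapT p2]; apply: nQ; exact: H.
Qed.

Lemma ae_imply3 (P P' P'' Q : R -> Prop) :
  (forall x, P x -> P' x -> P'' x -> Q x) ->
  {ae mu, forall x, P x} -> {ae mu, forall x, P' x} ->
  {ae mu, forall x, P'' x} -> {ae mu, forall x, Q x}.
Proof.
move=> H h1 h2; apply: (@ae_imply2 (fun x => P x /\ P' x)); first by move=> x [] *; exact: H.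
by apply: ae_imply2 h1 h2.
Qed.

Lemma ae_neq (z : R) : {ae mu, forall x, x != z}.
Proof.
exists [set z]; split; [by []| |by move=> x /= /negP; rewrite negbK => /eqP].
apply/eqP; rewrite eq_le measure_ge0 andbT arc_lengthE.
rewrite -(@lebesgue_measure_set1 R z) le_measure ?inE//.
exact: measurableI.
Qed.

Lemma ae_oitv : {ae mu, forall x, - pi < x < (pi : R)}.
Proof.
have h1 : {ae mu, forall x : R, - pi <= x <= pi}.
  exists (~` [set` `[- pi, pi : R]]); split.
  - by apply: measurableC.
  - exact: arc_length_itvC.
  - by move=> x /= H; rewrite in_itv.
apply: ae_imply3 (ae_neq pi) (ae_neq (- pi)) h1 => x x1 x2 /andP[x3 x4].
by rewrite !lt_neqAle x3 x4 x1 eq_sym x2.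
Qed.

Lemma arc_integralE (f : T -> R) :
  measurable_fun [set: T] f ->
  (\int[mu]_x (f x)%:E = \int[lebesgue_measure]_(x in `[(- pi)%R, pi]) (f x)%:E)%E.
Proof.
move=> mf.
have mD : measurable ([set` `[- pi, pi : R]] : set T) by [].
rewrite -[RHS](@eq_measure_integral _ _ _ _ _ mu); last first.
  by move=> A mA AD; rewrite arc_lengthE setIidl.
rewrite (_ : (\int[mu]_(x in `[(- pi)%R, pi]) (f x)%:E =
    \int[mu]_x (f x * \1_[set` `[- pi, pi : R]] x)%:E)%E); last first.
  rewrite integral_mkcond; apply: eq_integral => x _.
  by rewrite patchE indicE; case: (_ \in _); rewrite ?mulr1 ?mulr0.
apply: ae_eq_integral => //.
- exact/measurable_EFinP.
- by apply/measurable_EFinP/measurable_funM.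
- apply: ae_imply ae_oitv => x /andP[/ltW x1 /ltW x2] _.
  by rewrite indicE mem_set ?mulr1//= in_itv/= x1 x2.
Qed.

(** Lebesgue measure is determined by its values on half-open intervals, and
    the reflection of such an interval is an interval of the same length. *)
Lemma arc_length_oppr (A : set T) : measurable A ->
  mu (-%R @^-1` A) = mu A.
Proof.
move=> mA.
have mN : measurable_fun [set: T] (-%R : T -> T).
  exact: measurable_realfun.oppr_measurable.
have E : forall X, measurable X -> @lebesgue_measure R X =
     pushforward (@lebesgue_measure R) (-%R : T -> T) X.
  move=> X mX; apply: (@lebesgue_measure_unique R (pushforward (@lebesgue_measure R) (-%R : T -> T))) => //.
  move=> Y [] [a b] _ <-.
  rewrite /pushforward /=; change (lebesgue_measure `]a, b] = lebesgue_measure (-%R @^-1` [set` `]a, b]])).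
  have -> : -%R @^-1` [set` `]a, b]] = [set` `[- b, - a[] :> set R.
    by apply/seteqP; split=> x /=; rewrite !in_itv /= => /andP[h1 h2]; apply/andP; split; lra.
  rewrite !lebesgue_measure_itv /= !lte_fin ltrN2; case: ifP => // _.
  by rewrite -!EFinB opprK addrC.
rewrite !arc_lengthE [RHS]E; last by apply: measurableI.
rewrite /pushforward preimage_setI; congr (lebesgue_measure (_ `&` _)).
by apply/seteqP; split=> x /=; rewrite !in_itv /= => /andP[h1 h2]; apply/andP; split; lra.
Qed.

Lemma measurable_oppT : measurable_fun [set: T] (-%R : T -> T).
Proof. exact: measurable_realfun.oppr_measurable. Qed.

Lemma continuous_measurableT (f : R -> R) : continuous f -> measurable_fun [set: T] f.
Proof. exact: continuous_measurable_fun. Qed.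

Lemma measurable_cosM (k : R) : measurable_fun [set: T] (fun x : R => cos (k * x)).
Proof.
apply: continuous_measurableT => x.
by apply: continuous_comp; [exact: mulrl_continuous|exact: continuous_cos].
Qed.

Lemma measurable_sinM (k : R) : measurable_fun [set: T] (fun x : R => sin (k * x)).
Proof.
apply: continuous_measurableT => x.
by apply: continuous_comp; [exact: mulrl_continuous|exact: continuous_sin].
Qed.

Lemma arc_FTC (f g : R -> R) : continuous g ->
  (forall x, is_derive x 1 f (g x)) ->
  \int[mu]_x g x = f pi - f (- pi).
Proof.
move=> cg dg.
have mpi : - pi < pi :> R by have := pi_gt0 R; lra.
rewrite /Rintegral arc_integralE; last exact: continuous_measurableT.
have df x : derivable f x 1 by have := dg x.
have cf : continuous f.
  by move=> x; apply/differentiable_continuous/derivable1_diffP.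
rewrite (@continuous_FTC2 _ _ f)//.
- by apply: continuous_subspaceT.
- split=> //.
  + by apply: cvg_at_right_filter; exact: cf.
  + by apply: cvg_at_left_filter; exact: cf.
- by move=> x _; rewrite derive1E; have := dg x => /@derive_val.
Qed.

Lemma int_cos n : \int[mu]_x cos (n%:~R * x) = if n == 0 then 2 * pi else 0.
Proof.
have [->|n0] := eqVneq n 0.
  under eq_Rintegral do rewrite mulr0z mul0r cos0.
  by rewrite Rintegral_cst// arc_lengthT mul1r.
have n0R : n%:~R != 0 :> R by rewrite intr_eq0.
have dg (x : R) : is_derive x 1 (fun x => sin (n%:~R * x) / n%:~R) (cos (n%:~R * x)).
  apply: is_derive_eq.
  change (sin (n%:~R * x) * (- n%:~R ^- 2 * 0) + n%:~R^-1 * (cos (n%:~R * x) * (n%:~R * 1)) = cos (n%:~R*x) :> R).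
  by field.
rewrite (arc_FTC _ dg).
- by rewrite mulrN sinN sin_int_pi oppr0 mul0r subrr.
- by move=> x; apply: continuous_comp; [exact: mulrl_continuous|exact: continuous_cos].
Qed.

Lemma int_sin n : \int[mu]_x sin (n%:~R * x) = 0.
Proof.
have [->|n0] := eqVneq n 0.
  under eq_Rintegral do rewrite mulr0z mul0r sin0.
  by rewrite Rintegral_cst// mul0r.
have n0R : n%:~R != 0 :> R by rewrite intr_eq0.
have dg (x : R) : is_derive x 1 (fun x => - cos (n%:~R * x) / n%:~R) (sin (n%:~R * x)).
  apply: is_derive_eq.
  change (- cos (n%:~R * x) * (- n%:~R ^- 2 * 0) + n%:~R^-1 * - (- sin (n%:~R * x) * (n%:~R * 1)) = sin (n%:~R*x) :> R).
  by field.
rewrite (arc_FTC _ dg).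
- by rewrite mulrN cosN subrr.
- by move=> x; apply: continuous_comp; [exact: mulrl_continuous|exact: continuous_sin].
Qed.

Lemma ae_opp (P : R -> Prop) :
  {ae mu, forall x, P x} -> {ae mu, forall x, P (- x)}.
Proof.
move=> [A [mA A0 AP]]; exists (-%R @^-1` A : set T); split.
- by rewrite -[X in measurable X]setTI; exact: measurable_oppT.
- by rewrite arc_length_oppr.
- by move=> x /= nP; apply: AP.
Qed.

Local Notation intg g := (mu.-integrable [set: T] (EFin \o g)).

Lemma intg_meas (g : R -> R) : intg g -> measurable_fun [set: T] g.
Proof. by move=> /integrableP[/measurable_EFinP]. Qed.

Lemma int_opp (g : R -> R) : intg g -> 
  intg (fun x => g (- x)) /\ \int[mu]_x g (- x) = \int[mu]_x g x.
Proof.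
move=> ig; have mg := intg_meas ig.
have mgN : measurable_fun [set: T] (fun x => g (- x)).
  exact: (measurableT_comp mg measurable_oppT).
have PE h : (\int[pushforward mu (-%R : T -> T)]_x h x = \int[mu]_x h x)%E.
  by apply: eq_measure_integral => A mA _; exact: arc_length_oppr.
have igN : intg (fun x => g (- x)).
  apply/integrableP; split; first exact/measurable_EFinP.
  move/integrableP : ig => [_]; congr (_ < _)%E.
  rewrite -PE ge0_integral_pushforward//.
  by apply: measurableT_comp => //; exact/measurable_EFinP.
split=> //.
rewrite /Rintegral; congr fine.
rewrite -[RHS]PE integral_pushforward//; exact/measurable_EFinP.
Qed.

Lemma intg_bounded (g : R -> R) (M : R) : measurable_fun [set: T] g ->
  (forall x, `|g x| <= M) -> intg g.
Proof.
move=> mg H; apply: measurable_bounded_integrable => //; first exact: arc_length_fin.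
by exists M; split; [exact: num_real|move=> K MK x _; apply: le_trans (H x) (ltW MK)].
Qed.

Lemma intg_ae_le (g h : R -> R) : measurable_fun [set: T] h ->
  {ae mu, forall x, `|h x| <= g x} -> intg g -> intg h.
Proof.
move=> mh hg /integrableP[mg gi]; apply/integrableP; split; first exact/measurable_EFinP.
apply: le_lt_trans gi.
apply: ae_ge0_le_integral => //.
- by apply: measurableT_comp => //; exact/measurable_EFinP.
- by apply: measurableT_comp.
- by apply: ae_imply hg => x hx _; rewrite lee_fin (le_trans hx)// ler_norm.
Qed.

Lemma intg_le (g h : R -> R) : measurable_fun [set: T] h ->
  (forall x, `|h x| <= g x) -> intg g -> intg h.
Proof. by move=> mh hg; apply: intg_ae_le => //; exact: aeW. Qed.

Lemma ae_eq_int (g h : R -> R) : measurable_fun [set: T] g ->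
  measurable_fun [set: T] h ->
  {ae mu, forall x, g x = h x} -> \int[mu]_x g x = \int[mu]_x h x.
Proof.
move=> mg mh gh; rewrite /Rintegral; congr fine; apply: ae_eq_integral => //.
- exact/measurable_EFinP.
- exact/measurable_EFinP.
- by apply: ae_imply gh => x /= ->.
Qed.

End Angle.

(** * Complex functions on the circle *)

Section ComplexFunctions.
Context {R : realType}.
Local Notation C := (R[i]).
Local Notation T := (measurableTypeR R).
Local Notation mu := (arc_length R).
Local Notation F := (circle R -> C).
Local Notation intg g := (mu.-integrable [set: T] (EFin \o g)).
Implicit Types (f g h : F) (n k : int) (z w : C).

Definition modc f : R -> R := fun x => normc (f (cis x)).

Lemma cmeas_cst z : cmeasurable (fun=> z).
Proof. by split; exact: measurable_cst. Qed.

Lemma cmeasD f g : cmeasurable f -> cmeasurable g ->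
  cmeasurable (fun t => f t + g t).
Proof.
move=> [f1 f2] [g1 g2]; split.
  rewrite [X in measurable_fun _ X](_ : _ = fun x => complex.Re (f (cis x)) + complex.Re (g (cis x))).
    exact: measurable_funD.
  by apply/funext => x; rewrite cReD.
rewrite [X in measurable_fun _ X](_ : _ = fun x => complex.Im (f (cis x)) + complex.Im (g (cis x))).
  exact: measurable_funD.
by apply/funext => x; rewrite cImD.
Qed.

Lemma cmeasM f g : cmeasurable f -> cmeasurable g ->
  cmeasurable (fun t => f t * g t).
Proof.
move=> [f1 f2] [g1 g2]; split.
  rewrite [X in measurable_fun _ X](_ : _ = fun x => complex.Re (f (cis x)) * complex.Re (g (cis x)) - complex.Im (f (cis x)) * complex.Im (g (cis x))).
    by apply: measurable_funB; apply: measurable_funM.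
  by apply/funext => x; rewrite cReM.
rewrite [X in measurable_fun _ X](_ : _ = fun x => complex.Re (f (cis x)) * complex.Im (g (cis x)) + complex.Im (f (cis x)) * complex.Re (g (cis x))).
  by apply: measurable_funD; apply: measurable_funM.
by apply/funext => x; rewrite cImM.
Qed.

Lemma cmeasZ z f : cmeasurable f -> cmeasurable (fun t => z * f t).
Proof. exact: cmeasM (cmeas_cst z). Qed.

Lemma cmeasN f : cmeasurable f -> cmeasurable (fun t => - f t).
Proof.
move=> mf; rewrite (_ : (fun t => - f t) = fun t => -1 * f t); first exact: cmeasZ.
by apply/funext => t; rewrite mulN1r.
Qed.

Lemma cmeasB f g : cmeasurable f -> cmeasurable g ->
  cmeasurable (fun t => f t - g t).
Proof. by move=> mf mg; apply: cmeasD => //; exact: cmeasN. Qed.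

Lemma cmeas_conj f : cmeasurable f -> cmeasurable (fun t => (f t)^*%C).
Proof.
move=> [f1 f2]; split.
  rewrite [X in measurable_fun _ X](_ : _ = fun x => complex.Re (f (cis x)))//.
  by apply/funext => x; case: (f _).
rewrite [X in measurable_fun _ X](_ : _ = fun x => - complex.Im (f (cis x))).
  exact: measurable_funN.
by apply/funext => x; case: (f _).
Qed.

Lemma cmeas_modc f : cmeasurable f -> measurable_fun [set: T] (modc f).
Proof.
move=> [f1 f2].
rewrite (_ : modc f = fun x => Num.sqrt (complex.Re (f (cis x)) ^+ 2 + complex.Im (f (cis x)) ^+ 2)).
  apply: (measurableT_comp (continuous_measurable_fun (@sqrt_continuous R))).
  by apply: measurable_funD; apply: measurable_funX.
by apply/funext => x; rewrite /modc; case: (f _).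
Qed.

Lemma measurable_invr : measurable_fun [set: R] (fun x : R => x^-1).
Proof.
rewrite (_ : (fun x : R => x^-1) = fun x => x * (x ^+ 2) `^ (-1)).
  apply: measurable_funM => //.
  by apply: (measurableT_comp (measurable_powR (-1))); exact: measurable_funX.
apply/funext => x; rewrite powR_inv1 ?sqr_ge0// expr2.
by have [->|x0] := eqVneq x 0; [rewrite invr0 mul0r|field].
Qed.

Lemma cmeas_recip f : cmeasurable f -> cmeasurable (recip f).
Proof.
move=> [f1 f2].
have m : measurable_fun [set: T] (fun x => (complex.Re (f (cis x)) ^+ 2 + complex.Im (f (cis x)) ^+ 2)^-1).
  apply: (measurableT_comp measurable_invr).
  by apply: measurable_funD; apply: measurable_funX.
split.
  rewrite [X in measurable_fun _ X](_ : _ = fun x => complex.Re (f (cis x)) * (complex.Re (f (cis x)) ^+ 2 + complex.Im (f (cis x)) ^+ 2)^-1).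
    exact: measurable_funM.
  by apply/funext => x; rewrite /recip cReV.
rewrite [X in measurable_fun _ X](_ : _ = fun x => - (complex.Im (f (cis x)) * (complex.Re (f (cis x)) ^+ 2 + complex.Im (f (cis x)) ^+ 2)^-1)).
  by apply: measurable_funN; exact: measurable_funM.
by apply/funext => x; rewrite /recip cImV.
Qed.

Lemma tilde_cis f x : tilde f (cis x) = f (cis (- x)).
Proof. by rewrite /tilde cisN. Qed.

Lemma cmeas_tilde f : cmeasurable f -> cmeasurable (tilde f).
Proof.
move=> [f1 f2]; split.
  rewrite [X in measurable_fun _ X](_ : _ = (fun x => complex.Re (f (cis x))) \o -%R).
    exact: measurableT_comp measurable_oppT.
  by apply/funext => x /=; rewrite tilde_cis.
rewrite [X in measurable_fun _ X](_ : _ = (fun x => complex.Im (f (cis x))) \o -%R).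
  exact: measurableT_comp measurable_oppT.
by apply/funext => x /=; rewrite tilde_cis.
Qed.

Lemma cmeas_zexp n : cmeasurable (@zexp R n).
Proof.
split.
  rewrite [X in measurable_fun _ X](_ : _ = fun x => cos (n%:~R * x)).
    exact: measurable_cosM.
  by apply/funext => x; rewrite zexp_cis.
rewrite [X in measurable_fun _ X](_ : _ = fun x => sin (n%:~R * x)).
  exact: measurable_sinM.
by apply/funext => x; rewrite zexp_cis.
Qed.

Lemma cmeas_sum (I : Type) (s : seq I) (f : I -> F) :
  (forall i, cmeasurable (f i)) -> cmeasurable (fun t => \sum_(i <- s) f i t).
Proof.
move=> mf; elim: s => [|i s IH].
  by under eq_fun do rewrite big_nil; exact: cmeas_cst.
by under eq_fun do rewrite big_cons; exact: cmeasD.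
Qed.

Lemma polyfunE (r : {poly C}) t :
  polyfun r t = \sum_(i < size r) r`_i * zexp i%:Z t.
Proof. by rewrite /polyfun horner_coef; apply: eq_bigr => i _; rewrite /zexp -exprnP. Qed.

Lemma cmeas_polyfun (r : {poly C}) : cmeasurable (polyfun r).
Proof.
rewrite (_ : polyfun r = fun t => \sum_(i < size r) r`_i * zexp i%:Z t).
  by apply: cmeas_sum => i; apply: cmeasZ; exact: cmeas_zexp.
by apply/funext => t; exact: polyfunE.
Qed.

(** ** Integrable functions *)

Definition cintegrable f := cmeasurable f /\ intg (modc f).
Local Notation cint := cintegrable.

Lemma intg_Re f : cint f -> intg (fun x => complex.Re (f (cis x))).
Proof. by move=> [[mf _]]; apply: intg_le => // x; exact: le_Re_normc. Qed.

Lemma intg_Im f : cint f -> intg (fun x => complex.Im (f (cis x))).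
Proof. by move=> [[_ mf]]; apply: intg_le => // x; exact: le_Im_normc. Qed.

Lemma cint_ae_le (g : R -> R) f : cmeasurable f -> intg g ->
  {ae mu, forall x, modc f x <= g x} -> cint f.
Proof.
move=> mf ig h; split=> //; apply: (intg_ae_le _ _ ig); first exact: cmeas_modc.
by apply: ae_imply h => x; rewrite ger0_norm// normc_ge0.
Qed.

Lemma intgD (g h : R -> R) : intg g -> intg h -> intg (fun x => g x + h x).
Proof. by move=> ig ih; have := integrableD measurableT ig ih. Qed.

Lemma intgZ (k : R) (g : R -> R) : intg g -> intg (fun x => k * g x).
Proof. by move=> ig; have := integrableZl measurableT k ig. Qed.

Lemma cintD f g : cint f -> cint g -> cint (fun t => f t + g t).
Proof.
move=> [mf f1] [mg g1].
apply: (cint_ae_le _ (intgD f1 g1)); first exact: cmeasD.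
by apply: aeW => x; exact: le_normcD.
Qed.

Lemma cintM_bounded (M : R) f g : cmeasurable f ->
  {ae mu, forall x, modc f x <= M} -> cint g -> cint (fun t => f t * g t).
Proof.
move=> mf fM [mg g1].
apply: (cint_ae_le _ (intgZ M g1)); first exact: cmeasM.
by apply: ae_imply fM => x; rewrite /modc normcM => h; rewrite ler_wpM2r// normc_ge0.
Qed.

Lemma cintZ z f : cint f -> cint (fun t => z * f t).
Proof.
by apply: (@cintM_bounded (normc z)); [exact: cmeas_cst|exact: aeW].
Qed.

Lemma cintN f : cint f -> cint (fun t => - f t).
Proof.
move=> /(cintZ (-1)); rewrite (_ : (fun t => -1 * f t) = fun t => - f t)//.
by apply/funext => t; rewrite mulN1r.
Qed.

Lemma cintB f g : cint f -> cint g -> cint (fun t => f t - g t).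
Proof. by move=> cf cg; apply: cintD => //; exact: cintN. Qed.

Lemma cint_bounded (M : R) f : cmeasurable f ->
  (forall t, normc (f t) <= M) -> cint f.
Proof.
move=> mf fM; split=> //; apply: (@intg_bounded _ _ M); first exact: cmeas_modc.
by move=> x; rewrite ger0_norm /modc ?normc_ge0.
Qed.

Lemma cint_cst z : cint (fun=> z).
Proof. by apply: (@cint_bounded (normc z)); [exact: cmeas_cst|]. Qed.

Lemma cint_zexpM n f : cint f -> cint (fun t => f t * zexp n t).
Proof.
move=> cf; have := @cintM_bounded 1 (zexp n) f (cmeas_zexp n).
rewrite (_ : (fun t => zexp n t * f t) = (fun t => f t * zexp n t)); last first.
  by apply/funext => t; rewrite mulrC.
by apply=> //; apply: aeW => x; rewrite /modc normc_zexp.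
Qed.

Lemma cint_zexp n : cint (zexp n).
Proof.
by apply: (@cint_bounded 1); [exact: cmeas_zexp|move=> t; rewrite normc_zexp].
Qed.

Lemma cint_tilde f : cint f -> cint (tilde f).
Proof.
move=> [mf f1]; split; first exact: cmeas_tilde.
have [h _] := int_opp f1.
by rewrite (_ : modc (tilde f) = fun x => modc f (- x))//; apply/funext => x; rewrite /modc tilde_cis.
Qed.

Lemma cint_conj f : cint f -> cint (fun t => (f t)^*%C).
Proof.
move=> [mf f1]; split; first exact: cmeas_conj.
rewrite (_ : modc _ = modc f)//.
by apply/funext => x; rewrite /modc normc_conj.
Qed.

(** ** The integral *)

Lemma circle_int_aeq f g : cmeasurable f -> cmeasurable g -> aeq f g ->
  circle_int f = circle_int g.
Proof.
move=> [f1 f2] [g1 g2] fg; apply: complexP => /=; apply: ae_eq_int => //;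
  by apply: ae_imply fg => x ->.
Qed.

Lemma circle_intD f g : cint f -> cint g ->
  circle_int (fun t => f t + g t) = circle_int f + circle_int g.
Proof.
move=> cf cg; apply: complexP; rewrite ?cReD ?cImD /=.
  under eq_Rintegral do rewrite cReD.
  by rewrite RintegralD//; exact: intg_Re.
under eq_Rintegral do rewrite cImD.
by rewrite RintegralD//; exact: intg_Im.
Qed.

Lemma circle_intZ z f : cint f ->
  circle_int (fun t => z * f t) = z * circle_int f.
Proof.
move=> cf; have i1 := intg_Re cf; have i2 := intg_Im cf.
apply: complexP; rewrite ?cReM ?cImM /=.
  under eq_Rintegral do rewrite cReM.
  rewrite RintegralB//; [|exact: intgZ|exact: intgZ].
  by rewrite !RintegralZl.
under eq_Rintegral do rewrite cImM.
rewrite RintegralD//; [|exact: intgZ|exact: intgZ].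
by rewrite !RintegralZl.
Qed.

Lemma circle_intB f g : cint f -> cint g ->
  circle_int (fun t => f t - g t) = circle_int f - circle_int g.
Proof.
move=> cf cg; rewrite -[- circle_int g]mulN1r -circle_intZ// -circle_intD//; last exact: cintZ.
by congr circle_int; apply/funext => t; rewrite mulN1r.
Qed.

Lemma circle_int_sum (I : Type) (s : seq I) (f : I -> F) :
  (forall i, cint (f i)) ->
  cint (fun t => \sum_(i <- s) f i t) /\
  circle_int (fun t => \sum_(i <- s) f i t) = \sum_(i <- s) circle_int (f i).
Proof.
move=> cf; elim: s => [|i s [IH1 IH2]].
  under eq_fun do rewrite big_nil; split; first exact: cint_cst.
  rewrite big_nil; under [fun _ => _]eq_fun do rewrite -[0](mul0r (0 : C)).
  by rewrite circle_intZ ?mul0r//; exact: cint_cst.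
under eq_fun do rewrite big_cons; split; first exact: cintD.
by rewrite big_cons -IH2 circle_intD.
Qed.

Lemma normc_circle_int f : cint f ->
  normc (circle_int f) <= 2 * \int[mu]_x modc f x.
Proof.
move=> cf; apply: le_trans (le_normc_ReIm _) _; rewrite mulr_natl mulr2n /=.
apply: lerD.
  apply: le_trans (le_normr_Rintegral _ (intg_Re cf)) _ => //.
  apply: le_Rintegral => //; [exact: integrable_norm (intg_Re cf)|exact: cf.2|].
  by move=> x _; exact: le_Re_normc.
apply: le_trans (le_normr_Rintegral _ (intg_Im cf)) _ => //.
apply: le_Rintegral => //; [exact: integrable_norm (intg_Im cf)|exact: cf.2|].
by move=> x _; exact: le_Im_normc.
Qed.

Lemma circle_int_conj f : cint f ->
  circle_int (fun t => (f t)^*%C) = (circle_int f)^*%C.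
Proof.
move=> cf; apply: complexP => /=.
  by apply: eq_Rintegral => x _; case: (f _).
rewrite -[RHS]mulN1r -RintegralZl//; last exact: intg_Im.
by apply: eq_Rintegral => x _; rewrite mulN1r; case: (f _).
Qed.

Lemma circle_int_tilde f : cint f -> circle_int (tilde f) = circle_int f.
Proof.
move=> cf; apply: complexP => /=.
  rewrite -[RHS](int_opp (intg_Re cf)).2.
  by apply: eq_Rintegral => x _; rewrite tilde_cis.
rewrite -[RHS](int_opp (intg_Im cf)).2.
by apply: eq_Rintegral => x _; rewrite tilde_cis.
Qed.

Lemma circle_int_zexp n :
  circle_int (@zexp R n) = if n == 0 then (2 * pi)%:C%C else 0.
Proof.
apply: complexP => /=.
  under eq_Rintegral do rewrite zexp_cis.
  by rewrite int_cos; case: ifP.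
under eq_Rintegral do rewrite zexp_cis.
by rewrite int_sin; case: ifP.
Qed.

(** ** Fourier coefficients *)

Local Notation pi2 := ((2 * pi)^-1%:C%C : C).

Lemma fourierE f n : fourier f n = pi2 * circle_int (fun t => f t * zexp (- n) t).
Proof. by []. Qed.

Lemma fourier_aeq f g n : cmeasurable f -> cmeasurable g -> aeq f g ->
  fourier f n = fourier g n.
Proof.
move=> mf mg fg; rewrite !fourierE; congr (_ * _); apply: circle_int_aeq.
- by apply: cmeasM => //; exact: cmeas_zexp.
- by apply: cmeasM => //; exact: cmeas_zexp.
- by apply: ae_imply fg => x ->.
Qed.

Lemma fourierD f g n : cint f -> cint g ->
  fourier (fun t => f t + g t) n = fourier f n + fourier g n.
Proof.
move=> cf cg; rewrite !fourierE -mulrDr -circle_intD; [|exact: cint_zexpM..].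
by congr (_ * circle_int _); apply/funext => t; rewrite mulrDl.
Qed.

Lemma fourierZ z f n : cint f -> fourier (fun t => z * f t) n = z * fourier f n.
Proof.
move=> cf; rewrite !fourierE mulrCA -(circle_intZ z); last exact: cint_zexpM.
by congr (_ * circle_int _); apply/funext => t; rewrite mulrA.
Qed.

Lemma fourierB f g n : cint f -> cint g ->
  fourier (fun t => f t - g t) n = fourier f n - fourier g n.
Proof.
move=> cf cg; rewrite !fourierE -mulrBr -circle_intB; [|exact: cint_zexpM..].
by congr (_ * circle_int _); apply/funext => t; rewrite mulrBl.
Qed.

Lemma fourierN f n : cint f -> fourier (fun t => - f t) n = - fourier f n.
Proof.
move=> cf; rewrite (_ : (fun t => - f t) = fun t => -1 * f t).
  by rewrite fourierZ// mulN1r.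
by apply/funext => t; rewrite mulN1r.
Qed.

Lemma fourier_sum (I : Type) (s : seq I) (f : I -> F) n :
  (forall i, cint (f i)) ->
  fourier (fun t => \sum_(i <- s) f i t) n = \sum_(i <- s) fourier (f i) n.
Proof.
move=> cf; rewrite fourierE -mulr_sumr; congr (_ * _).
have /(_ (fun i => cint_zexpM (- n) (cf i)))[_ <-] := @circle_int_sum _ s (fun i t => f i t * zexp (- n) t).
by congr circle_int; apply/funext => t; rewrite mulr_suml.
Qed.

Lemma fourier_shift f n k : fourier (fun t => f t * zexp k t) n = fourier f (n - k).
Proof.
rewrite !fourierE; congr (_ * circle_int _); apply/funext => t.
by rewrite -mulrA -zexpD; congr (_ * zexp _ _); ring.
Qed.

Lemma fourier_tilde f n : cint f -> fourier (tilde f) n = fourier f (- n).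
Proof.
move=> cf; rewrite !fourierE; congr (_ * _).
rewrite -[RHS]circle_int_tilde; last exact: cint_zexpM.
congr circle_int; apply/funext => t.
by rewrite /tilde zexp_inv opprK.
Qed.

Lemma JopE f t : Jop f t = tilde f t * zexp (-1) t.
Proof. by rewrite /Jop mulrC. Qed.

Lemma cint_Jop f : cint f -> cint (Jop f).
Proof.
move=> mf; rewrite (_ : Jop f = fun t => tilde f t * zexp (-1) t); last first.
  by apply/funext => t; exact: JopE.
by apply: cint_zexpM; exact: cint_tilde.
Qed.

Lemma fourier_Jop f n : cint f -> fourier (Jop f) n = fourier f (- n - 1).
Proof.
move=> cf; rewrite (_ : Jop f = fun t => tilde f t * zexp (-1) t); last first.
  by apply/funext => t; exact: JopE.
by rewrite fourier_shift fourier_tilde//; congr (fourier _ _); ring.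
Qed.

Lemma fourier_conj f n : cint f ->
  fourier (fun t => (f t)^*%C) n = (fourier f (- n))^*%C.
Proof.
move=> cf; rewrite !fourierE.
transitivity (pi2 * (circle_int (fun t => f t * zexp (- - n) t))^*%C); last first.
  by rewrite [RHS]rmorphM; congr (_ * _); rewrite /= oppr0.
congr (_ * _).
rewrite -circle_int_conj; last exact: cint_zexpM.
by congr circle_int; apply/funext => t; rewrite rmorphM /= conj_zexp opprK.
Qed.

Lemma fourier_zexp n k : fourier (@zexp R n) k = (n == k)%:R.
Proof.
rewrite fourierE (_ : (fun t => _) = zexp (n - k)); last first.
  by apply/funext => t; rewrite -zexpD.
rewrite circle_int_zexp subr_eq0; case: eqP => _; last by rewrite mulr0.
by rewrite -rmorphM /= mulVf// pi2_neq0.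
Qed.

Lemma cint_polyfun (r : {poly C}) : cint (polyfun r).
Proof.
rewrite (_ : polyfun r = fun t => \sum_(i < size r) r`_i * zexp i%:Z t); last first.
  by apply/funext => t; exact: polyfunE.
by apply: (circle_int_sum _ _).1 => i; apply: cintZ; exact: cint_zexp.
Qed.

Lemma fourier_polyfun (r : {poly C}) n :
  fourier (polyfun r) n = if n is Posz k then r`_k else 0.
Proof.
rewrite (_ : polyfun r = fun t => \sum_(i < size r) r`_i * zexp i%:Z t); last first.
  by apply/funext => t; exact: polyfunE.
rewrite fourier_sum; last by move=> i; apply: cintZ; exact: cint_zexp.
under eq_bigr => i _ do rewrite (fourierZ _ _ (@cint_zexp i%:Z)) fourier_zexp.
case: n => k; last by rewrite big1// => i _; rewrite mulr0.
have [kr|rk] := ltnP k (size r).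
  rewrite (bigD1 (Ordinal kr))//= eqxx mulr1 big1 ?addr0// => i ik.
  rewrite (_ : _ == _ = false) ?mulr0//; apply/negbTE; apply: contra ik.
  by move=> /eqP[ik]; apply/eqP/val_inj.
rewrite nth_default// big1// => i _.
rewrite (_ : _ == _ = false) ?mulr0//; apply/negbTE/eqP => -[ik].
by have := ltn_ord i; rewrite ik ltnNge rk.
Qed.

Lemma normc_fourier f n : cint f ->
  normc (fourier f n) <= \int[mu]_x modc f x.
Proof.
move=> cf; rewrite fourierE normcM normc_real ger0_norm; last first.
  by rewrite invr_ge0 ltW// pi2_gt0.
rewrite ler_pdivrMl ?pi2_gt0//.
apply: le_trans (normc_circle_int (cint_zexpM (- n) cf)) _.
rewrite (_ : modc _ = modc f); last first.
  by apply/funext => x; rewrite /modc normcM normc_zexp mulr1.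
apply: ler_wpM2r; first by apply: Rintegral_ge0 => x _; exact: normc_ge0.
by rewrite ler_peMr// (le_trans _ (pi_ge2 R))// ler1n.
Qed.

End ComplexFunctions.

(** * The Riesz projection on polynomials *)

Section DyadicSums.
Context {R : realType}.
Implicit Types (s v x y l : R).

Let theta (a v : R) := v `^ a / (1 + v `^ a).

(** For a = min (s, 1 - s) and u = v^a, the term is at most 4 u / (1 + u)^2.
    This is comparable to the increment of u / (1 + u) when v is doubled, so
    that sums over dyadic v telescope. *)
Lemma dyadic_term s : 0 < s < 1 -> exists2 K : R, 0 < K &
  exists a : R, forall v, 0 < v ->
    v `^ s / (1 + v) <= K * (theta a (2 * v) - theta a v).
Proof.
move=> /andP[s0 s1]; pose a := Num.min s (1 - s).
have p1 : (1 : R) `^ a = 1 by rewrite powR1.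
have a0 : 0 < a by rewrite lt_min s0 subr_gt0.
have as_ : a <= s by rewrite ge_min lexx.
have as1 : a <= 1 - s by rewrite ge_min lexx orbT.
pose t : R := 2 `^ a.
have t1 : 1 < t.
  by rewrite -[X in X < _]p1 /t gt0_ltr_powR ?nnegrE//; lra.
have t10 : 0 < t - 1 by rewrite subr_gt0.
exists (4 * t / (t - 1)); first by rewrite divr_gt0// mulr_gt0// (lt_trans _ t1).
exists a => v v0; rewrite /theta (powRM a (ler0n R 2) (ltW v0)) -/t.
set u := v `^ a; have u0 : 0 < u by exact: powR_gt0.
have E1 : v `^ s / (1 + v) <= 4 * (u / (1 + u) ^+ 2).
  rewrite ler_pdivrMr ?addr_gt0//.
  have [v1|v1] := leP v 1.
    have vsu : v `^ s <= u by apply: ger_powR; rewrite ?v0.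
    have u1 : u <= 1 by rewrite -p1; apply: ge0_ler_powR; rewrite ?nnegrE// ltW.
    apply: (le_trans vsu).
    rewrite mulrA mulrAC ler_pdivlMr ?exprn_gt0 ?addr_gt0// mulrA [4 * u]mulrC -!mulrA ler_pM2l//.
    apply: (@le_trans _ _ 4); last by lra.
    nra.
  have u1 : 1 <= u by rewrite -p1; apply: ge0_ler_powR; rewrite ?nnegrE// ltW.
  have vsu : v `^ s <= v / u.
    rewrite ler_pdivlMr// /u -powRD; last by rewrite gt_eqF ?implybT ?addr_gt0.
    rewrite -[leRHS](powRr1 (ltW v0)); apply: ler_powR; [exact: ltW|lra].
  apply: (le_trans vsu).
  rewrite ler_pdivrMr//.
  have : u ^+ 2 <= 4 * (u / (1 + u) ^+ 2) * u * u ^+ 2.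
    rewrite ler_peMl ?sqr_ge0//.
    rewrite mulrA mulrAC ler_pdivlMr ?exprn_gt0 ?addr_gt0// mul1r -mulrA -expr2.
    rewrite (_ : 4 = 2 ^+ 2 :> R); last by rewrite -natrX.
    by rewrite -exprMn ler_pXn2r ?nnegrE//; lra.
  set w := 4 * _; rewrite -[X in X <= _]mul1r ler_pM2r ?exprn_gt0// => h.
  rewrite mulrAC; apply: le_trans (_ : 1 * v <= _); first by rewrite mul1r.
  apply: (@le_trans _ _ (w * u * v)); first by rewrite ler_pM2r.
  by rewrite ler_pM2l ?ler_wpDl// (lt_le_trans _ h).
apply: (le_trans E1).
have E2 : t * u / (1 + t * u) - u / (1 + u) = (t - 1) * u / ((1 + t * u) * (1 + u)).
  by field; apply/andP; split; rewrite gt_eqF// addr_gt0// mulr_gt0// (lt_trans _ t1).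
have t0 : 0 < t by exact: lt_trans t1.
have d1 : 0 < 1 + t * u by rewrite addr_gt0// mulr_gt0.
have d2 : 0 < 1 + u by rewrite addr_gt0.
have -> : 4 * t / (t - 1) * (t * u / (1 + t * u) - u / (1 + u)) =
    4 * (t * u / ((1 + t * u) * (1 + u))).
  by rewrite E2; field; rewrite !gt_eqF.
rewrite ler_pM2l// ler_pdivrMr ?exprn_gt0// mulrAC ler_pdivlMr ?mulr_gt0//.
rewrite -subr_ge0.
have -> : t * u * (1 + u) ^+ 2 - u * ((1 + t * u) * (1 + u)) = (t - 1) * (u * (1 + u)).
  by ring.
by rewrite !mulr_ge0// ltW.
Qed.

Lemma dyadic_sum s : 0 < s < 1 -> exists2 K : R, 0 < K &
  forall v (n : nat), 0 < v ->
    \sum_(j < n) (v * 2 ^+ j) `^ s / (1 + v * 2 ^+ j) <= K.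
Proof.
move=> /dyadic_term[K K0 [a H]]; exists K => // v n v0.
have v2 j : 0 < v * 2 ^+ j by rewrite mulr_gt0// exprn_gt0.
apply: (@le_trans _ _ (\sum_(j < n) K * (theta a (v * 2 ^+ j.+1) - theta a (v * 2 ^+ j)))).
  apply: ler_sum => j _.
  by rewrite exprS mulrCA; exact: H.
rewrite -mulr_sumr -[leRHS]mulr1 ler_pM2l//.
rewrite -(big_mkord xpredT (fun j => theta a (v * 2 ^+ j.+1) - theta a (v * 2 ^+ j))).
rewrite telescope_sumr// /theta.
have th (w : R) : 0 <= w `^ a / (1 + w `^ a) <= 1.
  have h := powR_ge0 w a.
  by rewrite divr_ge0 ?addr_ge0//= ler_pdivrMr ?ltr_wpDr// mul1r lerDr.
have /andP[_ h1] := th (v * 2 ^+ n).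
have /andP[h2 _] := th (v * 2 ^+ 0).
lra.
Qed.

Lemma dyadic_scale (l r : R) (n : nat) : 0 < l -> l <= r <= l * 2 ^+ n ->
  exists2 j : 'I_n.+1, l * 2 ^+ j <= r & r <= 2 * (l * 2 ^+ j).
Proof.
move=> l0; elim: n => [|n IH] /andP[h1 h2].
  exists ord0; rewrite /= expr0 mulr1// (le_trans h2)// expr0 mulr1; lra.
have [h|h] := leP r (l * 2 ^+ n).
  have [|j j1 j2] := IH; first by rewrite h1.
  by exists (widen_ord (leqnSn _) j).
exists (@Ordinal n.+2 n (leqnSn _)) => /=; first exact: ltW.
by rewrite mulrCA -exprS.
Qed.

(** The pointwise inequality behind the theorem of M. Riesz. Here rho is the
    modulus of z = x + i y, and the terms of the sum are the values of
    Re (z^2 / (z + l)) for dyadic l, weighted by l^s. Their positive parts add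
    up to O (rho^s x). Among the negative ones, the term with l close to rho
    already has the order of rho^s y^2 / rho, and rho <= x + y^2 / rho. *)
Lemma riesz_pointwise s : 0 < s < 1 -> exists K : R, 0 < K /\ exists2 K' : R, 0 < K' &
  forall (x y rho l : R) (n : nat), 0 < x -> 0 < rho -> rho ^+ 2 = x ^+ 2 + y ^+ 2 ->
    0 < l -> l <= rho <= l * 2 ^+ n ->
    rho `^ s * rho + K' * \sum_(j < n.+1) (l * 2 ^+ j) `^ s *
        ((rho ^+ 2 * x + (l * 2 ^+ j) * (x ^+ 2 - y ^+ 2)) / ((x + l * 2 ^+ j) ^+ 2 + y ^+ 2))
      <= K * (rho `^ s * x).
Proof.
move=> s01; have [K0 K00 HK] := dyadic_sum s01.
pose K' : R := 2 `^ s * 8.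
have K'0 : 0 < K' by rewrite mulr_gt0// powR_gt0.
exists (1 + K' * (2 * K0)); split; first by rewrite addr_gt0// !mulr_gt0.
exists K' => // x y rho l n x0 r0 rE l0 lr.
have [j0 j1 j2] := dyadic_scale l0 lr.
have xr : x <= rho.
  have : x ^+ 2 <= rho ^+ 2 by rewrite rE lerDl sqr_ge0.
  by rewrite ler_pXn2r// nnegrE ltW.
pose L (j : nat) := l * 2 ^+ j.
have L0 j : 0 < L j by rewrite mulr_gt0// exprn_gt0.
pose D (j : nat) := (x + L j) ^+ 2 + y ^+ 2.
have DE j : D j = rho ^+ 2 + 2 * (x * L j) + L j ^+ 2 by rewrite rE /D; ring.
have D0 j : 0 < D j by rewrite /D ltr_wpDr ?sqr_ge0// exprn_gt0// addr_gt0.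
have -> : \sum_(j < n.+1) (l * 2 ^+ j) `^ s *
        ((rho ^+ 2 * x + (l * 2 ^+ j) * (x ^+ 2 - y ^+ 2)) / ((x + l * 2 ^+ j) ^+ 2 + y ^+ 2))
   = \sum_(j < n.+1) L j `^ s * ((rho ^+ 2 * x + L j * x ^+ 2) / D j)
     - \sum_(j < n.+1) L j `^ s * (L j * y ^+ 2 / D j).
  rewrite -sumrB; apply: eq_bigr => j _; rewrite -/(L j) -/(D j).
  by rewrite -mulrBr -mulrBl; congr (_ * (_ / _)); ring.
have U : \sum_(j < n.+1) L j `^ s * ((rho ^+ 2 * x + L j * x ^+ 2) / D j) <=
    2 * K0 * (rho `^ s * x).
  apply: (@le_trans _ _ (\sum_(j < n.+1) (2 * (rho `^ s * x)) * ((l / rho * 2 ^+ j) `^ s / (1 + l / rho * 2 ^+ j)))).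
    apply: ler_sum => j _.
    have -> : l / rho * 2 ^+ j = L j / rho by rewrite mulrAC.
    have LE : L j `^ s = (L j / rho) `^ s * rho `^ s.
      by rewrite -powRM ?divfK ?gt_eqF// ?ltW// divr_gt0.
    rewrite LE.
    set A := (_ / _) `^ s; have A0 : 0 <= A by exact: powR_ge0.
    set B := rho `^ s; have B0 : 0 <= B by exact: powR_ge0.
    have -> : 2 * (B * x) * (A / (1 + L j / rho)) = A * B * (2 * x * rho / (rho + L j)).
      by field; rewrite !gt_eqF//= ?addr_gt0// ?gt_eqF.
    apply: ler_wpM2l; first exact: mulr_ge0.
    rewrite ler_pdivrMr// [leRHS]mulrAC ler_pdivlMr ?addr_gt0//.
    have h : (rho ^+ 2 * x + L j * x ^+ 2) * (rho + L j) <= x * rho * (rho + L j) ^+ 2.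
      rewrite (_ : x * rho * (rho + L j) ^+ 2 = (x * rho * (rho + L j)) * (rho + L j)); last by ring.
      rewrite ler_pM2r ?addr_gt0//.
      have : L j * x ^+ 2 <= L j * (x * rho) by rewrite ler_pM2l// expr2 ler_pM2l.
      by rewrite expr2; nra.
    apply: (le_trans h).
    rewrite (_ : 2 * x * rho * D j = x * rho * (2 * D j)); last by ring.
    rewrite ler_pM2l ?mulr_gt0// DE.
    have : 0 < x * L j by rewrite mulr_gt0.
    have := sqr_ge0 (rho - L j); nra.
  rewrite -mulr_sumr [leRHS](_ : _ = 2 * (rho `^ s * x) * K0); last by ring.
  apply: ler_wpM2l; first by rewrite !mulr_ge0 ?powR_ge0// ltW.
  by apply: HK; rewrite divr_gt0.
have Lo : rho `^ s * (y ^+ 2 / rho) <= K' * \sum_(j < n.+1) L j `^ s * (L j * y ^+ 2 / D j).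
  rewrite (bigD1 j0)//= mulrDr; apply: ler_wpDr.
    apply: mulr_ge0; first exact: ltW.
    apply: sumr_ge0 => j _.
    apply: mulr_ge0; first exact: powR_ge0.
    apply: divr_ge0; last exact: ltW.
    by apply: mulr_ge0; [exact: ltW|exact: sqr_ge0].
  rewrite /K' -/(L j0).
  have h1 : rho `^ s <= 2 `^ s * L j0 `^ s.
    rewrite -powRM; [|lra|exact: ltW].
    apply: ge0_ler_powR; rewrite ?nnegrE ?mulr_ge0//; try exact: ltW.
    by case/andP: s01 => /ltW.
  have DL : D j0 <= 4 * rho ^+ 2.
    rewrite DE.
    have : x * L j0 <= rho * rho by apply: ler_pM => //; apply: ltW.
    have : L j0 ^+ 2 <= rho ^+ 2 by rewrite ler_pXn2r ?nnegrE// ltW.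
    by rewrite !expr2; nra.
  have h2 : y ^+ 2 / rho <= 8 * (L j0 * y ^+ 2 / D j0).
    rewrite ler_pdivrMr//.
    rewrite (_ : _ * rho = y ^+ 2 * (8 * rho * L j0) / D j0); last by ring.
    rewrite ler_pdivlMr//.
    apply: ler_wpM2l; first exact: sqr_ge0.
    apply: (le_trans DL); rewrite expr2.
    have := ler_pM2l r0 rho (2 * L j0); rewrite j2 => /esym; nra.
  rewrite (_ : 2 `^ s * 8 * _ = (2 `^ s * L j0 `^ s) * (8 * (L j0 * y ^+ 2 / D j0))); last by ring.
  by apply: ler_pM => //; [exact: powR_ge0|rewrite divr_ge0 ?sqr_ge0// ltW].
have rs : 0 <= rho `^ s by exact: powR_ge0.
have rr : rho `^ s * rho <= rho `^ s * x + rho `^ s * (y ^+ 2 / rho).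
  rewrite -mulrDr; apply: ler_wpM2l => //.
  rewrite -(@ler_pM2r _ rho)// mulrDl divfK ?gt_eqF// -expr2 rE lerD2r expr2.
  by rewrite ler_pM2l.
have := ler_wpM2l (ltW K'0) U.
set S1 := \sum_(j < n.+1) L j `^ s * (_ / _) in U *.
set S2 := \sum_(j < n.+1) L j `^ s * (L j * y ^+ 2 / D j) in Lo *.
rewrite mulrBr mulrDl mul1r; lra.
Qed.

(** Either rho <= 2 K x, or the left side is at most half of rho^s rho, which
    can be absorbed when this bounds an integral of rho^s rho itself. *)
Lemma young_absorb s (K rho x : R) : 0 < s -> 0 < K -> 0 <= x -> 0 <= rho ->
  K * (rho `^ s * x) <= rho `^ s * rho / 2 + K * (2 * K) `^ s * (x `^ s * x).
Proof.
move=> s0 K0 x0 r0.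
have rs : 0 <= rho `^ s by exact: powR_ge0.
have [h|h] := leP rho (2 * K * x).
  apply: ler_wpDl; first by rewrite divr_ge0// mulr_ge0.
  rewrite -mulrA ler_pM2l// mulrA ler_wpM2r// -powRM//; last by rewrite mulr_ge0// ltW.
  by apply: ge0_ler_powR; rewrite ?nnegrE ?mulr_ge0// ltW.
apply: ler_wpDr; first by rewrite !mulr_ge0 ?powR_ge0// ltW.
by rewrite mulrCA -mulrA ler_wpM2l//; lra.
Qed.

End DyadicSums.

Section MeanValues.
Context {R : realType}.
Local Notation C := (R[i]).
Local Notation T := (measurableTypeR R).
Local Notation mu := (arc_length R).
Local Notation F := (circle R -> C).
Local Notation intg g := (mu.-integrable [set: T] (EFin \o g)).

(** The class in which polynomials live: it is stable under all operations
    used on them and leaves no integrability condition to check. *)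
Definition bmeas (g : R -> R) :=
  measurable_fun [set: T] g /\ exists M, forall x, `|g x| <= M.

Lemma bmeas_intg g : bmeas g -> intg g.
Proof. by move=> [mg [M gM]]; exact: intg_bounded gM. Qed.

Lemma bmeas_cst k : bmeas (fun=> k).
Proof. by split; [exact: measurable_cst|exists `|k|]. Qed.

Lemma bmeasD g h : bmeas g -> bmeas h -> bmeas (fun x => g x + h x).
Proof.
move=> [mg [M gM]] [mh [N hN]]; split; first exact: measurable_funD.
by exists (M + N) => x; rewrite (le_trans (ler_normD _ _))// lerD.
Qed.

Lemma bmeasM g h : bmeas g -> bmeas h -> bmeas (fun x => g x * h x).
Proof.
move=> [mg [M gM]] [mh [N hN]]; split; first exact: measurable_funM.
by exists (M * N) => x; rewrite normrM ler_pM.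
Qed.

Lemma bmeasZ k g : bmeas g -> bmeas (fun x => k * g x).
Proof. exact: bmeasM (bmeas_cst k). Qed.

Lemma bmeasN g : bmeas g -> bmeas (fun x => - g x).
Proof.
move=> [mg [M gM]]; split; first exact: measurable_funN.
by exists M => x; rewrite normrN.
Qed.

Lemma bmeasB g h : bmeas g -> bmeas h -> bmeas (fun x => g x - h x).
Proof. by move=> bg bh; apply: bmeasD => //; exact: bmeasN. Qed.

Lemma bmeas_norm g : bmeas g -> bmeas (fun x => `|g x|).
Proof.
move=> [mg [M gM]]; split; first exact: measurableT_comp.
by exists M => x; rewrite normr_id.
Qed.

Lemma bmeas_powR g p : 0 <= p -> (forall x, 0 <= g x) -> bmeas g -> bmeas (fun x => g x `^ p).
Proof.
move=> p0 g0 [mg [M gM]]; split.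
  exact: (measurableT_comp (measurable_powR p)).
exists (M `^ p) => x; rewrite ger0_norm ?powR_ge0//.
have M0 : 0 <= M by apply: le_trans (gM x).
apply: ge0_ler_powR; rewrite ?nnegrE//.
by apply: le_trans (gM x); exact: ler_norm.
Qed.

Lemma bmeasV g (e : R) : 0 < e -> (forall x, e <= g x) -> bmeas g ->
  bmeas (fun x => (g x)^-1).
Proof.
move=> e0 ge [mg _]; split; first exact: (measurableT_comp measurable_invr).
exists e^-1 => x; have g0 : 0 < g x by exact: lt_le_trans (ge x).
by rewrite ger0_norm ?lef_pV2 ?invr_ge0//; exact: ltW.
Qed.

Lemma bmeas_sum (I : Type) (s : seq I) (g : I -> R -> R) :
  (forall i, bmeas (g i)) -> bmeas (fun x => \sum_(i <- s) g i x).
Proof.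
move=> bg; elim: s => [|i s IH].
  by under eq_fun do rewrite big_nil; exact: bmeas_cst.
by under eq_fun do rewrite big_cons; exact: bmeasD.
Qed.

Lemma intD g h : bmeas g -> bmeas h ->
  \int[mu]_x (g x + h x) = \int[mu]_x g x + \int[mu]_x h x.
Proof. by move=> bg bh; rewrite RintegralD//; exact: bmeas_intg. Qed.

Lemma intZ k g : bmeas g -> \int[mu]_x (k * g x) = k * \int[mu]_x g x.
Proof. by move=> bg; rewrite RintegralZl//; exact: bmeas_intg. Qed.

Lemma int_cst k : \int[mu]_x k = 2 * pi * k.
Proof. by rewrite Rintegral_cst// arc_lengthT mulrC. Qed.

Lemma int_le g h : bmeas g -> bmeas h -> (forall x, g x <= h x) ->
  \int[mu]_x g x <= \int[mu]_x h x.
Proof.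
move=> bg bh gh; apply: le_Rintegral => //; by [exact: bmeas_intg|move=> x _; exact: gh].
Qed.

Lemma polyfun_bounded (r : {poly C}) : exists2 M : R, 0 < M & forall t, normc (polyfun r t) <= M.
Proof.
elim/poly_ind: r => [|r c [M M0 IH]].
  by exists 1 => // t; rewrite /polyfun horner0 normc0.
exists (M + normc c) => [|t]; first by rewrite ltr_wpDr ?normc_ge0.
rewrite /polyfun hornerMXaddC (le_trans (le_normcD _ _))// lerD2r.
by rewrite normcM normc_val mulr1; exact: IH.
Qed.

Lemma bmeas_modc (f : F) (M : R) : cmeasurable f -> (forall t, normc (f t) <= M) -> bmeas (modc f).
Proof.
move=> mf fM; split; first exact: cmeas_modc.
by exists M => x; rewrite ger0_norm /modc ?normc_ge0.
Qed.

Lemma bmeas_Re (f : F) (M : R) : cmeasurable f -> (forall t, normc (f t) <= M) ->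
  bmeas (fun x => complex.Re (f (cis x))).
Proof.
move=> [mf _] fM; split=> //.
by exists M => x; apply: le_trans (le_Re_normc _) _.
Qed.

Lemma int_Re (f : F) : cintegrable f -> \int[mu]_x complex.Re (f (cis x)) = 2 * pi * complex.Re (fourier f 0).
Proof.
move=> cf; rewrite fourierE cReM /= mul0r subr0 mulrA mulfV ?pi2_neq0// mul1r.
by apply: eq_Rintegral => x _; rewrite oppr0 zexp0 mulr1.
Qed.

Lemma geometric_to0 (x K : R) : 0 <= x < 1 -> forall e, 0 < e -> exists n : nat, K * x ^+ n < e.
Proof.
move=> /andP[x0 x1] e e0.
have : (K * x ^+ n) @[n --> \oo] --> (0 : R).
  rewrite -[X in _ --> X](mulr0 K); apply: cvgMr.
  by apply: cvg_expr; rewrite ger0_norm.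
move=> /cvgrPdist_lt/(_ e e0)[N _ /(_ N (leqnn N))] /=; rewrite sub0r normrN => h.
by exists N; apply: le_lt_trans h; exact: ler_norm.
Qed.

(** 1 / G is a uniform limit of polynomials: G maps the circle into a disc
    with centre A > 0 large and radius less than A, so that 1 / G is the sum of
    a geometric series in w = 1 - G / A. *)
Lemma mean_recip (G : {poly C}) (e : R) : 0 < e ->
  (forall t, e <= complex.Re (polyfun G t)) ->
  G`_0 * fourier (recip (polyfun G)) 0 = 1.
Proof.
move=> e0 Ge; have [M M0 GM] := polyfun_bounded G.
pose A : R := M ^+ 2 / e + e.
have A0 : 0 < A by rewrite addr_gt0// divr_gt0// exprn_gt0.
have AC : A%:C%C != 0 :> C by apply/eqP => -[]; by apply/eqP; rewrite gt_eqF.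
pose w : {poly C} := 1 - (A^-1)%:C%C *: G.
have wE t : polyfun w t = 1 - (A^-1)%:C%C * polyfun G t.
  by rewrite /polyfun !hornerE.
pose rho2 : R := 1 - e / A.
have Ae : e < A by rewrite ltrDr divr_gt0// exprn_gt0.
have rho20 : 0 <= rho2 by rewrite subr_ge0 ler_pdivrMr// mul1r ltW.
have rho21 : rho2 < 1 by rewrite ltrBlDr ltrDl divr_gt0.
have w2 t : normc (polyfun w t) ^+ 2 <= rho2.
  rewrite wE normc2E cReD cImD cReN cImN cReM cImM /=.
  have h1 := Ge t; have h2 : normc (polyfun G t) ^+ 2 <= M ^+ 2.
    by rewrite ler_pXn2r ?nnegrE ?normc_ge0//; exact: ltW.
  rewrite normc2E in h2.
  move: h1 h2; set x := complex.Re _; set y := complex.Im _ => h1 h2.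
  rewrite (_ : _ + _ = 1 - A^-1 * (2 * x - A^-1 * (x ^+ 2 + y ^+ 2))); last by ring.
  rewrite lerD2l lerN2 mulrC ler_pM2l ?invr_gt0//.
  suff : A^-1 * (x ^+ 2 + y ^+ 2) <= e by lra.
  rewrite mulrC ler_pdivrMr// /A mulrDr mulrCA mulfV ?gt_eqF// mulr1.
  by apply: (le_trans h2); rewrite lerDl sqr_ge0.
pose rho := Num.sqrt rho2.
have rho01 : 0 <= rho < 1 by rewrite sqrtr_ge0/= -sqrtr1 ltr_sqrt.
have w1 t : normc (polyfun w t) <= rho.
  by rewrite -[normc _]ger0_norm ?normc_ge0// -sqrtr_sqr ler_wsqrtr.
have wX k t : polyfun (w ^+ k) t = polyfun w t ^+ k by rewrite /polyfun horner_exp.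
have wX0 k : (w ^+ k)`_0 = w`_0 ^+ k by rewrite -!horner_coef0 horner_exp.
have G0 t : polyfun G t != 0.
  by apply/eqP => G0; have := Ge t; rewrite G0 /= leNgt e0.
have mG : cmeasurable (recip (polyfun G)) by apply: cmeas_recip; exact: cmeas_polyfun.
have GB t : normc (recip (polyfun G) t) <= e^-1.
  rewrite /recip normcV lef_pV2 ?posrE ?normc_gt0//.
  by apply: le_trans (le_trans (ler_norm _) (le_Re_normc _)).
have cG := cint_bounded mG GB.
pose u k : F := fun t => polyfun (w ^+ k) t * recip (polyfun G) t.
have mu_ k : cmeasurable (u k) by apply: cmeasM => //; exact: cmeas_polyfun.
have uB k t : normc (u k t) <= rho ^+ k * e^-1.
  rewrite normcM; apply: ler_pM; rewrite ?normc_ge0//.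
  by rewrite wX normcX lerXn2r// nnegrE ?normc_ge0//; case/andP: rho01.
have cu k := cint_bounded (mu_ k) (uB k).
have AiE : (A^-1)%:C%C = A%:C%C^-1 :> C by rewrite fmorphV.
have ru k t : A%:C%C * (u k t - u k.+1 t) = polyfun (w ^+ k) t.
  rewrite /u !wX exprS; set X := _ ^+ k; rewrite wE /recip AiE; field.
  by rewrite G0 AC.
have ra k : A%:C%C * (fourier (u k) 0 - fourier (u k.+1) 0) = w`_0 ^+ k.
  rewrite -fourierB// -fourierZ; last exact: cintB.
  rewrite (_ : (fun t => _) = polyfun (w ^+ k)); last by apply/funext => t; exact: ru.
  by rewrite fourier_polyfun -wX0.
have G0E : G`_0 = A%:C%C * (1 - w`_0).
  rewrite /w coefB coefC eqxx coefZ AiE; field; exact: AC.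
have E n : G`_0 * fourier (u 0%N) 0 - 1 = G`_0 * fourier (u n) 0 - w`_0 ^+ n.
  elim: n => [|n ->]; first by rewrite expr0.
  by rewrite exprS -(ra n) G0E; ring.
have u0E : u 0%N = recip (polyfun G).
  by apply/funext => t; rewrite /u wX expr0 mul1r.
rewrite -u0E; apply/eqP; rewrite -subr_eq0; apply/eqP.
apply: (@normc_le_eps _ _ 1) => // d d0.
pose K : R := normc (G`_0) * (2 * pi * e^-1) + 2 * pi.
have [n nd] := @geometric_to0 rho K rho01 d d0.
rewrite mul1r (E n); apply: le_trans (ltW nd).
apply: le_trans (le_normcD _ _) _; rewrite normcN normcM /K mulrDl.
have B f (L : R) : cmeasurable f -> (forall t, normc (f t) <= L) ->
    normc (fourier f 0) <= 2 * pi * L.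
  move=> mf fL; apply: le_trans (normc_fourier _ (cint_bounded mf fL)) _.
  rewrite -int_cst; apply: int_le; [exact: bmeas_modc fL|exact: bmeas_cst|].
  by move=> x; exact: fL.
apply: lerD.
  rewrite -[leRHS]mulrA ler_wpM2l ?normc_ge0//.
  by apply: le_trans (B _ _ (mu_ n) (uB n)) _; rewrite -!mulrA [e^-1 * _]mulrC.
have -> : w`_0 ^+ n = fourier (polyfun (w ^+ n)) 0 by rewrite fourier_polyfun -wX0.
apply: B; first exact: cmeas_polyfun.
move=> t; rewrite wX normcX.
by rewrite lerXn2r// nnegrE ?normc_ge0//; case/andP: rho01.
Qed.

(** As G^2 / (G + l) = G - l + l^2 / (G + l), its mean is G_0^2 / (G_0 + l) by
    the previous lemma. *)
Lemma mean_sqr_div (G : {poly C}) (e l : R) : 0 < e -> 0 < l ->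
  (forall t, e <= complex.Re (polyfun G t)) -> complex.Im G`_0 = 0 ->
  0 <= \int[mu]_x complex.Re (polyfun G (cis x) ^+ 2 / (polyfun G (cis x) + l%:C%C)).
Proof.
move=> e0 l0 Ge G0r.
pose H := G + l%:C%C%:P.
have HE t : polyfun H t = polyfun G t + l%:C%C by rewrite /polyfun hornerD hornerC.
have He t : e <= complex.Re (polyfun H t).
  by rewrite HE cReD /= (le_trans (Ge t))// lerDl ltW.
have H0 t : polyfun H t != 0.
  by apply/eqP => h; have := He t; rewrite h /= leNgt e0.
have mH : cmeasurable (recip (polyfun H)) by apply: cmeas_recip; exact: cmeas_polyfun.
have HB t : normc (recip (polyfun H) t) <= e^-1.
  rewrite /recip normcV lef_pV2 ?posrE ?normc_gt0//.
  by apply: le_trans (le_trans (ler_norm _) (le_Re_normc _)).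
have cH := cint_bounded mH HB.
have mr := mean_recip e0 He.
have HE0 : H`_0 = G`_0 + l%:C%C by rewrite coefD coefC eqxx.
pose a := complex.Re G`_0.
have GE0 : G`_0 = a%:C%C by apply: complexP.
have a0 : 0 <= a.
  have := int_Re (cint_polyfun G); rewrite fourier_polyfun -/a => h.
  rewrite -(@pmulr_rge0 _ (2 * pi)) ?pi2_gt0// -h; apply: Rintegral_ge0 => x _.
  by apply: le_trans (Ge _); exact: ltW.
have al : a + l != 0 by rewrite gt_eqF// ltr_wpDl.
have alC : (a + l)%:C%C != 0 :> C by apply/eqP => -[]; apply/eqP.
pose f : F := fun t => polyfun (G - l%:C%C%:P) t + (l ^+ 2)%:C%C * recip (polyfun H) t.
have fE t : polyfun G t ^+ 2 / (polyfun G t + l%:C%C) = f t.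
  rewrite /f /recip HE /polyfun hornerD hornerN hornerC rmorphXn /=.
  have := H0 t; rewrite HE /polyfun => h.
  by field.
under eq_Rintegral do rewrite fE.
have cf : cintegrable f by apply: cintD; [exact: cint_polyfun|exact: cintZ].
rewrite int_Re// mulr_ge0//; first by rewrite ltW// pi2_gt0.
rewrite fourierD ?fourierZ//; [|exact: cint_polyfun|exact: cintZ].
rewrite fourier_polyfun /= coefB coefC eqxx.
have -> : fourier (recip (polyfun H)) 0 = ((a + l)^-1)%:C%C.
  apply: (mulfI alC); rewrite -[RHS]rmorphM mulfV//= -[RHS]mr HE0 GE0.
  by rewrite -rmorphD.
rewrite GE0 -rmorphB -rmorphM -rmorphD /=.
rewrite (_ : _ + _ = a ^+ 2 / (a + l)); last by field.
by rewrite divr_ge0 ?sqr_ge0// addr_ge0// ltW.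
Qed.

End MeanValues.

Section RieszPolynomials.
Context {R : realType}.
Local Notation C := (R[i]).
Local Notation mu := (arc_length R).
Local Notation F := (circle R -> C).

Lemma powRS (x p : R) : 0 <= x -> 0 < p -> x `^ (p - 1) * x = x `^ p.
Proof. by move=> x0 p0; rewrite mulrC mulr_powRB1. Qed.

Lemma Re_sqr_div (z : C) (l : R) : complex.Re (z ^+ 2 / (z + l%:C%C)) =
  ((complex.Re z ^+ 2 + complex.Im z ^+ 2) * complex.Re z
    + l * (complex.Re z ^+ 2 - complex.Im z ^+ 2))
  / ((complex.Re z + l) ^+ 2 + complex.Im z ^+ 2).
Proof.
rewrite expr2 !(cReM, cImM, cReV, cImV, cReD, cImD) /= addr0.
by ring.
Qed.

Lemma bmeas_modc_polyfun (r : {poly C}) : bmeas (modc (polyfun r)).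
Proof.
by have [M _ rM] := polyfun_bounded r; apply: bmeas_modc rM; exact: cmeas_polyfun.
Qed.

Lemma bmeas_Re_polyfun (r : {poly C}) : bmeas (fun x => complex.Re (polyfun r (cis x))).
Proof.
by have [M _ rM] := polyfun_bounded r; apply: bmeas_Re rM; exact: cmeas_polyfun.
Qed.

Lemma bmeas_Im_polyfun (r : {poly C}) : bmeas (fun x => complex.Im (polyfun r (cis x))).
Proof.
have [M _ rM] := polyfun_bounded r; split; first by case: (cmeas_polyfun r).
by exists M => x; apply: le_trans (le_Im_normc _) _.
Qed.

Lemma modc_polyfun2 (r : {poly C}) x : modc (polyfun r) x ^+ 2 =
  complex.Re (polyfun r (cis x)) ^+ 2 + complex.Im (polyfun r (cis x)) ^+ 2.
Proof. exact: normc2E. Qed.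

Lemma modc_ge0 (f : F) x : 0 <= modc f x. Proof. exact: normc_ge0. Qed.

(** The pointwise inequality is integrated with scales running from the lower
    bound e of Re r to an upper bound of its modulus. The sum over scales has
    nonnegative mean and can be dropped; the right side is absorbed. *)
Lemma riesz_positive p : 1 < p < 2 -> exists K : R, 0 < K /\
  forall (r : {poly C}) (e : R), 0 < e -> complex.Im r`_0 = 0 ->
    (forall t, e <= complex.Re (polyfun r t)) ->
    \int[mu]_x modc (polyfun r) x `^ p <=
      K * \int[mu]_x complex.Re (polyfun r (cis x)) `^ p.
Proof.
move=> /andP[p1 p2]; pose s := p - 1.
have s01 : 0 < s < 1 by rewrite /s; apply/andP; split; lra.
have [K [K0 [K' K'0 H]]] := riesz_pointwise s01.
have s0 : 0 < s by case/andP: s01.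
have p0 : 0 < p by lra.
exists (2 * (K * (2 * K) `^ s)); split; first by rewrite !mulr_gt0// powR_gt0// mulr_gt0.
move=> r e e0 r0 re.
have [M M0 rM] := polyfun_bounded r.
have [n nM] : exists n : nat, M * 2^-1 ^+ n < e.
  by apply: geometric_to0 => //; apply/andP; split; lra.
have {}nM : M <= e * 2 ^+ n.
  by rewrite exprVn ltr_pdivrMr ?exprn_gt0// in nM; exact: ltW.
pose X x := complex.Re (polyfun r (cis x)).
pose Y x := complex.Im (polyfun r (cis x)).
pose rho := modc (polyfun r).
have X0 x : 0 < X x by exact: lt_le_trans (re _).
have Xr x : X x <= rho x by apply: le_trans (le_Re_normc _); exact: ler_norm.
have r_0 x : 0 < rho x by exact: lt_le_trans (Xr x).
pose Phi x := \sum_(j < n.+1) (e * 2 ^+ j) `^ s *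
   complex.Re (polyfun r (cis x) ^+ 2 / (polyfun r (cis x) + (e * 2 ^+ j)%:C%C)).
have el j : 0 < e * 2 ^+ j by rewrite mulr_gt0// exprn_gt0.
have bR : bmeas rho by exact: bmeas_modc_polyfun.
have bX : bmeas X by exact: bmeas_Re_polyfun.
have bY : bmeas Y by exact: bmeas_Im_polyfun.
have bT j : bmeas (fun x => complex.Re (polyfun r (cis x) ^+ 2 / (polyfun r (cis x) + (e * 2 ^+ j)%:C%C))).
  rewrite (_ : (fun _ => _) = fun x => ((X x * X x + Y x * Y x) * X x
    + (e * 2 ^+ j) * (X x * X x - Y x * Y x)) * ((X x + e * 2 ^+ j) * (X x + e * 2 ^+ j) + Y x * Y x)^-1); last first.
    by apply/funext => x; rewrite Re_sqr_div -!expr2.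
  apply: bmeasM.
    apply: bmeasD; first by apply: bmeasM => //; apply: bmeasD; apply: bmeasM.
    by apply: bmeasZ; apply: bmeasB; apply: bmeasM.
  apply: (@bmeasV _ _ (e ^+ 2)); first by rewrite exprn_gt0.
    move=> x; rewrite -!expr2; apply: ler_wpDr; first exact: sqr_ge0.
    rewrite ler_pXn2r ?nnegrE ?addr_ge0//; try exact: ltW.
    by apply: le_trans (re (cis x)) _; rewrite -/(X x) lerDl ltW.
  by apply: bmeasD; apply: bmeasM => //; apply: bmeasD => //; exact: bmeas_cst.
have bPhi : bmeas Phi by apply: bmeas_sum => j; apply: bmeasZ.
have Phi0 : 0 <= \int[mu]_x Phi x.
  rewrite /Phi.
  have -> : \int[mu]_x (\sum_(j < n.+1) (e * 2 ^+ j) `^ s *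
      complex.Re (polyfun r (cis x) ^+ 2 / (polyfun r (cis x) + (e * 2 ^+ j)%:C%C))) =
    \sum_(j < n.+1) (e * 2 ^+ j) `^ s * \int[mu]_x
      complex.Re (polyfun r (cis x) ^+ 2 / (polyfun r (cis x) + (e * 2 ^+ j)%:C%C)).
    elim: (index_enum _) => [|j l IH].
      by under eq_Rintegral do rewrite big_nil; rewrite big_nil int_cst mulr0.
    under eq_Rintegral do rewrite big_cons.
    rewrite big_cons intD ?IH ?intZ//; first exact: bmeasZ.
    by apply: bmeas_sum => i; apply: bmeasZ.
  apply: sumr_ge0 => j _; rewrite mulr_ge0 ?powR_ge0//.
  exact: mean_sqr_div e0 (el j) re r0.
have bRs : bmeas (fun x => rho x `^ s) by apply: bmeas_powR => //; [exact: ltW|move=> x; exact: ltW].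
have bXs : bmeas (fun x => X x `^ s) by apply: bmeas_powR => //; [exact: ltW|move=> x; exact: ltW].
have P x : rho x `^ s * rho x + K' * Phi x <= rho x `^ s * rho x / 2 + K * (2 * K) `^ s * (X x `^ s * X x).
  apply: le_trans (young_absorb s0 K0 (ltW (X0 x)) (ltW (r_0 x))).
  have := H (X x) (Y x) (rho x) e n (X0 x) (r_0 x) (modc_polyfun2 r x) e0.
  rewrite (le_trans (re (cis x)) (Xr x)) (le_trans (rM (cis x)) nM) => /(_ isT).
  congr (_ + K' * _ <= _); apply: eq_bigr => j _.
  by rewrite Re_sqr_div modc_polyfun2.
have I1 : \int[mu]_x rho x `^ p = \int[mu]_x (rho x `^ s * rho x).
  by apply: eq_Rintegral => x _; rewrite powRS// ltW.
have I2 : \int[mu]_x X x `^ p = \int[mu]_x (X x `^ s * X x).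
  by apply: eq_Rintegral => x _; rewrite powRS// ltW.
rewrite -/rho -/X I1 I2.
have bA : bmeas (fun x => rho x `^ s * rho x) by exact: bmeasM.
have bB : bmeas (fun x => X x `^ s * X x) by exact: bmeasM.
have := @int_le _ (fun x => rho x `^ s * rho x + K' * Phi x) (fun x => 2^-1 * (rho x `^ s * rho x) + K * (2 * K) `^ s * (X x `^ s * X x)).
rewrite intD//; last exact: bmeasZ.
rewrite intD; [|exact: bmeasZ|exact: bmeasZ].
rewrite !intZ// => /(_ _ _ _) h.
have := h (bmeasD bA (bmeasZ K' bPhi)) (bmeasD (bmeasZ _ bA) (bmeasZ _ bB)) (fun x => _).
have := mulr_ge0 (ltW K'0) Phi0.
set a := \int[mu]_x (rho x `^ s * rho x); set b := \int[mu]_x (X x `^ s * X x) => h1 h2.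
have : a + K' * \int[mu]_x Phi x <= 2^-1 * a + K * (2 * K) `^ s * b.
  by apply: h2 => x; rewrite [2^-1 * _]mulrC; exact: P.
by rewrite -mulrA; lra.
Qed.

(** ** Real trigonometric polynomials *)

(** Encoded through an analytic completion r with real mean, since r is what
    the inequality of M. Riesz estimates. *)
Definition trigpoly (g : circle R -> R) :=
  exists2 r : {poly C}, complex.Im r`_0 = 0 & forall t, g t = complex.Re (polyfun r t).

Lemma trigpolyD g h : trigpoly g -> trigpoly h -> trigpoly (fun t => g t + h t).
Proof.
move=> [r r0 gr] [r' r'0 hr]; exists (r + r'); first by rewrite coefD cImD r0 r'0 addr0.
by move=> t; rewrite gr hr /polyfun hornerD cReD.
Qed.

Lemma trigpolyZ (k : R) g : trigpoly g -> trigpoly (fun t => k * g t).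
Proof.
move=> [r r0 gr]; exists (k%:C%C *: r).
  by rewrite coefZ cImM /= r0 mulr0 mul0r addr0.
by move=> t; rewrite gr /polyfun hornerZ cReM /= mul0r subr0.
Qed.

Lemma trigpoly_cst (k : R) : trigpoly (fun=> k).
Proof.
exists (k%:C%C%:P); first by rewrite coefC.
by move=> t; rewrite /polyfun hornerC.
Qed.

Lemma trigpoly_sum (I : Type) (s : seq I) (g : I -> circle R -> R) :
  (forall i, trigpoly (g i)) -> trigpoly (fun t => \sum_(i <- s) g i t).
Proof.
move=> bg; elim: s => [|i s IH].
  by under eq_fun do rewrite big_nil; exact: trigpoly_cst.
by under eq_fun do rewrite big_cons; exact: trigpolyD.
Qed.

Lemma trigpoly_monomial (c : C) (n : int) : trigpoly (fun t => complex.Re (c * zexp n t)).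
Proof.
have pos (d : C) (k : nat) : trigpoly (fun t => complex.Re (d * zexp k.+1%:Z t)).
  exists (d *: 'X^(k.+1)); first by rewrite coefZ coefXn mulr0.
  by move=> t; rewrite /polyfun hornerZ hornerXn /zexp -exprnP.
case: n => [[|k]|k]; last 2 first.
- exact: pos.
- rewrite (_ : (fun t => _) = fun t => complex.Re (c^*%C * zexp k.+1%:Z t)); first exact: pos.
  apply/funext => t; rewrite NegzE -conj_zexp.
  by case: c (zexp _ t) => [a b] [a' b'] /=; ring.
- rewrite (_ : (fun t => _) = fun=> complex.Re c); first exact: trigpoly_cst.
  by apply/funext => t; rewrite zexp0 mulr1.
Qed.

(** By 2 Re z Re w = Re (z w) + Re (z conj w), term by term. *)
Lemma trigpolyM g h : trigpoly g -> trigpoly h -> trigpoly (fun t => g t * h t).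
Proof.
move=> [r r0 gr] [r' r'0 hr].
rewrite (_ : (fun t => g t * h t) = fun t => \sum_(i < size r) \sum_(j < size r')
   (2^-1 * complex.Re (r`_i * r'`_j * zexp (i%:Z + j%:Z) t) +
    2^-1 * complex.Re (r`_i * (r'`_j)^*%C * zexp (i%:Z - j%:Z) t))).
  apply: trigpoly_sum => i; apply: trigpoly_sum => j.
  by apply: trigpolyD; apply: trigpolyZ; exact: trigpoly_monomial.
apply/funext => t; rewrite gr hr !polyfunE.
have Resum (I : Type) (s : seq I) (f : I -> C) :
    complex.Re (\sum_(i <- s) f i) = \sum_(i <- s) complex.Re (f i).
  by elim: s => [|i s IH]; rewrite ?big_nil// !big_cons cReD IH.
rewrite !Resum mulr_suml; apply: eq_bigr => i _.
rewrite mulr_sumr; apply: eq_bigr => j _.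
rewrite !zexpD -(conj_zexp j%:Z).
case: (r`_i) (r'`_j) (zexp i%:Z t) (zexp j%:Z t) => [a1 b1] [a2 b2] [a3 b3] [a4 b4] /=.
by field.
Qed.

Lemma trigpoly_bounded g : trigpoly g -> exists2 M : R, 0 < M & forall t, `|g t| <= M.
Proof.
move=> [r _ gr]; have [M M0 rM] := polyfun_bounded r; exists M => // t.
by rewrite gr (le_trans (le_Re_normc _)).
Qed.

Lemma bmeas_trigpoly g : trigpoly g -> bmeas (fun x => g (cis x)).
Proof.
move=> [r _ gr]; rewrite (_ : (fun x => _) = fun x => complex.Re (polyfun r (cis x))).
  exact: bmeas_Re_polyfun.
by apply/funext => x.
Qed.

End RieszPolynomials.

(** ** Polynomial approximation of the sign *)

Section SmoothStep.
Context {R : realType}.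
Implicit Types (y : R) (n : nat).

(** An odd polynomial map of [-1, 1] that fixes 0 and attracts (0, 1] to 1. Its
    iterates, composed with a trigonometric polynomial, are trigonometric
    polynomials that converge to its sign. *)
Definition smoothstep y : R := (3 * y - y ^+ 3) / 2.

Lemma smoothstepN y : smoothstep (- y) = - smoothstep y.
Proof. by rewrite /smoothstep; ring. Qed.

Lemma iter_smoothstepN n y : iter n smoothstep (- y) = - iter n smoothstep y.
Proof. by elim: n => //= n ->; rewrite smoothstepN. Qed.

Lemma smoothstep_le y : 0 <= y <= 1 -> y <= smoothstep y <= 1.
Proof.
move=> /andP[y0 y1]; rewrite /smoothstep ler_pdivlMr// ler_pdivrMr//; apply/andP; split.
  rewrite -subr_ge0 (_ : _ - _ = y * (1 - y) * (1 + y)); last by ring.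
  by rewrite !mulr_ge0//; lra.
rewrite -subr_ge0 (_ : _ - _ = (1 - y) ^+ 2 * (2 + y)); last by ring.
by rewrite mulr_ge0 ?sqr_ge0//; lra.
Qed.

(** The distance to 1 shrinks at each step by a factor at most 1 - y / 2. *)
Lemma iter_smoothstep_le n y : 0 <= y <= 1 ->
  (y <= iter n smoothstep y <= 1) && (1 - iter n smoothstep y <= (1 - y / 2) ^+ n).
Proof.
move=> y01; have /andP[y0 y1] := y01.
elim: n => [|n /andP[/andP[IH1 IH2] IH3]] /=.
  by rewrite lexx y1 expr0 lerBlDr lerDl.
set z := iter n _ _ in IH1 IH2 IH3 *.
have z01 : 0 <= z <= 1 by rewrite IH2 (le_trans y0).
have /andP[h1 h2] := smoothstep_le z01.
rewrite (le_trans IH1 h1) h2 /= exprSr.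
apply: (@le_trans _ _ ((1 - z) * (1 - z / 2))).
  rewrite -subr_ge0 /smoothstep.
  rewrite (_ : _ - _ = z ^+ 2 * (1 - z) / 2); last by field.
  by rewrite divr_ge0// mulr_ge0 ?sqr_ge0//; lra.
by apply: ler_pM => //; lra.
Qed.

Lemma bernoulli_decay n (u : R) : 0 <= u <= 1 -> (1 - u) ^+ n * (1 + n%:R * u) <= 1.
Proof.
move=> /andP[u0 u1]; elim: n => [|n IH]; first by rewrite expr0 mul0r addr0 mulr1.
apply: le_trans IH; rewrite exprSr -mulrA ler_wpM2l ?exprn_ge0 ?subr_ge0//.
rewrite -subr_ge0 -natr1 (_ : _ - _ = (n%:R + 1) * u ^+ 2); last by ring.
by rewrite mulr_ge0 ?sqr_ge0// addr_ge0.
Qed.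

(** In particular y times the n-th iterate approximates |y| from below,
    uniformly within 2 / n. *)
Lemma iter_smoothstep_abs n y : `|y| <= 1 ->
  [/\ `|iter n smoothstep y| <= 1, y * iter n smoothstep y <= `|y| &
      n%:R * (`|y| - y * iter n smoothstep y) <= 2].
Proof.
wlog y0 : y / 0 <= y => [H|] y1.
  have [/H|/ltW] := leP 0 y; first by apply.
  rewrite -oppr_ge0 => /H; rewrite normrN iter_smoothstepN normrN mulrNN.
  exact.
rewrite (ger0_norm y0) in y1 *.
have y01 : 0 <= y <= 1 by rewrite y0.
have /andP[/andP[h1 h2] h3] := iter_smoothstep_le n y01.
set z := iter n _ _ in h1 h2 h3 *.
split; first by rewrite ger0_norm// (le_trans y0).
  by rewrite ler_piMr.
have -> : y - y * z = y * (1 - z) by ring.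
apply: (@le_trans _ _ (n%:R * (y * (1 - y / 2) ^+ n))).
  by rewrite ler_wpM2l// ler_wpM2l.
have hu : 0 <= y / 2 <= 1 by apply/andP; split; lra.
have := bernoulli_decay n hu.
have : 0 <= (1 - y / 2) ^+ n by apply: exprn_ge0; lra.
set w := _ ^+ n; nra.
Qed.

Lemma iter_smoothstep_cvg y : 0 < y <= 1 ->
  iter n smoothstep y @[n --> \oo] --> (1 : R).
Proof.
move=> /andP[y0 y1]; apply/cvgrPdist_le => e e0.
have y01 : 0 <= 1 - y / 2 < 1 by apply/andP; split; lra.
have : ((1 - y / 2) ^+ n) @[n --> \oo] --> (0 : R).
  by apply: cvg_expr; rewrite ger0_norm; case/andP: y01.
move=> /cvgrPdist_le/(_ e e0); apply: filterS => n /=.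
rewrite sub0r normrN ger0_norm ?exprn_ge0//; last by case/andP: y01.
have /(iter_smoothstep_le n)/andP[/andP[_ h2] h3] : 0 <= y <= 1 by rewrite ltW.
by rewrite ger0_norm ?subr_ge0//; exact: le_trans.
Qed.

(** The constant 2^p is not optimal but serves all exponents at once. *)
Lemma powR_add_le (a b p : R) : 0 <= p -> 0 <= a -> 0 <= b ->
  (a + b) `^ p <= 2 `^ p * (a `^ p + b `^ p).
Proof.
move=> p0 a0 b0.
wlog ab : a b a0 b0 / a <= b => [H|].
  have [/H|/ltW] := leP a b; first exact.
  by move=> /H; rewrite addrC [b `^ p + _]addrC; apply.
apply: (@le_trans _ _ ((2 * b) `^ p)).
  by apply: ge0_ler_powR; rewrite ?nnegrE ?addr_ge0 ?mulr_ge0//; lra.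
rewrite powRM// ler_wpM2l ?powR_ge0// lerDr powR_ge0//.
Qed.

(** Either a <= l, or a / l <= (a / l)^p. This compares means of order 1 and p
    at a scale l that can be chosen freely. *)
Lemma powR_le1 (l a p : R) : 0 < l -> 1 <= p -> 0 <= a -> a <= l + l / l `^ p * a `^ p.
Proof.
move=> l0 p1 a0; have lp : 0 < l `^ p by exact: powR_gt0.
have [h|h] := leP a l.
  by apply: ler_wpDr => //; apply: mulr_ge0; [rewrite divr_ge0// ltW|exact: powR_ge0].
apply: ler_wpDl; first exact: ltW.
have -> : l / l `^ p * a `^ p = l * (a / l) `^ p.
  have -> : (a / l) `^ p = a `^ p / l `^ p.
    rewrite powRM//; last by rewrite invr_ge0 ltW.
    by rewrite -(powRN l) -(powR_inv1 (ltW l0)) -powRrM mulN1r.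
  by rewrite mulrAC mulrA.
rewrite -ler_pdivrMl// mulrC.
by apply: le1r_powR => //; rewrite ler_pdivlMr// mul1r ltW.
Qed.

Lemma cvg_powR (p : R) (u : nat -> R) (l : R) : 0 < p -> (forall n, 0 <= u n) ->
  u n @[n --> \oo] --> l -> u n `^ p @[n --> \oo] --> l `^ p.
Proof.
move=> p0 u0 ul; have l0 : 0 <= l.
  by rewrite -(cvg_lim _ ul)//; apply: limr_ge; [exact: cvgP ul|exact: nearW].
move: l0; rewrite le_eqVlt => /predU1P[l0|l0].
  rewrite -l0 in ul *; rewrite powR0 ?gt_eqF//; apply/cvgrPdist_le => d d0.
  have d1 : 0 < d `^ p^-1 by exact: powR_gt0.
  move/cvgrPdist_le : ul => /(_ _ d1); apply: filterS => n /=.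
  rewrite !sub0r !normrN (ger0_norm (powR_ge0 _ _)) ger0_norm// => hn.
  rewrite (_ : d = (d `^ p^-1) `^ p); last by rewrite -powRrM mulVf ?gt_eqF// powRr1// ltW.
  by apply: ge0_ler_powR; rewrite ?nnegrE// ltW.
have c2 : p * ln (u n) @[n --> \oo] --> p * ln l.
  apply: cvgM; first exact: cvg_cst.
  exact: (cvg_comp _ _ ul (continuous_ln l0)).
have c1 : expR (p * ln (u n)) @[n --> \oo] --> expR (p * ln l).
  exact: (cvg_comp _ _ c2 (@continuous_expR R _)).
rewrite /powR (gt_eqF l0); apply: cvg_trans c1; apply: near_eq_cvg.
have un : \forall n \near \oo, 0 < u n by exact: (cvgr_gt _ ul _ l0).
by near=> n; rewrite gt_eqF//; near: n.
Unshelve. all: by end_near.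
Qed.

End SmoothStep.

Section RieszAllExponents.
Context {R : realType}.
Local Notation C := (R[i]).
Local Notation mu := (arc_length R).

Lemma trigpoly_smoothstep n (g : circle R -> R) : trigpoly g ->
  trigpoly (fun t => iter n smoothstep (g t)).
Proof.
move=> tg; elim: n => //= n IH.
rewrite (_ : (fun t => _) = fun t => (3 / 2) * iter n smoothstep (g t) +
  (- 2^-1) * (iter n smoothstep (g t) * (iter n smoothstep (g t) * iter n smoothstep (g t)))).
  by apply: trigpolyD; apply: trigpolyZ => //; apply: trigpolyM => //; exact: trigpolyM.
by apply/funext => t; rewrite /smoothstep; field.
Qed.

(** Equivalent to the boundedness, in the mean of order p, of the conjugate
    function on trigonometric polynomials. *)
Definition riesz_bound (p : R) := exists K : R, 0 < K /\
  forall r : {poly C}, complex.Im r`_0 = 0 ->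
    \int[mu]_x modc (polyfun r) x `^ p <=
      K * \int[mu]_x `|complex.Re (polyfun r (cis x))| `^ p.

(** With f = Re r, the trigonometric polynomial g = h + e, where h approximates
    |f| from below, makes both g and g - f positive, and r is the difference of
    their completions. *)
Lemma riesz_signed p : 1 < p < 2 -> riesz_bound p.
Proof.
move=> p12; have [K [K0 HK]] := riesz_positive p12.
have p0 : 0 < p by case/andP: p12 => /(lt_trans _) -> //.
exists (2 `^ p * (K * (2 * (2 `^ p * 2 `^ p)))); split.
  by rewrite !mulr_gt0// powR_gt0.
move=> r r0.
pose X (x : R) : R := `|complex.Re (polyfun r (cis x))|.
have bX : bmeas X by apply: bmeas_norm; exact: bmeas_Re_polyfun.
have bXp : bmeas (fun x => X x `^ p).
  by apply: bmeas_powR => //; [exact: ltW|move=> x; exact: normr_ge0].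
apply/ler_addgt0Pr => e0 e00.
pose k1 : R := 2 `^ p * (K * (2 * (2 `^ p * (2 * pi)))).
have k10 : 0 < k1 by rewrite !mulr_gt0 ?powR_gt0// pi_gt0.
pose e := (e0 / k1) `^ p^-1.
have ee0 : 0 < e0 / k1 by rewrite divr_gt0.
have eE : e `^ p = e0 / k1 by rewrite /e -powRrM mulVf ?gt_eqF// powRr1// ltW.
have e_0 : 0 < e by rewrite powR_gt0.
have tf : trigpoly (fun t => complex.Re (polyfun r t)) by exists r.
have [M M0 fM] := trigpoly_bounded tf.
pose n := (Num.truncn (4 * M / e)).+1.
have nM : 4 * M / e < n%:R by exact: truncnS_gt.
have n0 : 0 < n%:R :> R by rewrite ltr0n.
pose f t := complex.Re (polyfun r t).
pose h t := M * (M^-1 * f t * iter n smoothstep (M^-1 * f t)).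
have hE t : h t <= `|f t| /\ `|f t| - h t <= e / 2.
  have y1 : `|M^-1 * f t| <= 1.
    rewrite normrM gtr0_norm ?invr_gt0// ler_pdivrMl// mulr1; exact: fM.
  have [_ h1 h2] := iter_smoothstep_abs n y1.
  have fE : `|f t| = M * `|M^-1 * f t|.
    by rewrite normrM gtr0_norm ?invr_gt0// mulrA mulfV ?mul1r// gt_eqF.
  split; first by rewrite fE /h ler_pM2l.
  rewrite fE /h -mulrBr -(@ler_pM2l _ n%:R)// mulrCA.
  apply: (@le_trans _ _ (M * 2)); first by rewrite ler_pM2l.
  by move: nM; rewrite ltr_pdivrMr// => /ltW; lra.
have tg : trigpoly (fun t => h t + e).
  apply: trigpolyD; last exact: trigpoly_cst.
  apply: trigpolyZ; apply: trigpolyM; first exact: trigpolyZ.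
  by apply: trigpoly_smoothstep; exact: trigpolyZ.
have [r1 r10 r1E] := tg.
pose r2 := r1 - r.
have r20 : complex.Im r2`_0 = 0 by rewrite coefB cImD cImN r10 r0 subr0.
have r2E t : complex.Re (polyfun r2 t) = h t + e - f t.
  by rewrite /polyfun hornerD hornerN cReD cReN -[complex.Re _]r1E.
have rE t : polyfun r t = polyfun r1 t - polyfun r2 t.
  by rewrite /polyfun /r2 !hornerE; ring.
have e20 : 0 < e / 2 by rewrite divr_gt0.
have P1 t : e / 2 <= complex.Re (polyfun r1 t).
  by rewrite -r1E; have [_] := hE t; have := normr_ge0 (f t); lra.
have P2 t : e / 2 <= complex.Re (polyfun r2 t).
  by rewrite r2E; have [_] := hE t; have := ler_norm (f t); lra.
have Q1 t : complex.Re (polyfun r1 t) <= 2 * `|f t| + e.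
  by rewrite -r1E; have [] := hE t; have := normr_ge0 (f t); lra.
have Q2 t : complex.Re (polyfun r2 t) <= 2 * `|f t| + e.
  by rewrite r2E; have [] := hE t; have := ler_norm (- f t); rewrite normrN; lra.
have H1 := HK _ _ e20 r10 P1; have H2 := HK _ _ e20 r20 P2.
have bm q : bmeas (fun x => modc (polyfun q) x `^ p).
  by apply: bmeas_powR; [exact: ltW|move=> x; exact: modc_ge0|exact: bmeas_modc_polyfun].
have I0 : \int[mu]_x modc (polyfun r) x `^ p <= 2 `^ p *
   (\int[mu]_x modc (polyfun r1) x `^ p + \int[mu]_x modc (polyfun r2) x `^ p).
  rewrite -intD// -intZ; last exact: bmeasD.
  apply: int_le => //; first by apply: bmeasZ; exact: bmeasD.
  move=> x; apply: le_trans (powR_add_le (ltW p0) (modc_ge0 _ _) (modc_ge0 _ _)).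
  apply: ge0_ler_powR; rewrite ?nnegrE ?addr_ge0 ?modc_ge0//; first exact: ltW.
  by rewrite /modc rE (le_trans (le_normcD _ _))// normcN.
have J (q : {poly C}) : complex.Im q`_0 = 0 -> (forall t, e / 2 <= complex.Re (polyfun q t)) ->
    (forall t, complex.Re (polyfun q t) <= 2 * `|f t| + e) ->
    \int[mu]_x complex.Re (polyfun q (cis x)) `^ p <=
      2 `^ p * (2 `^ p * \int[mu]_x X x `^ p + 2 * pi * (e0 / k1)).
  move=> q0 q1 q2.
  have bq : bmeas (fun x => complex.Re (polyfun q (cis x)) `^ p).
    apply: bmeas_powR; [exact: ltW| |exact: bmeas_Re_polyfun].
    by move=> x; apply: le_trans (q1 _); exact: ltW.
  rewrite -int_cst -intZ// -intD//; [|exact: bmeasZ|exact: bmeas_cst].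
  have bs : bmeas (fun x => 2 `^ p * X x `^ p + e0 / k1).
    by apply: bmeasD; [exact: bmeasZ|exact: bmeas_cst].
  rewrite -intZ//; apply: int_le => //; first exact: bmeasZ.
  move=> x; rewrite -eE.
  apply: (@le_trans _ _ ((2 * X x + e) `^ p)).
    apply: ge0_ler_powR; rewrite ?nnegrE.
    - exact: ltW.
    - by apply: le_trans (q1 _); exact: ltW.
    - by rewrite addr_ge0 ?mulr_ge0 ?normr_ge0// ltW.
    - exact: q2.
  have X0 : 0 <= X x by exact: normr_ge0.
  apply: le_trans (powR_add_le (ltW p0) _ _) _; rewrite ?mulr_ge0//; first exact: ltW.
  by rewrite powRM.
have J1 := J _ r10 P1 Q1; have J2 := J _ r20 P2 Q2.
set I := \int[mu]_x modc (polyfun r) x `^ p in I0 *.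
set I1 := \int[mu]_x modc (polyfun r1) x `^ p in I0 H1.
set I2 := \int[mu]_x modc (polyfun r2) x `^ p in I0 H2.
rewrite -/(X _); set IX := \int[mu]_x X x `^ p in J1 J2 *.
set B := 2 `^ p * (_ + _) in J1 J2.
have I1B : I1 <= K * B by apply: le_trans H1 _; rewrite ler_pM2l.
have I2B : I2 <= K * B by apply: le_trans H2 _; rewrite ler_pM2l.
apply: (le_trans I0).
apply: (@le_trans _ _ (2 `^ p * (K * B + K * B))).
  by rewrite ler_pM2l ?powR_gt0//; exact: lerD.
rewrite le_eqVlt; apply/orP; left; apply/eqP.
have : k1 * (e0 / k1) = e0 by rewrite mulrC divfK// gt_eqF.
rewrite /B /k1; set z := e0 / _ => <-; ring.
Qed.

(** The mean of r^2 is r_0^2, hence x^2 - y^2 has nonnegative mean. *)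
Lemma riesz_square : riesz_bound 2.
Proof.
exists 2; split=> // r r0.
pose X x := complex.Re (polyfun r (cis x)).
pose Y x := complex.Im (polyfun r (cis x)).
have bX : bmeas X by exact: bmeas_Re_polyfun.
have bY : bmeas Y by exact: bmeas_Im_polyfun.
have bXX : bmeas (fun x => X x * X x) by exact: bmeasM.
have bYY : bmeas (fun x => Y x * Y x) by exact: bmeasM.
have -> : \int[mu]_x modc (polyfun r) x `^ 2 = \int[mu]_x (X x * X x + Y x * Y x).
  apply: eq_Rintegral => x _.
  by rewrite powR_mulrn ?modc_ge0// modc_polyfun2 !expr2.
have -> : \int[mu]_x `|complex.Re (polyfun r (cis x))| `^ 2 = \int[mu]_x (X x * X x).
  by apply: eq_Rintegral => x _; rewrite powR_mulrn// real_normK ?num_real// expr2.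
rewrite intD//.
have : 0 <= \int[mu]_x (X x * X x - Y x * Y x).
  have -> : \int[mu]_x (X x * X x - Y x * Y x) = \int[mu]_x complex.Re (polyfun (r ^+ 2) (cis x)).
    by apply: eq_Rintegral => x _; rewrite /polyfun horner_exp expr2 cReM.
  rewrite int_Re; last exact: cint_polyfun.
  rewrite fourier_polyfun /= -horner_coef0 horner_exp horner_coef0 expr2 cReM r0 mul0r subr0.
  by rewrite -expr2 mulr_ge0 ?sqr_ge0// ltW// pi2_gt0.
rewrite RintegralB//; [|exact: bmeas_intg..].
lra.
Qed.

(** The mean of Re r is Re r_0; the exponent is raised by choosing for the
    scale of comparison half of its modulus. *)
Lemma mean_powR (s : R) (r : {poly C}) : 1 <= s -> complex.Im r`_0 = 0 ->
  2 * pi * (`|complex.Re r`_0| / 2) `^ s <= \int[mu]_x `|complex.Re (polyfun r (cis x))| `^ s.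
Proof.
move=> s1 r0; have s0 : 0 < s by exact: lt_le_trans s1.
pose X (x : R) : R := `|complex.Re (polyfun r (cis x))|.
have bX : bmeas X by apply: bmeas_norm; exact: bmeas_Re_polyfun.
have bXs : bmeas (fun x => X x `^ s).
  by apply: bmeas_powR => //; [exact: ltW|move=> x; exact: normr_ge0].
pose l := `|complex.Re r`_0| / 2.
have [l0|l0] := eqVneq l 0.
  rewrite -/l l0 powR0 ?gt_eqF// mulr0.
  by apply: Rintegral_ge0 => x _; exact: powR_ge0.
have {}l0 : 0 < l by rewrite lt0r l0 divr_ge0.
have ls : 0 < l `^ s by exact: powR_gt0.
have h1 : 2 * pi * (2 * l) <= \int[mu]_x X x.
  rewrite (_ : 2 * l = `|complex.Re r`_0|); last by rewrite /l; field.
  have := int_Re (cint_polyfun r); rewrite fourier_polyfun /= => h.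
  have : `|\int[mu]_x complex.Re (polyfun r (cis x))| <= \int[mu]_x X x.
    by apply: le_normr_Rintegral => //; apply: bmeas_intg; exact: bmeas_Re_polyfun.
  by rewrite h normrM (gtr0_norm pi2_gt0).
have h2 : \int[mu]_x X x <= \int[mu]_x (l + l / l `^ s * X x `^ s).
  apply: int_le => //; first by apply: bmeasD; [exact: bmeas_cst|exact: bmeasZ].
  by move=> x; apply: powR_le1 => //; exact: normr_ge0.
rewrite intD in h2; [|exact: bmeas_cst|exact: bmeasZ].
rewrite int_cst intZ// in h2.
set IX := \int[mu]_x X x `^ s in h2 *; rewrite -/X -/IX -/l.
have h3 : 2 * pi * l <= l * IX / l `^ s by rewrite mulrAC; lra.
rewrite ler_pdivlMr// in h3.
by rewrite -(ler_pM2l l0); apply: le_trans h3; rewrite le_eqVlt; apply/orP; left; apply/eqP; ring.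
Qed.

(** The bound for p is applied to -i (r^2 - r_0^2), whose real part is 2 x y;
    the mixed product |x|^p |x + i y|^p is then absorbed. *)
Lemma riesz_double p : 1 < p -> riesz_bound p -> riesz_bound (2 * p).
Proof.
move=> p1; have p0 : 0 < p by exact: lt_trans p1.
have p2 : 1 <= 2 * p by lra.
have YI (c v u : R) : c * (u * v) <= 2^-1 * (v * v) + 2^-1 * c ^+ 2 * (u * u).
  by have := sqr_ge0 (v - c * u); lra.
move=> [K [K0 HK]].
pose k : R := 2 `^ p * (K * 2 `^ p).
have k0 : 0 < k by rewrite !mulr_gt0 ?powR_gt0.
exists (k ^+ 2 + 2 * (2 `^ p * 2 `^ (2 * p))); split.
  by rewrite addr_gt0 ?exprn_gt0// !mulr_gt0// powR_gt0.
move=> r r0; pose a := complex.Re r`_0.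
have aE : r`_0 = a%:C%C by apply: complexP.
pose ii : C := (0 +i* 1)%C.
pose H : {poly C} := (- ii) *: r ^+ 2 + (ii * (a ^+ 2)%:C%C)%:P.
have HE t : polyfun H t = ii * ((a ^+ 2)%:C%C - polyfun r t ^+ 2).
  by rewrite /polyfun hornerD hornerZ horner_exp hornerC; ring.
have H0 : H`_0 = 0.
  rewrite coefD coefZ coefC eqxx -horner_coef0 horner_exp horner_coef0 aE rmorphXn /=.
  by ring.
have H0i : complex.Im H`_0 = 0 by rewrite H0.
have ReH t : complex.Re (polyfun H t) = 2 * (complex.Re (polyfun r t) * complex.Im (polyfun r t)).
  by rewrite HE; case: (polyfun r t) => x y; rewrite /ii expr2 /=; ring.
pose X (x : R) : R := `|complex.Re (polyfun r (cis x))|.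
pose rho (x : R) : R := modc (polyfun r) x.
pose U x := X x `^ p; pose V x := rho x `^ p.
have X0 x : 0 <= X x by exact: normr_ge0.
have rho0 x : 0 <= rho x by exact: modc_ge0.
have bX : bmeas X by apply: bmeas_norm; exact: bmeas_Re_polyfun.
have brho : bmeas rho by exact: bmeas_modc_polyfun.
have bU : bmeas U by apply: bmeas_powR => //; exact: ltW.
have bV : bmeas V by apply: bmeas_powR => //; exact: ltW.
have bUU : bmeas (fun x => U x * U x) by exact: bmeasM.
have bVV : bmeas (fun x => V x * V x) by exact: bmeasM.
have bUV : bmeas (fun x => U x * V x) by exact: bmeasM.
have sqE (z : R) : 0 <= z -> z `^ (2 * p) = z `^ p * z `^ p.
  by move=> z0; rewrite mulrC powRrM -expr2 -powR_mulrn ?powR_ge0.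
have -> : \int[mu]_x modc (polyfun r) x `^ (2 * p) = \int[mu]_x (V x * V x).
  by apply: eq_Rintegral => x _; exact: sqE.
have EX : \int[mu]_x `|complex.Re (polyfun r (cis x))| `^ (2 * p) = \int[mu]_x (U x * U x).
  by apply: eq_Rintegral => x _; exact: sqE.
have bH : bmeas (fun x => modc (polyfun H) x `^ p).
  by apply: bmeas_powR; [exact: ltW|move=> x; exact: modc_ge0|exact: bmeas_modc_polyfun].
have S1 : \int[mu]_x (V x * V x) <= 2 `^ p * (\int[mu]_x modc (polyfun H) x `^ p + 2 * pi * (a ^+ 2) `^ p).
  rewrite -int_cst -intD//; last exact: bmeas_cst.
  rewrite -intZ; last by apply: bmeasD => //; exact: bmeas_cst.
  apply: int_le => //; first by apply: bmeasZ; apply: bmeasD => //; exact: bmeas_cst.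
  move=> x; apply: le_trans (powR_add_le (ltW p0) (modc_ge0 _ _) (sqr_ge0 a)).
  rewrite /V -powRM// -expr2; apply: ge0_ler_powR; rewrite ?nnegrE ?addr_ge0 ?sqr_ge0 ?modc_ge0//.
    exact: ltW.
  have -> : modc (polyfun H) x = normc ((a ^+ 2)%:C%C - polyfun r (cis x) ^+ 2).
    rewrite /modc HE normcM (_ : normc ii = 1) ?mul1r//.
    by rewrite /= expr0n expr1n add0r sqrtr1.
  rewrite -[X in _ + X](ger0_norm (sqr_ge0 a)) -normc_real /rho /modc -normcX.
  rewrite -(normcN (_ - _)); apply: le_trans (le_normcD _ _).
  by rewrite opprB subrK.
have S2 : \int[mu]_x modc (polyfun H) x `^ p <= K * (2 `^ p * \int[mu]_x (U x * V x)).
  apply: le_trans (HK H H0i) _; rewrite ler_pM2l// -intZ//.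
  apply: int_le; [|exact: bmeasZ|].
    apply: bmeas_powR; [exact: ltW|move=> x; exact: normr_ge0|].
    by apply: bmeas_norm; exact: bmeas_Re_polyfun.
  move=> x; rewrite /U /V -powRM// -powRM ?mulr_ge0//.
  apply: ge0_ler_powR; rewrite ?nnegrE ?mulr_ge0//; first exact: ltW.
  rewrite ReH !normrM (ger0_norm (ler0n _ 2)) ler_pM2l// ler_wpM2l//.
  exact: le_Im_normc.
have S3 : k * \int[mu]_x (U x * V x) <= 2^-1 * \int[mu]_x (V x * V x) + 2^-1 * k ^+ 2 * \int[mu]_x (U x * U x).
  rewrite -!intZ// -intD; [|exact: bmeasZ|exact: bmeasZ].
  apply: int_le; [exact: bmeasZ|by apply: bmeasD; exact: bmeasZ|].
  by move=> x; exact: YI.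
have S4 : 2 * pi * (a ^+ 2) `^ p <= 2 `^ (2 * p) * \int[mu]_x (U x * U x).
  have := mean_powR p2 r0; rewrite EX -/a => h.
  apply: le_trans (ler_wpM2l (powR_ge0 _ _) h).
  have -> : (a ^+ 2) `^ p = 2 `^ (2 * p) * (`|a| / 2) `^ (2 * p).
    rewrite -powRM ?divr_ge0// [2 * (_ / 2)]mulrC divfK// powRrM powR_mulrn//.
    by rewrite real_normK ?num_real.
  by rewrite mulrCA.
rewrite EX; set I := \int[mu]_x (V x * V x) in S1 S3 *.
set J := \int[mu]_x (U x * U x) in S3 S4 *.
set L := \int[mu]_x modc _ x `^ p in S1 S2.
set N := \int[mu]_x (U x * V x) in S2 S3.
have h1 : 2 `^ p * L <= k * N.
  have := ler_wpM2l (powR_ge0 2 p) S2; rewrite /k; lra.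
have h2 := ler_wpM2l (powR_ge0 2 p) S4.
rewrite mulrDr in S1; lra.
Qed.

(** The theorem of M. Riesz for polynomials: the exponents in (1, 2] are
    covered directly, the others by repeated doubling. *)
Lemma riesz_boundT p : 1 < p -> riesz_bound p.
Proof.
move=> p1.
have [n] : exists n : nat, p <= 2 ^+ n.+1.
  have : p <= (Num.truncn p).+1%:R by rewrite ltW// truncnS_gt.
  move=> h; exists (Num.truncn p); apply: le_trans h _.
  by rewrite -natrX ler_nat ltnW// ltn_expl.
elim: n p p1 => [|n IH] p p1 pn.
  move: pn; rewrite expr1 le_eqVlt => /predU1P[->|p2]; first exact: riesz_square.
  by apply: riesz_signed; rewrite p1.
have [p2|p2|->] := ltgtP p 2.
- by apply: riesz_signed; rewrite p1.
- have -> : p = 2 * (p / 2) by field.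
  have h1 : 1 < p / 2 by lra.
  apply: riesz_double => //; apply: IH => //.
  by rewrite exprS in pn; lra.
- exact: riesz_square.
Qed.

End RieszAllExponents.

(** * Uniqueness of Fourier coefficients and density *)

Section MonotoneClass.
Context {R : realType}.
Local Notation C := (R[i]).
Local Notation T := (measurableTypeR R).
Local Notation mu := (arc_length R).

(** A substitute for approximate identities: such a class contains the
    indicators of all measurable sets, so that a property of trigonometric
    polynomials that survives dominated convergence holds for all of them. *)
Record bounded_limit_class (Q : (R -> R) -> Prop) := BoundedLimitClass {
  blc_trig : forall g, trigpoly g -> Q (fun x => g (cis x));
  blc_lin : forall (k : R) g h, Q g -> Q h -> Q (fun x => k * g x + h x);
  blc_lim : forall (f : nat -> R -> R) (g : R -> R) (M : R), (forall n, Q (f n)) ->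
    (forall n, measurable_fun [set: T] (f n)) -> measurable_fun [set: T] g ->
    (forall n x, `|f n x| <= M) -> (forall x, `|g x| <= M) ->
    {ae mu, forall x, f n x @[n --> \oo] --> g x} -> Q g }.

Context (Q : (R -> R) -> Prop) (HQ : bounded_limit_class Q).

Lemma blc_cst k : Q (fun=> k).
Proof. by have := blc_trig HQ (trigpoly_cst k). Qed.

Lemma blc_ae g h : Q g -> bmeas g -> bmeas h ->
  {ae mu, forall x, g x = h x} -> Q h.
Proof.
move=> Qg [mg [M gM]] [mh [N hN]] gh.
apply: (@blc_lim _ HQ (fun=> g) h (Num.max M N)) => //.
- by move=> _ x; rewrite le_max gM.
- by move=> x; rewrite le_max hN orbT.
- by apply: ae_imply gh => x ->; exact: cvg_cst.
Qed.

(** The trigonometric polynomial sin (b/2) + sin (b/2 - x), equal to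
    2 cos (x/2) sin ((b - x)/2), has the sign of b - x on (-pi, pi). *)
Lemma blc_ray (b : R) : Q (\1_(`]-oo, b[%classic : set R)).
Proof.
have mI : bmeas (\1_(`]-oo, b[%classic : set R) : R -> R).
  split=> //; exists 1 => x.
  by rewrite indicE; case: (_ \in _); rewrite ?normr1 ?normr0.
have [bp|bp] := leP pi b.
  apply: (blc_ae (blc_cst 1) (bmeas_cst 1) mI).
  apply: ae_imply ae_oitv => x /andP[_ xp].
  by rewrite indicE mem_set//= in_itv/= (lt_le_trans xp).
have [pb|pb] := leP b (- pi).
  apply: (blc_ae (blc_cst 0) (bmeas_cst 0) mI).
  apply: ae_imply ae_oitv => x /andP[px _].
  rewrite indicE memNset//= in_itv/=; apply/negP; rewrite -leNgt.
  exact: le_trans (ltW px).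
pose g (t : circle R) : R := (sin (b / 2) + complex.Re (((sin (b / 2)) +i* (cos (b / 2)))%C * val t)) / 2.
have gE x : g (cis x) = cos (x / 2) * sin ((b - x) / 2).
  rewrite /g /= -sinB (_ : b / 2 - x = (b - x) / 2 - x / 2); last by field.
  rewrite (_ : b / 2 = (b - x) / 2 + x / 2); last by field.
  by rewrite sinD sinB; field.
have tg : trigpoly g.
  rewrite /g; under eq_fun do rewrite mulrC; apply: trigpolyZ; apply: trigpolyD.
    exact: trigpoly_cst.
  exact: (trigpoly_monomial _ 1).
have g1 t : `|g t| <= 1.
  rewrite /g normrM (ger0_norm (_ : 0 <= 2^-1 :> R))// ler_pdivrMr// mul1r.
  apply: le_trans (ler_normD _ _) _; apply: lerD.
    by rewrite ler_norml sin_geN1 sin_le1.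
  apply: le_trans (le_Re_normc _) _; rewrite normcM normc_val mulr1 /=.
  by rewrite addrC cos2Dsin2 sqrtr1.
pose f n x := iter n smoothstep (g (cis x)).
have Qf n : Q (f n) by apply: (blc_trig HQ (g := fun t => iter n smoothstep (g t))); exact: trigpoly_smoothstep.
have bf n : bmeas (f n).
  by apply: (@bmeas_trigpoly _ (fun t => iter n smoothstep (g t))); exact: trigpoly_smoothstep.
have f1 n x : `|f n x| <= 1 by case: (iter_smoothstep_abs n (g1 (cis x))).
pose I2 x : R := 2 * \1_(`]-oo, b[%classic : set R) x + -1.
have mI2 : measurable_fun [set: T] I2.
  by apply: measurable_funD => //; exact: measurable_funM.
have I21 x : `|I2 x| <= 1.
  rewrite /I2 indicE; case: (_ \in _); rewrite ?mulr1 ?mulr0 ?add0r ?normrN ?normr1//.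
  by rewrite (_ : 2 + -1 = 1) ?normr1//; ring.
have QI2 : Q I2.
  apply: (blc_lim HQ Qf (fun n => (bf n).1) mI2 f1 I21).
  apply: ae_imply2 ae_oitv (ae_neq b) => x /andP[px xp] xb.
  have cx : 0 < cos (x / 2) by apply: cos_gt0_pihalf; apply/andP; split; lra.
  have := g1 (cis x); rewrite ler_norml => /andP[g2 g3].
  have [xlb|] := ltP x b.
    rewrite /I2 indicE mem_set ?in_itv//= mulr1 (_ : 2 + -1 = 1); last by ring.
    apply: iter_smoothstep_cvg; rewrite g3 andbT gE mulr_gt0//.
    by apply: sin_gt0_pi; apply/andP; split; lra.
  rewrite le_eqVlt eq_sym (negbTE xb)/= => blx.
  rewrite /I2 indicE memNset/= ?in_itv/= ?mulr0 ?add0r; last first.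
    by apply/negP; rewrite -leNgt ltW.
  rewrite (_ : f ^~ x = fun n => - iter n smoothstep (- g (cis x))); last first.
    by apply/funext => n; rewrite iter_smoothstepN opprK.
  apply: cvgN; apply: iter_smoothstep_cvg.
  rewrite lerNl g2 andbT gE -mulrN -sinN mulr_gt0//.
  by apply: sin_gt0_pi; apply/andP; split; lra.
have := blc_lin HQ 2^-1 QI2 (blc_cst 2^-1).
by congr Q; apply/funext => x; rewrite /I2; field.
Qed.

(** The rays form a pi-system that generates the Borel sets, and the sets with
    indicator in Q form a Dynkin class. *)
Lemma blc_indic (E : set T) : measurable E -> Q (\1_E).
Proof.
have ME : @measurable _ T = <<s [set A : set R | exists x, A = `]-oo, x[%classic] >>.
  exact: RGenInftyO.measurableE.
move=> mE; have : <<s [set A : set R | exists x, A = `]-oo, x[%classic] >> E by rewrite -ME.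
apply: (@dynkin_induction _ T _ (fun E => Q (\1_E))) ME _ _ _ _ _ _.
- move=> _ _ [a ->] [b ->]; exists (Num.min a b).
  by apply/seteqP; split=> x /=; rewrite !in_itv/= lt_min => /andP.
- by rewrite indicT; exact: blc_cst.
- by move=> _ [b ->]; exact: blc_ray.
- move=> S mS QS.
  have := blc_lin HQ (-1) QS (blc_cst 1); congr Q.
  by apply/funext => x; rewrite !indicE in_setC; case: (x \in S) => /=; ring.
- move=> A mA tA QA.
  pose U n := \big[setU/set0]_(k < n) A k.
  have mU n : measurable (U n) by apply: bigsetU_measurable => k _; exact: mA.
  have QU n : Q (\1_(U n)).
    elim: n => [|n IH]; first by rewrite /U big_ord0 indic0; exact: blc_cst.
    have := blc_lin HQ 1 (QA n) IH; congr Q; apply/funext => x.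
    rewrite /U big_ord_recr /= -/(U n) mul1r !indicE in_setU.
    have [xn|_] := boolP (x \in A n); last by rewrite orbF add0r.
    rewrite orbT memNset ?addr0//; rewrite /U -bigcup_mkord => -[k /= kn xk].
    have := tA k n I I; rewrite inE in xn => /(_ _)/eqP.
    rewrite ltn_eqF//= => h; suff : false by []; apply: h.
    by exists x.
  apply: (@blc_lim _ HQ (fun n => \1_(U n)) _ 1 QU).
  + by move=> n; exact: measurable_indic.
  + by apply: measurable_indic; exact: bigcupT_measurable.
  + by move=> n x; rewrite indicE; case: (_ \in _); rewrite ?normr1 ?normr0.
  + by move=> x; rewrite indicE; case: (_ \in _); rewrite ?normr1 ?normr0.
  + apply: aeW => x; rewrite indicE.
    have [|xU] := boolP (x \in \bigcup_k A k); last first.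
      rewrite (_ : (fun n => _) = fun=> 0); first exact: cvg_cst.
      apply/funext => n; rewrite indicE memNset// /U -bigcup_mkord => -[k _ xk].
      by move: xU; rewrite notin_setE; apply; exists k.
    rewrite inE => -[k _ xk]; apply: cvg_near_cst.
    exists k.+1 => // n /= kn; rewrite indicE mem_set//.
    by rewrite /U -bigcup_mkord; exists k.
Qed.

End MonotoneClass.

Section Uniqueness.
Context {R : realType}.
Local Notation C := (R[i]).
Local Notation T := (measurableTypeR R).
Local Notation mu := (arc_length R).
Local Notation F := (circle R -> C).
Local Notation intg g := (mu.-integrable [set: T] (EFin \o g)).
Local Notation cint := cintegrable.

Lemma int_dct (f : nat -> R -> R) (g G : R -> R) :
  (forall n, measurable_fun [set: T] (f n)) -> measurable_fun [set: T] g ->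
  intg G -> (forall n x, `|f n x| <= G x) ->
  {ae mu, forall x, f n x @[n --> \oo] --> g x} ->
  \int[mu]_x f n x @[n --> \oo] --> \int[mu]_x g x.
Proof.
move=> mf mg iG fG fg.
have mf' n : measurable_fun [set: T] (EFin \o f n) by exact/measurable_EFinP.
have mg' : measurable_fun [set: T] (EFin \o g) by exact/measurable_EFinP.
have fg' : {ae mu, forall x, [set: T] x -> (EFin \o f n) x @[n --> \oo] --> (EFin \o g) x}.
  by apply: ae_imply fg => x h _; apply: cvg_EFin => //; exact: nearW.
have fG' : {ae mu, forall x n, [set: T] x -> (`|(EFin \o f n) x| <= (EFin \o G) x)%E}.
  by apply: aeW => x n _ /=; rewrite lee_fin.
have [ig _ h] := dominated_convergence measurableT mf' mg' fg' iG fG'.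
apply: fine_cvg; rewrite fineK; first exact: h.
exact: integrable_fin_num.
Qed.

Lemma ZfourierP (f : F) n : cint f -> fourier f (- n) = 0 ->
  circle_int (fun t => f t * zexp n t) = 0.
Proof.
move=> cf; rewrite fourierE opprK => /eqP; rewrite mulf_eq0 => /orP[|/eqP//].
by move=> /eqP[] /eqP; rewrite invr_eq0 (negbTE pi2_neq0).
Qed.

Lemma circle_int_trig (f : F) (g : circle R -> R) : cint f -> (forall n, fourier f n = 0) ->
  trigpoly g -> circle_int (fun t => (g t)%:C%C * f t) = 0.
Proof.
move=> cf f0 [r _ gr].
rewrite (_ : (fun t => _) = fun t => \sum_(i < size r) (2^-1 * r`_i * (f t * zexp i%:Z t)
   + 2^-1 * (r`_i)^*%C * (f t * zexp (- i%:Z) t))); last first.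
  apply/funext => t; rewrite gr.
  have -> : (complex.Re (polyfun r t))%:C%C = 2^-1 * (polyfun r t + (polyfun r t)^*%C).
    by rewrite addcJ mulrA mulVf ?mul1r// pnatr_eq0.
  rewrite polyfunE rmorph_sum /= -big_split /= mulr_sumr mulr_suml; apply: eq_bigr => i _.
  by rewrite rmorphM /= conj_zexp; ring.
have c1 (c : C) k : cint (fun t => 2^-1 * c * (f t * zexp k t)) by apply: cintZ; exact: cint_zexpM.
have [_ ->] := @circle_int_sum R _ (index_enum 'I_(size r)) (fun i t => 2^-1 * r`_i * (f t * zexp i%:Z t)
   + 2^-1 * (r`_i)^*%C * (f t * zexp (- i%:Z) t)) (fun i => cintD (c1 _ _) (c1 _ _)).
apply: big1 => i _; rewrite circle_intD// !circle_intZ; [|exact: cint_zexpM..].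
by rewrite !ZfourierP ?mulr0 ?addr0.
Qed.

Lemma intgM_bmeas (g h : R -> R) : bmeas g -> intg h -> intg (fun x => g x * h x).
Proof.
move=> [mg [M gM]] ih.
apply: (@intg_le _ (fun x => M * `|h x|)).
- by apply: measurable_funM => //; exact: intg_meas ih.
- by move=> x; rewrite normrM ler_wpM2r.
- by apply: intgZ; exact: integrable_norm ih.
Qed.

Lemma blc_orthogonal (h : R -> R) : intg h ->
  (forall g, trigpoly g -> \int[mu]_x (g (cis x) * h x) = 0) ->
  bounded_limit_class (fun g => bmeas g /\ \int[mu]_x (g x * h x) = 0).
Proof.
move=> ih H; split.
- by move=> g tg; split; [exact: bmeas_trigpoly|exact: H].
- move=> k g1 g2 [b1 h1] [b2 h2]; split; first by apply: bmeasD => //; exact: bmeasZ.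
  under eq_Rintegral do rewrite mulrDl -mulrA.
  rewrite RintegralD//; [|by apply: intgZ; exact: intgM_bmeas|exact: intgM_bmeas].
  by rewrite RintegralZl ?h1 ?h2 ?mulr0 ?addr0//; exact: intgM_bmeas.
- move=> f g M Qf mf mg fM gM fg.
  have bg : bmeas g by split=> //; exists M.
  split=> //.
  have : \int[mu]_x (f n x * h x) @[n --> \oo] --> \int[mu]_x (g x * h x).
    apply: (@int_dct _ _ (fun x => M * `|h x|)).
    + by move=> n; apply: measurable_funM => //; exact: intg_meas ih.
    + by apply: measurable_funM => //; exact: intg_meas ih.
    + by apply: intgZ; exact: integrable_norm ih.
    + by move=> n x; rewrite normrM ler_wpM2r.
    + by apply: ae_imply fg => x fgx; apply: cvgMr_tmp.
  rewrite (_ : (fun n => _) = fun=> 0); last by apply/funext => n; case: (Qf n).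
  by move=> /cvg_unique; apply => //; exact: cvg_cst.
Qed.

Lemma ae_eq0_indic (h : R -> R) : intg h ->
  (forall E : set T, measurable E -> \int[mu]_x (\1_E x * h x) = 0) ->
  {ae mu, forall x, h x = 0}.
Proof.
move=> ih H.
have := @integral_ae_eq _ _ _ mu setT measurableT (EFin \o (fun=> 0)) (EFin \o h) ih.
have m0 : measurable_fun [set: T] (EFin \o (fun=> 0 : R)).
  by apply/measurable_EFinP; exact: measurable_cst.
move=> /(_ m0) h0.
have {}h0 : ae_eq mu setT (EFin \o h) (EFin \o (fun=> 0)).
  apply: h0 => E _ mE; rewrite integral0 integral_mkcond.
  have iE : intg (fun x => \1_E x * h x).
    apply: (@intg_le _ (fun x => `|h x|)).
    - by apply: measurable_funM; [exact: measurable_indic|exact: intg_meas ih].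
    - move=> x; rewrite normrM indicE.
      by case: (_ \in _); rewrite ?normr1 ?normr0 ?mul1r ?mul0r.
    - exact: integrable_norm ih.
  rewrite (eq_integral (fun x => (\1_E x * h x)%:E)).
    rewrite -[LHS]fineK; last exact: (integrable_fin_num measurableT iE).
    by have := H E mE; rewrite /Rintegral => ->.
  move=> x _; rewrite patchE indicE; case: (_ \in _); by rewrite ?mul1r ?mul0r.
by apply: ae_imply h0 => x /(_ I) /= [].
Qed.

(** An integrable function all of whose Fourier coefficients vanish is
    orthogonal to the trigonometric polynomials, hence to all indicators. *)
Lemma fourier_uniqueness (f : F) : cint f -> (forall n, fourier f n = 0) ->
  aeq f (fun=> 0).
Proof.
move=> cf f0.
have key (h : R -> R) : intg h ->
    (forall g, trigpoly g -> \int[mu]_x (g (cis x) * h x) = 0) -> {ae mu, forall x, h x = 0}.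
  move=> ih H; apply: ae_eq0_indic => // E mE.
  by have [] := blc_indic (blc_orthogonal ih H) mE.
have hR := key _ (intg_Re cf); have hI := key _ (intg_Im cf).
have tr g : trigpoly g -> \int[mu]_x (g (cis x) * complex.Re (f (cis x))) = 0 /\
    \int[mu]_x (g (cis x) * complex.Im (f (cis x))) = 0.
  move=> tg; have E := circle_int_trig cf f0 tg; split.
    rewrite -[RHS]/(complex.Re (0 : C)) -E.
    by apply: eq_Rintegral => x _; rewrite cReM /= mul0r subr0.
  rewrite -[RHS]/(complex.Im (0 : C)) -E.
  by apply: eq_Rintegral => x _; rewrite cImM /= mul0r addr0.
apply: ae_imply2 (hR (fun g tg => (tr g tg).1)) (hI (fun g tg => (tr g tg).2)) => x h1 h2.
exact: complexP.
Qed.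

Lemma fourier_inj (f g : F) : cint f -> cint g ->
  (forall n, fourier f n = fourier g n) -> aeq f g.
Proof.
move=> cf cg fg; have := @fourier_uniqueness (fun t => f t - g t) (cintB cf cg).
move=> /(_ _)H; apply: ae_imply (H _) => [x /eqP|n]; first by rewrite subr_eq0 => /eqP.
by rewrite fourierB// fg subrr.
Qed.

(** ** Density of trigonometric polynomials *)

Lemma bmeas_diff_powR p (g h : R -> R) : 0 <= p -> bmeas g -> bmeas h -> bmeas (fun x => `|g x - h x| `^ p).
Proof.
move=> p0 bg bh; apply: bmeas_powR => //; apply: bmeas_norm; exact: bmeasB.
Qed.

(** Stability under limits follows from dominated convergence and the
    quasi-triangle inequality. *)
Lemma blc_dense (p : R) : 0 < p -> bounded_limit_class (fun g : R -> R => bmeas g /\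
  forall e : R, 0 < e -> exists2 t, trigpoly t & \int[mu]_x `|g x - t (cis x)| `^ p <= e).
Proof.
move=> p0; have p0' := ltW p0; have P2 : 0 < 2 `^ p :> R by exact: powR_gt0.
split.
- move=> g tg; split; first exact: bmeas_trigpoly.
  move=> e e0; exists g => //.
  under eq_Rintegral do rewrite subrr normr0 powR0 ?gt_eqF//.
  by rewrite int_cst mulr0 ltW.
- move=> k g h [bg Hg] [bh Hh]; split; first by apply: bmeasD => //; exact: bmeasZ.
  move=> e e0.
  pose c : R := 2 `^ p * (`|k| `^ p + 1).
  have c0 : 0 < c by rewrite mulr_gt0 ?powR_gt0// ltr_wpDl ?powR_ge0.
  have ec : 0 < e / c by rewrite divr_gt0.
  have [t1 tt1 h1] := Hg _ ec; have [t2 tt2 h2] := Hh _ ec.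
  exists (fun t => k * t1 t + t2 t); first by apply: trigpolyD => //; exact: trigpolyZ.
  have bt1 := bmeas_trigpoly tt1; have bt2 := bmeas_trigpoly tt2.
  have b1 := bmeas_diff_powR p0' bg bt1; have b2 := bmeas_diff_powR p0' bh bt2.
  apply: (@le_trans _ _ (2 `^ p * (`|k| `^ p * \int[mu]_x `|g x - t1 (cis x)| `^ p + \int[mu]_x `|h x - t2 (cis x)| `^ p))).
    rewrite -intZ// -intD//; last exact: bmeasZ.
    rewrite -intZ; last by apply: bmeasD => //; exact: bmeasZ.
    apply: int_le.
    + by apply: bmeas_diff_powR => //; apply: bmeasD => //; exact: bmeasZ.
    + by apply: bmeasZ; apply: bmeasD => //; exact: bmeasZ.
    + move=> x; rewrite -powRM//; apply: le_trans (powR_add_le p0' (mulr_ge0 _ _) _) => //.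
      apply: ge0_ler_powR; rewrite ?nnegrE ?addr_ge0 ?mulr_ge0//.
      by rewrite -normrM; apply: le_trans (ler_normD _ _); rewrite le_eqVlt; apply/orP; left; apply/eqP; congr `|_|; ring.
  apply: (@le_trans _ _ (2 `^ p * (`|k| `^ p * (e / c) + e / c))).
    rewrite (ler_pM2l P2); apply: (lerD _ h2); exact: (ler_wpM2l (powR_ge0 _ _) h1).
  rewrite (_ : 2 `^ p * _ = c * (e / c)); last by rewrite /c; ring.
  by rewrite mulrC divfK ?gt_eqF.
- move=> f g M Qf mf mg fM gM fg.
  have bg : bmeas g by split=> //; exists M.
  split=> // e e0.
  have bf n : bmeas (f n) by case: (Qf n).
  pose c : R := 2 `^ p * 2.
  have c0 : 0 < c by rewrite mulr_gt0 ?powR_gt0.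
  have ec : 0 < e / c by rewrite divr_gt0.
  have M0 : 0 <= M by apply: le_trans (gM 0).
  have : \int[mu]_x `|g x - f n x| `^ p @[n --> \oo] --> \int[mu]_x (0 : R).
    apply: (@int_dct _ _ (fun=> (M + M) `^ p)).
    + by move=> n; exact: (bmeas_diff_powR p0' bg (bf n)).1.
    + exact: measurable_cst.
    + by apply: bmeas_intg; exact: bmeas_cst.
    + move=> n x; rewrite ger0_norm ?powR_ge0//; apply: ge0_ler_powR; rewrite ?nnegrE ?addr_ge0//.
      by apply: le_trans (ler_normB _ _) _; exact: lerD.
    + apply: ae_imply fg => x fgx.
      have h : `|g x - f n x| @[n --> \oo] --> (0 : R).
        rewrite -(normr0 R) -(subrr (g x)); apply: cvg_norm.
        by apply: cvgB => //; exact: cvg_cst.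
      by rewrite -[X in _ --> X](powR0 (lt0r_neq0 p0)); exact: cvg_powR.
  rewrite int_cst mulr0 => /cvgrPdist_le/(_ _ ec)[n _ /(_ n (leqnn n))] /=.
  rewrite sub0r normrN ger0_norm; last by apply: Rintegral_ge0 => x _; exact: powR_ge0.
  move=> h1; have [t tt h2] := (Qf n).2 _ ec; exists t => //.
  have bt := bmeas_trigpoly tt.
  have b1 := bmeas_diff_powR p0' bg (bf n); have b2 := bmeas_diff_powR p0' (bf n) bt.
  apply: (@le_trans _ _ (2 `^ p * (\int[mu]_x `|g x - f n x| `^ p + \int[mu]_x `|f n x - t (cis x)| `^ p))).
    rewrite -intD// -intZ; last exact: bmeasD.
    apply: int_le; [exact: bmeas_diff_powR|by apply: bmeasZ; exact: bmeasD|].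
    move=> x; apply: le_trans (powR_add_le p0' _ _) => //.
    apply: ge0_ler_powR; rewrite ?nnegrE ?addr_ge0//.
    by apply: le_trans (ler_normD _ _); rewrite addrA subrK.
  apply: (@le_trans _ _ (2 `^ p * (e / c + e / c))).
    by rewrite (ler_pM2l P2); exact: (lerD h1 h2).
  rewrite (_ : 2 `^ p * _ = c * (e / c)); last by rewrite /c; ring.
  by rewrite mulrC divfK ?gt_eqF.
Qed.

End Uniqueness.

(** * The spaces L^p *)

Section LpSpaces.
Context {R : realType}.
Local Notation C := (R[i]).
Local Notation T := (measurableTypeR R).
Local Notation mu := (arc_length R).
Local Notation F := (circle R -> C).
Local Notation intg g := (mu.-integrable [set: T] (EFin \o g)).
Local Notation cint := cintegrable.
Implicit Types (p : R) (f g : F).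

Lemma LpP p f : 0 < p ->
  Lp p%:E f <-> cmeasurable f /\ intg (fun x => modc f x `^ p).
Proof.
move=> p0; rewrite /Lp /Lp_norm unlock; split=> -[mf h]; split=> //.
  have mp : measurable_fun [set: T] (fun x => modc f x `^ p).
    by apply: (measurableT_comp (measurable_powR p)); exact: cmeas_modc.
  apply/integrableP; split; first exact/measurable_EFinP.
  have -> : (\int[mu]_x `|(EFin \o (fun x => (modc f x `^ p)%R)) x|)%E =
            (\int[mu]_x (`|(normc (f (cis x)))%:E| `^ p))%E.
    apply: eq_integral => x _ /=.
    by rewrite ger0_norm ?powR_ge0// (ger0_norm (normc_ge0 _)).
  by apply: (@lty_poweRy _ _ p^-1); rewrite ?invr_neq0 ?gt_eqF.
apply: poweR_lty.
have -> : (\int[mu]_x (`|(normc (f (cis x)))%:E| `^ p))%E =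
          (\int[mu]_x (EFin \o (fun x => (modc f x `^ p)%R)) x)%E.
  by apply: eq_integral => x _ /=; rewrite (ger0_norm (normc_ge0 _)).
exact: integrable_lty.
Qed.

Lemma Lp_normE p f : 0 < p -> Lp p%:E f ->
  Lp_norm p%:E f = ((\int[mu]_x modc f x `^ p) `^ p^-1)%:E.
Proof.
move=> p0 /(LpP _ p0)[mf h]; rewrite /Lp_norm unlock.
have -> : (\int[mu]_x (`|(normc (f (cis x)))%:E| `^ p))%E =
          (\int[mu]_x (EFin \o (fun x => (modc f x `^ p)%R)) x)%E.
  by apply: eq_integral => x _ /=; rewrite (ger0_norm (normc_ge0 _)).
rewrite -[X in (X `^ _)%E]fineK; last exact: integrable_fin_num.
by rewrite poweR_EFin.
Qed.

Lemma Lp_cint p f : 1 <= p -> Lp p%:E f -> cint f.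
Proof.
move=> p1; have p0 : 0 < p by exact: lt_le_trans p1.
move=> /(LpP _ p0)[mf h].
apply: (cint_ae_le mf (g := fun x => 1 + 1 / 1 `^ p * modc f x `^ p)).
  by apply: intgD; [apply: bmeas_intg; exact: bmeas_cst|exact: intgZ].
by apply: aeW => x; apply: powR_le1 => //; exact: modc_ge0.
Qed.

(** The inclusion of L^p in L^1, quantitatively. *)
Lemma int_modc_small p (e : R) : 1 <= p -> 0 < e -> exists2 d : R, 0 < d &
  forall f, Lp p%:E f -> \int[mu]_x modc f x `^ p <= d -> \int[mu]_x modc f x <= e.
Proof.
move=> p1 e0; have p0 : 0 < p by exact: lt_le_trans p1.
pose l := e / 2 / (2 * pi); have pi0 := @pi2_gt0 R.
have l0 : 0 < l by apply: divr_gt0 => //; exact: divr_gt0.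
pose c := l / l `^ p; have c0 : 0 < c by rewrite divr_gt0// powR_gt0.
exists (e / 2 / c); first by apply: divr_gt0 => //; exact: divr_gt0.
move=> f Lf h; have [_ i1] := Lp_cint p1 Lf; have [mf ip] := (LpP f p0).1 Lf.
apply: (@le_trans _ _ (\int[mu]_x (l + c * modc f x `^ p))).
  apply: le_Rintegral => //.
    by apply: intgD; [apply: bmeas_intg; exact: bmeas_cst|exact: intgZ].
  by move=> x _; apply: powR_le1 => //; exact: modc_ge0.
rewrite RintegralD//; [|by apply: bmeas_intg; exact: bmeas_cst|exact: intgZ].
rewrite int_cst RintegralZl//.
have -> : 2 * pi * l = e / 2 by rewrite /l mulrC divfK ?gt_eqF.
have : c * \int[mu]_x modc f x `^ p <= e / 2.
  by rewrite mulrC -ler_pdivlMr.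
lra.
Qed.

Lemma intg_powR_le p (g h : R -> R) : 0 <= p -> measurable_fun [set: T] g ->
  (forall x, `|g x| <= h x) -> intg (fun x => h x `^ p) -> intg (fun x => `|g x| `^ p).
Proof.
move=> p0 mg gh ih; apply: (intg_le _ _ ih).
  by apply: (measurableT_comp (measurable_powR p)); exact: measurableT_comp.
move=> x; rewrite ger0_norm ?powR_ge0//; apply: ge0_ler_powR; rewrite ?nnegrE//.
exact: le_trans (gh x).
Qed.

Lemma LpD p f g : 0 < p -> Lp p%:E f -> Lp p%:E g -> Lp p%:E (fun t => f t + g t).
Proof.
move=> p0 /(LpP _ p0)[mf hf] /(LpP _ p0)[mg hg]; apply/(LpP _ p0).
have mfg := cmeasD mf mg; split=> //.
apply: (@intg_le _ (fun x => 2 `^ p * (modc f x `^ p + modc g x `^ p))).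
- by apply: (measurableT_comp (measurable_powR p)); exact: cmeas_modc.
- move=> x; rewrite ger0_norm ?powR_ge0//.
  apply: le_trans (powR_add_le (ltW p0) (modc_ge0 _ _) (modc_ge0 _ _)).
  apply: ge0_ler_powR; rewrite ?nnegrE ?addr_ge0 ?modc_ge0//; first exact: ltW.
  exact: le_normcD.
- by apply: intgZ; exact: intgD.
Qed.

Lemma Lp_ae_le p (M : R) f g : 0 < p -> cmeasurable f ->
  {ae mu, forall x, modc f x <= M * modc g x} -> Lp p%:E g -> Lp p%:E f.
Proof.
move=> p0 mf fg /(LpP _ p0)[mg hg]; apply/(LpP _ p0); split=> //.
apply: (@intg_ae_le _ (fun x => `|M| `^ p * modc g x `^ p)).
- by apply: (measurableT_comp (measurable_powR p)); exact: cmeas_modc.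
- apply: ae_imply fg => x fg; rewrite ger0_norm ?powR_ge0// -powRM ?modc_ge0//.
  apply: ge0_ler_powR; rewrite ?nnegrE ?mulr_ge0 ?modc_ge0//; first exact: ltW.
  by apply: le_trans fg _; rewrite ler_wpM2r ?modc_ge0// ler_norm.
- exact: intgZ.
Qed.

Lemma Lp_aeq p f g : 0 < p -> cmeasurable f -> aeq f g -> Lp p%:E g -> Lp p%:E f.
Proof.
move=> p0 mf fg; apply: (@Lp_ae_le _ 1) => //.
by apply: ae_imply fg => x; rewrite /modc => ->; rewrite mul1r.
Qed.

Lemma LpM_bounded p (M : R) f g : 0 < p -> cmeasurable f ->
  {ae mu, forall x, modc f x <= M} -> Lp p%:E g -> Lp p%:E (fun t => f t * g t).
Proof.
move=> p0 mf fM Lg; apply: (@Lp_ae_le _ M _ g) => //; first by apply: cmeasM => //; case: Lg.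
by apply: ae_imply fM => x fM; rewrite /modc normcM ler_wpM2r ?normc_ge0.
Qed.

Lemma LpZ p (z : C) f : 0 < p -> Lp p%:E f -> Lp p%:E (fun t => z * f t).
Proof.
move=> p0 Lf; apply: (@LpM_bounded p (normc z) (fun=> z)) => //.
exact: aeW.
Qed.

Lemma LpB p f g : 0 < p -> Lp p%:E f -> Lp p%:E g -> Lp p%:E (fun t => f t - g t).
Proof.
move=> p0 Lf Lg; rewrite (_ : (fun t => _) = fun t => f t + (-1) * g t).
  by apply: LpD => //; exact: LpZ.
by apply/funext => t; rewrite mulN1r.
Qed.

Lemma Lp_bounded p (M : R) f : 0 < p -> cmeasurable f -> (forall t, normc (f t) <= M) ->
  Lp p%:E f.
Proof.
move=> p0 mf fM; apply/(LpP _ p0); split=> //; apply: bmeas_intg.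
apply: bmeas_powR; [exact: ltW|move=> x; exact: modc_ge0|exact: bmeas_modc fM].
Qed.

Lemma Lp_polyfun p (r : {poly C}) : 0 < p -> Lp p%:E (polyfun r).
Proof.
move=> p0; have [M _ rM] := polyfun_bounded r.
by apply: Lp_bounded rM => //; exact: cmeas_polyfun.
Qed.

Lemma Lp_zexpM p n f : 0 < p -> Lp p%:E f -> Lp p%:E (fun t => f t * zexp n t).
Proof.
move=> p0 Lf; rewrite (_ : (fun t => _) = fun t => zexp n t * f t); last first.
  by apply/funext => t; rewrite mulrC.
apply: (@LpM_bounded p 1) => //; first exact: cmeas_zexp.
by apply: aeW => x; rewrite /modc normc_zexp.
Qed.

Lemma Lp_tilde p f : 0 < p -> Lp p%:E f -> Lp p%:E (tilde f).
Proof.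
move=> p0 /(LpP _ p0)[mf hf]; apply/(LpP _ p0); split; first exact: cmeas_tilde.
have [h _] := int_opp hf.
rewrite (_ : (fun x => _) = fun x => modc f (- x) `^ p)//.
by apply/funext => x; rewrite /modc tilde_cis.
Qed.

Lemma Lp_Jop p f : 0 < p -> Lp p%:E f -> Lp p%:E (Jop f).
Proof.
move=> p0 Lf; rewrite (_ : Jop f = fun t => tilde f t * zexp (-1) t); last first.
  by apply/funext => t; exact: JopE.
by apply: Lp_zexpM => //; exact: Lp_tilde.
Qed.

(** ** Density in L^p *)

Lemma blc_nnsfun (Q : (R -> R) -> Prop) : bounded_limit_class Q ->
  forall s : {nnsfun T >-> R}, Q (fun x => s x).
Proof.
move=> HQ s.
rewrite (_ : (fun x => s x) = fun x => \sum_(y <- finmap.enum_fset (fset_set (range s))) y * \1_(s @^-1` [set y]) x); last first.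
  by apply/funext => x; rewrite fimfunE fsbig_finite.
elim: (finmap.enum_fset _) => [|y l IH].
  by under eq_fun do rewrite big_nil; exact: blc_cst.
under eq_fun do rewrite big_cons.
by apply: (blc_lin HQ) => //; apply: blc_indic.
Qed.

Lemma intg_powR_add p (g h : R -> R) : 0 <= p -> measurable_fun [set: T] g ->
  measurable_fun [set: T] h -> intg (fun x => `|g x| `^ p) -> intg (fun x => `|h x| `^ p) ->
  intg (fun x => `|g x + h x| `^ p) /\
  \int[mu]_x `|g x + h x| `^ p <=
    2 `^ p * (\int[mu]_x `|g x| `^ p + \int[mu]_x `|h x| `^ p).
Proof.
move=> p0 mg mh ig ih.
have B x : `|g x + h x| `^ p <= 2 `^ p * (`|g x| `^ p + `|h x| `^ p).
  apply: le_trans (powR_add_le p0 _ _) => //.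
  by apply: ge0_ler_powR; rewrite ?nnegrE ?addr_ge0// ler_normD.
have iB : intg (fun x => 2 `^ p * (`|g x| `^ p + `|h x| `^ p)) by apply: intgZ; exact: intgD.
have iA : intg (fun x => `|g x + h x| `^ p).
  apply: (intg_le _ _ iB); last by move=> x; rewrite ger0_norm ?powR_ge0.
  apply: (measurableT_comp (measurable_powR p)); apply: measurableT_comp => //.
  exact: measurable_funD.
split=> //; rewrite -RintegralD// -RintegralZl//; last exact: intgD.
exact: le_Rintegral.
Qed.

(** A nonnegative function is an increasing limit of simple functions. *)
Lemma dense_ge0 p (g : R -> R) : 0 < p -> measurable_fun [set: T] g ->
  (forall x, 0 <= g x) -> intg (fun x => `|g x| `^ p) ->
  forall e, 0 < e -> exists2 t, trigpoly t & intg (fun x => `|g x - t (cis x)| `^ p) /\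
    \int[mu]_x `|g x - t (cis x)| `^ p <= e.
Proof.
move=> p0 mg g0 ig e e0.
have mg' : measurable_fun [set: T] (EFin \o g) by exact/measurable_EFinP.
pose s n x : R := nnsfun_approx measurableT mg' n x.
have sg x : s n x @[n --> \oo] --> g x.
  have := @cvg_nnsfun_approx _ _ _ _ measurableT _ mg' (fun x _ => _) x I.
  move=> h; apply: (@fine_cvg _ _ _ _ (fun n => (s n x)%:E)); apply: h => y.
  by rewrite lee_fin; exact: g0.
have snd n x : s n x <= g x.
  have nd : nondecreasing_seq (fun n => s n x).
    by move=> a b ab; have /lefP/(_ x) := nd_nnsfun_approx measurableT mg' ab.
  have := nondecreasing_cvgn_le nd (cvgP _ (sg x)) n.
  by rewrite (cvg_lim _ (sg x)).
have ms n : measurable_fun [set: T] (s n) by [].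
have s0 n x : 0 <= s n x by [].
have P2 : 0 < 2 `^ p :> R by exact: powR_gt0.
pose c : R := 2 `^ p * 2; have c0 : 0 < c by rewrite mulr_gt0.
have ec : 0 < e / c by rewrite divr_gt0.
have dle n x : `|g x - s n x| <= `|g x|.
  by rewrite !ger0_norm ?subr_ge0// lerBlDr lerDl.
have mgs n : measurable_fun [set: T] (fun x => g x - s n x) by exact: measurable_funB.
have igs n : intg (fun x => `|g x - s n x| `^ p).
  by apply: (intg_powR_le (ltW p0) (mgs n) (dle n)).
have : \int[mu]_x `|g x - s n x| `^ p @[n --> \oo] --> \int[mu]_x (0 : R).
  apply: (@int_dct _ _ _ _ _ _ ig).
  - move=> n; exact: intg_meas (igs n).
  - exact: measurable_cst.
  - move=> n x; rewrite ger0_norm ?powR_ge0//; apply: ge0_ler_powR; rewrite ?nnegrE//.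
    exact: ltW.
  - apply: aeW => x; rewrite -[X in _ --> X](powR0 (lt0r_neq0 p0)).
    apply: cvg_powR => //; rewrite -(normr0 R) -(subrr (g x)).
    by apply: cvg_norm; apply: cvgB (sg x); exact: cvg_cst.
rewrite int_cst mulr0 => /cvgrPdist_le/(_ _ ec)[n _ /(_ n (leqnn n))] /=.
rewrite sub0r normrN ger0_norm; last by apply: Rintegral_ge0 => x _; exact: powR_ge0.
move=> h1.
have [bs /(_ _ ec)[t tt h2]] := blc_nnsfun (blc_dense p0) (nnsfun_approx measurableT mg' n).
have bt := bmeas_trigpoly tt; exists t => //.
have mst : measurable_fun [set: T] (fun x => s n x - t (cis x)) by exact: (bmeasB bs bt).1.
have ist : intg (fun x => `|s n x - t (cis x)| `^ p).
  by apply: bmeas_intg; exact: bmeas_diff_powR (ltW p0) bs bt.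
have := intg_powR_add (ltW p0) (mgs n) mst (igs n) ist.
rewrite (_ : (fun x => `|g x - s n x + (s n x - t (cis x))| `^ p) = fun x => `|g x - t (cis x)| `^ p); last first.
  by apply/funext => x; rewrite addrA subrK.
move=> [i1 h]; split=> //; apply: le_trans h _.
apply: (@le_trans _ _ (2 `^ p * (e / c + e / c))).
  by rewrite (ler_pM2l P2); exact: (lerD h1 h2).
rewrite (_ : 2 `^ p * _ = c * (e / c)); last by rewrite /c; ring.
by rewrite mulrC divfK ?gt_eqF.
Qed.

Lemma dense_Lp p (g : R -> R) : 0 < p -> measurable_fun [set: T] g ->
  intg (fun x => `|g x| `^ p) ->
  forall e, 0 < e -> exists2 t, trigpoly t & intg (fun x => `|g x - t (cis x)| `^ p) /\
    \int[mu]_x `|g x - t (cis x)| `^ p <= e.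
Proof.
move=> p0 mg ig e e0.
pose gp x := Num.max (g x) 0; pose gn x := Num.max (- g x) 0.
have mgp : measurable_fun [set: T] gp by exact: measurable_maxr.
have mgn : measurable_fun [set: T] gn by apply: measurable_maxr => //; exact: measurable_funN.
have gp0 x : 0 <= gp x by rewrite le_max lexx orbT.
have gn0 x : 0 <= gn x by rewrite le_max lexx orbT.
have gpl x : `|gp x| <= `|g x|.
  by rewrite ger0_norm// ge_max ler_norm normr_ge0.
have gnl x : `|gn x| <= `|g x|.
  by rewrite ger0_norm// ge_max normr_ge0 andbT -normrN ler_norm.
have gE x : g x = gp x - gn x.
  rewrite /gp /gn; have [h|h] := leP (g x) 0.
    by rewrite max_l ?sub0r ?opprK// oppr_ge0.
  by rewrite max_r ?subr0// oppr_le0 ltW.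
have P2 : 0 < 2 `^ p :> R by exact: powR_gt0.
pose c : R := 2 `^ p * 2; have c0 : 0 < c by rewrite mulr_gt0.
have ec : 0 < e / c by rewrite divr_gt0.
have [t1 tt1 [i1 h1]] := dense_ge0 p0 mgp gp0 (intg_powR_le (ltW p0) mgp gpl ig) ec.
have [t2 tt2 [i2 h2]] := dense_ge0 p0 mgn gn0 (intg_powR_le (ltW p0) mgn gnl ig) ec.
exists (fun t => t1 t + -1 * t2 t); first by apply: trigpolyD => //; exact: trigpolyZ.
have m1 : measurable_fun [set: T] (fun x => gp x - t1 (cis x)).
  by apply: measurable_funB => //; exact: (bmeas_trigpoly tt1).1.
have m2 : measurable_fun [set: T] (fun x => - (gn x - t2 (cis x))).
  by apply: measurable_funN; apply: measurable_funB => //; exact: (bmeas_trigpoly tt2).1.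
have := intg_powR_add (ltW p0) m1 m2 i1.
under [fun x => `|- _| `^ p]eq_fun do rewrite normrN.
move=> /(_ i2).
rewrite (_ : (fun x => `|_ + _| `^ p) = fun x => `|g x - (t1 (cis x) + -1 * t2 (cis x))| `^ p); last first.
  by apply/funext => x; rewrite gE; congr (`|_| `^ _); ring.
move=> [i3 h]; split=> //; apply: le_trans h _.
apply: (@le_trans _ _ (2 `^ p * (e / c + e / c))).
  by rewrite (ler_pM2l P2); exact: (lerD h1 h2).
rewrite (_ : 2 `^ p * _ = c * (e / c)); last by rewrite /c; ring.
by rewrite mulrC divfK ?gt_eqF.
Qed.

End LpSpaces.

(** * Completeness *)

Section Generic.
Context {R : realType} d (X : measurableType d) (m : {measure set X -> \bar R}).
Local Notation intg g := (m.-integrable [set: X] (EFin \o g)).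

(** By monotone convergence the sum of the series has a finite integral, hence
    is finite almost everywhere. *)
Lemma ae_summable (D : nat -> X -> R) (c : R) : (forall n, intg (D n)) ->
  (forall n x, 0 <= D n x) -> (forall N, \sum_(0 <= k < N) \int[m]_x D k x <= c) ->
  {ae m, forall x, cvgn (series (fun n => D n x))}.
Proof.
move=> iD D0 Dc; have mD n : measurable_fun [set: X] (EFin \o D n).
  by case/integrableP : (iD n).
pose G x := (\sum_(0 <= n <oo) (EFin \o D n) x)%E.
have mG : measurable_fun [set: X] G.
  by apply: ge0_emeasurable_sum => // n x _ _; rewrite lee_fin.
have G0 x : (0 <= G x)%E by apply: nneseries_ge0 => n _ _; rewrite lee_fin.
have iG : m.-integrable [set: X] G.
  apply/integrableP; split=> //.
  under eq_integral do rewrite gee0_abs//.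
  rewrite integral_nneseries//; last by move=> n x _; rewrite lee_fin.
  apply: (@le_lt_trans _ _ c%:E); last exact: ltry.
  apply: lime_le.
    by apply: is_cvg_nneseries => n _ _; apply: integral_ge0 => x _; rewrite lee_fin.
  apply: nearW => N.
  rewrite (eq_bigr (fun k => (\int[m]_x D k x)%:E)); last first.
    by move=> k _; apply/esym/fineK; exact: integrable_fin_num (iD k).
  by rewrite sumEFin lee_fin.
apply: filterS (integrable_ae measurableT iG) => x /(_ I) Gx.
apply: nondecreasing_is_cvgn.
  by apply/nondecreasing_seqP => n; rewrite /series/= big_nat_recr//= lerDl.
exists (fine (G x)) => _ [N _ <-]; rewrite -lee_fin fineK//.
rewrite /series/= -sumEFin; apply: nneseries_lim_ge => n _ _.
by rewrite lee_fin.
Qed.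

Lemma fatou_le (f : nat -> X -> R) (g : X -> R) (c : R) : (forall n, intg (f n)) ->
  (forall n x, 0 <= f n x) -> measurable_fun [set: X] g -> (forall x, 0 <= g x) ->
  {ae m, forall x, f n x @[n --> \oo] --> g x} -> (forall n, \int[m]_x f n x <= c) ->
  intg g /\ \int[m]_x g x <= c.
Proof.
move=> jf f0 mg g0 fg fc; have mf n : measurable_fun [set: X] (EFin \o f n).
  by case/integrableP : (jf n).
have mg' : measurable_fun [set: X] (EFin \o g) by exact/measurable_EFinP.
have L u : (forall n, u n <= c%:E)%E -> (limn_einf u <= c%:E)%E.
  move=> uc; apply: le_trans (limn_einf_sup u) _; rewrite limn_esup_lim.
  apply: lime_le; first exact: is_cvg_esups.
  by apply: nearW => n; apply: ge_ereal_sup => _ [k _ <-].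
have ml : measurable_fun [set: X] (fun x => limn_einf (fun n => (EFin \o f n) x)).
  apply: measurableT_comp => //.
  have := @measurable_fun_limn_esup _ _ _ [set: X] (fun n x => (- (EFin \o f n) x)%E).
  by apply => n; exact: measurableT_comp.
have B : (\int[m]_x (g x)%:E <= c%:E)%E.
  have -> : (\int[m]_x (g x)%:E = \int[m]_x limn_einf (fun n => (EFin \o f n) x))%E.
    apply: ge0_ae_eq_integral => //; first by move=> x _; rewrite lee_fin.
      move=> x _; rewrite limn_einf_lim; apply: lime_ge; first exact: is_cvg_einfs.
      by apply: nearW => n; apply: le_ereal_inf_tmp => _ [k _ <-]; rewrite lee_fin.
    apply: filterS fg => x fg _.
    have /cvg_limn_einf_sup[-> _]// : (EFin \o f n) x @[n --> \oo] --> (g x)%:E.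
    by apply: cvg_EFin => //; exact: nearW.
  apply: le_trans (fatou m measurableT mf _) _; first by move=> n x _; rewrite lee_fin.
  apply: L => n; rewrite -[leLHS]fineK ?lee_fin//; first exact: fc.
  exact: integrable_fin_num.
have ig : intg g.
  apply/integrableP; split=> //; under eq_integral do rewrite gee0_abs ?lee_fin//.
  by apply: le_lt_trans B _; exact: ltry.
by split=> //; rewrite -lee_fin fineK//; exact: integrable_fin_num.
Qed.

End Generic.

Section Complete.
Context {R : realType}.
Local Notation C := (R[i]).
Local Notation T := (measurableTypeR R).
Local Notation mu := (arc_length R).
Local Notation F := (circle R -> C).
Local Notation intg g := (mu.-integrable [set: T] (EFin \o g)).
Implicit Types (p : R) (f g : F).

(** A geometric rate fast enough for the quasi-triangle inequality
    |x + y|^p <= 2^p (|x|^p + |y|^p) to be iterated. *)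
Definition cauchy_rate p : R := 2^-1 `^ p / 2.

Lemma cauchy_rate_gt0 p : 0 < cauchy_rate p.
Proof. by apply: divr_gt0 => //; apply: powR_gt0; rewrite invr_gt0. Qed.

Lemma cauchy_rate2 p : 2 `^ p * cauchy_rate p = 2^-1.
Proof. by rewrite /cauchy_rate mulrA -powRM// mulfV// powR1 mul1r. Qed.

Lemma cauchy_rate_lt1 p : 0 <= p -> cauchy_rate p < 1.
Proof.
move=> p0; rewrite -(ltr_pM2l (powR_gt0 p (_ : 0 < 2))) ?cauchy_rate2 ?mulr1//.
have : 1 <= 2 `^ p :> R by rewrite -[leLHS](powRr0 2) ler_powR// ler1n.
lra.
Qed.

Section MeanCauchy.
Context (p : R) (h : nat -> R -> R) (p1 : 1 <= p) (bh : forall n, bmeas (h n)).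
Context (hC : forall n, \int[mu]_x `|h n.+1 x - h n x| `^ p <= cauchy_rate p ^+ n).
Local Notation q := (cauchy_rate p).

Let p0 : 0 < p. Proof. exact: lt_le_trans p1. Qed.

Let bD n m : bmeas (fun x => `|h n x - h m x| `^ p).
Proof. by apply: bmeas_diff_powR => //; exact: ltW. Qed.

(** Bounded by the mean of order p, the successive differences are summable
    in the mean, hence almost everywhere. *)
Lemma mean_cauchy_ae : {ae mu, forall x, cvgn (fun n => h n x)}.
Proof.
pose D n x := `|h n.+1 x - h n x|.
have bDn n : bmeas (D n) by apply: bmeas_norm; exact: bmeasB.
have Dn n : \int[mu]_x D n x <= (2 * pi + 1) * (2^-1) ^+ n.
  pose l : R := 2^-1 ^+ n; have l0 : 0 < l by apply: exprn_gt0; rewrite invr_gt0.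
  have lp : 0 < l `^ p by exact: powR_gt0.
  apply: (@le_trans _ _ (\int[mu]_x (l + l / l `^ p * `|h n.+1 x - h n x| `^ p))).
    apply: int_le => //; last by move=> x; apply: powR_le1 => //; exact: normr_ge0.
    by apply: bmeasD; [exact: bmeas_cst|exact: bmeasZ].
  rewrite intD; [|exact: bmeas_cst|exact: bmeasZ].
  rewrite int_cst intZ// [leRHS](_ : _ = 2 * pi * l + l); last by rewrite /l; ring.
  rewrite lerD2l.
  rewrite -mulrA ler_piMr ?(ltW l0)// mulrC ler_pdivrMr// mul1r.
  apply: le_trans (hC n) _.
  have -> : l `^ p = (2^-1 `^ p) ^+ n.
    have h0 : 0 <= 2^-1 :> R by rewrite invr_ge0.
    by rewrite /l -(powR_mulrn n h0) -powRrM mulrC powRrM powR_mulrn// powR_ge0.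
  rewrite lerXn2r ?nnegrE ?powR_ge0 ?(ltW (cauchy_rate_gt0 _))//.
  by rewrite /cauchy_rate ler_pdivrMr// ler_peMr ?powR_ge0// ler1n.
have DN N : \sum_(0 <= k < N) \int[mu]_x D k x <= (2 * pi + 1) * 2.
  apply: (@le_trans _ _ ((2 * pi + 1) * (2 - 2 * 2^-1 ^+ N))); last first.
    by rewrite ler_pM2l ?addr_gt0 ?pi2_gt0// gerBl mulr_ge0// exprn_ge0// invr_ge0.
  elim: N => [|N IH]; first by rewrite big_nil expr0 mulr1 subrr mulr0.
  rewrite big_nat_recr//=; apply: le_trans (lerD IH (Dn N)) _.
  by rewrite -mulrDr exprS mulVKf// le_eqVlt; apply/orP; left; apply/eqP; ring.
have := ae_summable (fun n => bmeas_intg (bDn n)) (fun n x => normr_ge0 _) DN.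
apply: ae_imply => x /normed_cvg; rewrite -/(telescope (h ^~ x)) telescopeK => cv.
rewrite (_ : (fun n => h n x) = (fun n => h 0 x + (h n x - h 0 x))); last first.
  by apply/funext => n; rewrite addrC subrK.
by apply: is_cvgD => //; exact: is_cvg_cst.
Qed.

(** The bound E (n, j) satisfies E (n, j + 1) <= 2^p (q^n + E (n + 1, j)), and
    2^p q = 1/2 makes 2 2^p q^n stable under this recursion. *)
Lemma mean_cauchy_tail j n : \int[mu]_x `|h (n + j)%N x - h n x| `^ p <= 2 * 2 `^ p * q ^+ n.
Proof.
have q0 := cauchy_rate_gt0 p; have q2 := cauchy_rate2 p.
have P2 : 0 < 2 `^ p :> R by exact: powR_gt0.
elim: j n => [|j IH] n.
  rewrite (_ : (fun x => _) = fun=> 0); last first.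
    by apply/funext => x; rewrite addn0 subrr normr0 powR0// gt_eqF.
  by rewrite int_cst mulr0 mulr_ge0 ?exprn_ge0 ?mulr_ge0 ?ltW.
have [_] := intg_powR_add (ltW p0) (bmeasB (bh n.+1) (bh n)).1
  (bmeasB (bh (n.+1 + j)%N) (bh n.+1)).1 (bmeas_intg (bD _ _)) (bmeas_intg (bD _ _)).
rewrite (_ : (fun x => `|_ + _| `^ p) = fun x => `|h (n + j.+1)%N x - h n x| `^ p); last first.
  by apply/funext => x; rewrite addSnnS; congr (`|_| `^ _); ring.
move=> H; apply: le_trans H _.
apply: (@le_trans _ _ (2 `^ p * (q ^+ n + 2 * 2 `^ p * q ^+ n.+1))).
  by rewrite ler_pM2l// lerD// IH.
rewrite exprS (_ : 2 * 2 `^ p * (q * q ^+ n) = 2 * (2 `^ p * q) * q ^+ n); last by ring.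
by rewrite q2 mulfV// mul1r le_eqVlt; apply/orP; left; apply/eqP; ring.
Qed.

(** Fatou's lemma turns the bound on tails into one on the limit. The upper
    limit is everywhere defined and measurable, and equals the limit almost
    everywhere. *)
Lemma mean_cauchy_lim : let g x := fine (limn_esup (fun n => (h n x)%:E)) in
  measurable_fun [set: T] g /\ forall n, intg (fun x => `|g x - h n x| `^ p) /\
    \int[mu]_x `|g x - h n x| `^ p <= 2 * 2 `^ p * q ^+ n.
Proof.
move=> g; have mg : measurable_fun [set: T] g.
  apply: (measurableT_comp (fine_measurable measurableT)).
  apply: measurable_fun_limn_esup => n; apply/measurable_EFinP; exact: (bh n).1.
have hg : {ae mu, forall x, h n x @[n --> \oo] --> g x}.
  apply: ae_imply mean_cauchy_ae => x cv; rewrite /g.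
  have /cvg_limn_einf_sup[_ ->]// : (h n x)%:E @[n --> \oo] --> (limn (fun n => h n x))%:E.
  by apply: cvg_EFin => //; exact: nearW.
split=> // n.
apply: (@fatou_le _ _ T mu (fun j x => `|h (n + j)%N x - h n x| `^ p) (fun x => `|g x - h n x| `^ p)).
- by move=> j; exact: bmeas_intg.
- by move=> j x; exact: powR_ge0.
- apply: (measurableT_comp (measurable_powR p)); apply: measurableT_comp => //.
  by apply: measurable_funB => //; exact: (bh n).1.
- by move=> x; exact: powR_ge0.
- apply: ae_imply hg => x hg.
  have c1 : `|h (n + j)%N x - h n x| @[j --> \oo] --> `|g x - h n x|.
    apply: cvg_norm; apply: cvgB; last exact: cvg_cst.
    exact: (cvg_comp (addn n) (h ^~ x) (cvg_addnl n) hg).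
  exact: cvg_powR c1.
- by move=> j; exact: mean_cauchy_tail.
Qed.

End MeanCauchy.
End Complete.

(** * The Riesz projection on L^p *)

Section RieszProjection.
Context {R : realType}.
Local Notation C := (R[i]).
Local Notation T := (measurableTypeR R).
Local Notation mu := (arc_length R).
Local Notation F := (circle R -> C).
Local Notation intg g := (mu.-integrable [set: T] (EFin \o g)).
Local Notation cint := cintegrable.
Implicit Types (p : R) (f g : F).

Lemma Lp_ReIm p f : 0 < p -> cmeasurable f ->
  intg (fun x => `|complex.Re (f (cis x))| `^ p) ->
  intg (fun x => `|complex.Im (f (cis x))| `^ p) ->
  Lp p%:E f /\ \int[mu]_x modc f x `^ p <=
    2 `^ p * (\int[mu]_x `|complex.Re (f (cis x))| `^ p +
              \int[mu]_x `|complex.Im (f (cis x))| `^ p).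
Proof.
move=> p0 mf ir ii.
have B x : modc f x `^ p <=
    2 `^ p * (`|complex.Re (f (cis x))| `^ p + `|complex.Im (f (cis x))| `^ p).
  apply: le_trans (powR_add_le (ltW p0) (normr_ge0 _) (normr_ge0 _)).
  apply: ge0_ler_powR; rewrite ?nnegrE ?addr_ge0 ?modc_ge0//; first exact: ltW.
  exact: le_normc_ReIm.
have iB : intg (fun x => 2 `^ p *
    (`|complex.Re (f (cis x))| `^ p + `|complex.Im (f (cis x))| `^ p)).
  by apply: intgZ; exact: intgD.
have Lf : Lp p%:E f.
  apply/(LpP _ p0); split=> //; apply: (intg_le _ _ iB).
    by apply: (measurableT_comp (measurable_powR p)); exact: cmeas_modc.
  by move=> x; rewrite ger0_norm ?powR_ge0.
split=> //; have [_ jf] := (LpP f p0).1 Lf.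
rewrite -RintegralD// -RintegralZl//; last exact: intgD.
exact: le_Rintegral.
Qed.

Lemma LpD_int p f g : 0 < p -> Lp p%:E f -> Lp p%:E g ->
  \int[mu]_x modc (fun t => f t + g t) x `^ p <=
    2 `^ p * (\int[mu]_x modc f x `^ p + \int[mu]_x modc g x `^ p).
Proof.
move=> p0 Lf Lg; have [_ i1] := (LpP _ p0).1 Lf; have [_ i2] := (LpP _ p0).1 Lg.
have [_ i3] := (LpP _ p0).1 (LpD p0 Lf Lg).
rewrite -RintegralD// -RintegralZl//; last exact: intgD.
apply: le_Rintegral => //; first by apply: intgZ; exact: intgD.
move=> x _; apply: le_trans (powR_add_le (ltW p0) (modc_ge0 _ _) (modc_ge0 _ _)).
apply: ge0_ler_powR; rewrite ?nnegrE ?addr_ge0 ?modc_ge0//; first exact: ltW.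
exact: le_normcD.
Qed.

Lemma int_powR_le p (g h : R -> R) : 0 <= p -> bmeas g -> bmeas h ->
  (forall x, `|g x| <= h x) -> \int[mu]_x `|g x| `^ p <= \int[mu]_x h x `^ p.
Proof.
move=> p0 bg bh gh; have h0 x : 0 <= h x by exact: le_trans (gh x).
apply: int_le.
- by apply: bmeas_powR => //; exact: bmeas_norm.
- exact: bmeas_powR.
- by move=> x; apply: ge0_ler_powR; rewrite ?nnegrE.
Qed.

Lemma polyfunB (r s : {poly C}) t : polyfun (r - s) t = polyfun r t - polyfun s t.
Proof. by rewrite /polyfun hornerD hornerN. Qed.

(** Completeness of L^p, in the only case needed. Real and imaginary parts
    converge separately, and polynomials being bounded, integrability enters
    only in the limit. *)
Lemma Lp_complete p (s : nat -> {poly C}) : 1 <= p ->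
  (forall n, \int[mu]_x modc (polyfun (s n.+1 - s n)) x `^ p <= cauchy_rate p ^+ n) ->
  exists2 g, Lp p%:E g & exists2 K, 0 < K &
    forall n, \int[mu]_x modc (fun t => g t - polyfun (s n) t) x `^ p <= K * cauchy_rate p ^+ n.
Proof.
move=> p1 hs; have p0 : 0 < p by exact: lt_le_trans p1.
pose h1 n x := complex.Re (polyfun (s n) (cis x)).
pose h2 n x := complex.Im (polyfun (s n) (cis x)).
have b1 n : bmeas (h1 n) by exact: bmeas_Re_polyfun.
have b2 n : bmeas (h2 n) by exact: bmeas_Im_polyfun.
have c1 n : \int[mu]_x `|h1 n.+1 x - h1 n x| `^ p <= cauchy_rate p ^+ n.
  apply: le_trans (hs n).
  apply: (int_powR_le (ltW p0) (bmeasB (b1 _) (b1 _)) (bmeas_modc_polyfun _)) => x.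
  by rewrite /h1 /modc polyfunB -cReN -cReD le_Re_normc.
have c2 n : \int[mu]_x `|h2 n.+1 x - h2 n x| `^ p <= cauchy_rate p ^+ n.
  apply: le_trans (hs n).
  apply: (int_powR_le (ltW p0) (bmeasB (b2 _) (b2 _)) (bmeas_modc_polyfun _)) => x.
  by rewrite /h2 /modc polyfunB -cImN -cImD le_Im_normc.
have [m1 l1] := mean_cauchy_lim p1 b1 c1.
have [m2 l2] := mean_cauchy_lim p1 b2 c2.
pose g : F := fun t => (fine (limn_esup (fun n => (complex.Re (polyfun (s n) t))%:E)) +i*
  fine (limn_esup (fun n => (complex.Im (polyfun (s n) t))%:E)))%C.
have mg : cmeasurable g by split.
have key n : Lp p%:E (fun t => g t - polyfun (s n) t) /\
  \int[mu]_x modc (fun t => g t - polyfun (s n) t) x `^ p <=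
    2 `^ p * (2 * (2 * 2 `^ p)) * cauchy_rate p ^+ n.
  have [i1 e1] := l1 n; have [i2 e2] := l2 n.
  have [|||L h] := @Lp_ReIm p (fun t => g t - polyfun (s n) t) p0.
  - by apply: cmeasB => //; exact: cmeas_polyfun.
  - by rewrite (_ : (fun x => _) = fun x => `|fine (limn_esup (fun n => (h1 n x)%:E)) - h1 n x| `^ p)//;
      apply/funext => x; rewrite cReD cReN.
  - by rewrite (_ : (fun x => _) = fun x => `|fine (limn_esup (fun n => (h2 n x)%:E)) - h2 n x| `^ p)//;
      apply/funext => x; rewrite cImD cImN.
  split=> //; apply: le_trans h _; rewrite -mulrA ler_pM2l ?powR_gt0//.
  rewrite -[2 in leRHS]/(1 + 1) mulrDl mul1r mulrDl; apply: lerD.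
    apply: le_trans e1; rewrite le_eqVlt; apply/orP; left; apply/eqP.
    by congr (Rintegral _ _ _); apply/funext => x; rewrite cReD cReN.
  apply: le_trans e2; rewrite le_eqVlt; apply/orP; left; apply/eqP.
  by congr (Rintegral _ _ _); apply/funext => x; rewrite cImD cImN.
exists g.
  rewrite (_ : g = fun t => (g t - polyfun (s 0) t) + polyfun (s 0) t); last first.
    by apply/funext => t; rewrite subrK.
  by apply: LpD => //; [exact: (key 0).1|exact: Lp_polyfun].
exists (2 `^ p * (2 * (2 * 2 `^ p))); first by rewrite !mulr_gt0// powR_gt0.
by move=> n; exact: (key n).2.
Qed.

(** All Fourier coefficients are bounded by the mean of the modulus. *)
Lemma fourier_small p (e : R) : 1 <= p -> 0 < e -> exists2 d : R, 0 < d &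
  forall f n, Lp p%:E f -> \int[mu]_x modc f x `^ p <= d -> normc (fourier f n) <= e.
Proof.
move=> p1 e0; have [d d0 hd] := int_modc_small p1 e0; exists d => // f n Lf fd.
by apply: le_trans (normc_fourier n (Lp_cint p1 Lf)) _; exact: hd.
Qed.

(** The analytic projection of a real trigonometric polynomial Re r. *)
Definition analytic_part (r : {poly C}) : {poly C} := 2^-1 *: (r + (r`_0)%:P).

Lemma analytic_partB r s : analytic_part (r - s) = analytic_part r - analytic_part s.
Proof. by rewrite /analytic_part -scalerBr coefB polyCB; congr (_ *: _); ring. Qed.

Lemma polyfun_analytic_part r t : polyfun (analytic_part r) t = 2^-1 * (polyfun r t + r`_0).
Proof. by rewrite /polyfun /analytic_part hornerZ hornerD hornerC. Qed.

(** For n > 0 the conjugate of r contributes nothing; for n = 0 it doubles the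
    mean, which is why analytic_part adds r_0. *)
Lemma fourier_analytic_part (r : {poly C}) n : complex.Im r`_0 = 0 ->
  fourier (polyfun (analytic_part r)) n =
  if 0 <= n then fourier (fun t => (complex.Re (polyfun r t))%:C%C) n else 0.
Proof.
move=> r0; rewrite fourier_polyfun; case: n => [n|n] //=.
rewrite (_ : (fun t => _) = fun t => 2^-1 * (polyfun r t + (polyfun r t)^*%C)); last first.
  apply/funext => t; case: (polyfun r t) => a b; apply: complexP => /=.
    by rewrite /= !(mul0r, mulr0, subr0, addr0, subrr, oppr0); field.
  by rewrite /= !(mul0r, mulr0, subr0, addr0, subrr, oppr0).
have cr := cint_polyfun r.
rewrite fourierZ; last by apply: cintD => //; exact: cint_conj.
rewrite fourierD//; last exact: cint_conj.
rewrite fourier_conj// !fourier_polyfun /analytic_part coefZ coefD coefC.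
congr (_ * (_ + _)); case: n => [|n] /=; last by apply: complexP; rewrite /= ?oppr0.
by move: r0; case: (r`_0) => a b /= ->; rewrite oppr0.
Qed.

Lemma analytic_part_bound p : 1 < p -> exists2 K, 0 < K & forall r : {poly C}, complex.Im r`_0 = 0 ->
  \int[mu]_x modc (polyfun (analytic_part r)) x `^ p <=
    K * \int[mu]_x `|complex.Re (polyfun r (cis x))| `^ p.
Proof.
move=> p1; have p0 : 0 < p by exact: lt_trans p1.
have P2 : 0 < 2 `^ p :> R by exact: powR_gt0.
have [K [K0 HK]] := riesz_boundT p1.
exists (2 `^ p * (K + 1)); first by rewrite mulr_gt0// addr_gt0.
move=> r r0; have br := bmeas_modc_polyfun r.
have bp : bmeas (fun x => modc (polyfun r) x `^ p).
  by apply: bmeas_powR => //; [exact: ltW|exact: modc_ge0].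
set I := \int[mu]_x `|complex.Re _| `^ p.
have hm := mean_powR (ltW p1) r0.
apply: (@le_trans _ _ (\int[mu]_x (2 `^ p * (modc (polyfun r) x `^ p + (`|complex.Re r`_0| / 2) `^ p)))).
  apply: int_le.
  - by apply: bmeas_powR; [exact: ltW|exact: modc_ge0|exact: bmeas_modc_polyfun].
  - by apply: bmeasZ; apply: bmeasD => //; exact: bmeas_cst.
  - move=> x; apply: le_trans (powR_add_le (ltW p0) _ _); rewrite ?modc_ge0//.
    apply: ge0_ler_powR; rewrite ?nnegrE ?addr_ge0 ?modc_ge0//; first exact: ltW.
    rewrite /modc polyfun_analytic_part normcM.
    have -> : normc (2^-1 : C) = 2^-1.
      rewrite (_ : (2^-1 : C) = (2^-1)%:C%C) ?normc_real ?ger0_norm ?invr_ge0//.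
      by rewrite rmorphV ?unitfE//= rmorphD.
    have := le_normcD (polyfun r (cis x)) r`_0.
    have -> : normc r`_0 = `|complex.Re r`_0|.
      rewrite -normc_real; congr normc; apply: complexP => //=.
    have := normc_ge0 (polyfun r (cis x)).
    lra.
rewrite intZ ?intD//; [|exact: bmeas_cst|by apply: bmeasD => //; exact: bmeas_cst].
rewrite int_cst -[leRHS]mulrA (ler_pM2l P2) [leRHS](_ : _ = K * I + I); last by ring.
by apply: lerD; [exact: HK|exact: hm].
Qed.

(** The real function u is approximated by trigonometric polynomials Re r_n at
    a geometric rate. By the inequality of M. Riesz the projections of the
    latter form a Cauchy sequence, whose limit has the required coefficients. *)
Lemma riesz_real p (u : F) : 1 < p -> (forall t, complex.Im (u t) = 0) -> Lp p%:E u ->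
  exists2 g, Lp p%:E g & (forall n, fourier g n = if 0 <= n then fourier u n else 0) /\
    forall e, 0 < e -> exists r : {poly C},
      \int[mu]_x modc (fun t => g t - polyfun r t) x `^ p <= e.
Proof.
move=> p1 u0 Lu; have p0 : 0 < p by exact: lt_trans p1.
have p1' := ltW p1; have P2 : 0 < 2 `^ p :> R by exact: powR_gt0.
have [K K0 HK] := analytic_part_bound p1.
pose q := cauchy_rate p; have q0 : 0 < q := cauchy_rate_gt0 p.
have q1 : q < 1 by apply: cauchy_rate_lt1; exact: ltW.
pose c := K * 2 `^ p * 2; have c0 : 0 < c by rewrite !mulr_gt0.
have uE t : u t = (complex.Re (u t))%:C%C by exact: complexP.
have [mu_ iu] := (LpP u p0).1 Lu.
have mru := mu_.1.
have iru : intg (fun x => `|complex.Re (u (cis x))| `^ p).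
  rewrite (_ : (fun x => _) = fun x => modc u x `^ p)//.
  by apply/funext => x; rewrite /modc [in RHS]uE normc_real.
have ch n : exists r : {poly C}, complex.Im r`_0 = 0 /\
    (intg (fun x => `|complex.Re (u (cis x)) - complex.Re (polyfun r (cis x))| `^ p) /\
     \int[mu]_x `|complex.Re (u (cis x)) - complex.Re (polyfun r (cis x))| `^ p <= q ^+ n / c).
  have [|t [r r0 tr] [i1 e1]] := dense_Lp p0 mru iru (e := q ^+ n / c).
    by rewrite divr_gt0// exprn_gt0.
  exists r; split=> //; rewrite (_ : (fun x => _) = fun x => `|complex.Re (u (cis x)) - t (cis x)| `^ p)//.
  by apply/funext => x; rewrite tr.
have [r hr] := choice ch.
have qS n : q ^+ n.+1 / c <= q ^+ n / c.
  by rewrite ler_pM2r ?invr_gt0// exprS ler_piMl ?exprn_ge0// ltW.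
have rate n : \int[mu]_x modc (polyfun (analytic_part (r n.+1) - analytic_part (r n))) x `^ p <= q ^+ n.
  rewrite -analytic_partB; apply: le_trans (HK _ _) _.
    by rewrite coefB cImD cImN (hr n).1 (hr n.+1).1 subrr.
  have [_ [i1 e1]] := hr n; have [_ [i2 e2]] := hr n.+1.
  have mr k : measurable_fun [set: T] (fun x => complex.Re (u (cis x)) - complex.Re (polyfun (r k) (cis x))).
    by apply: measurable_funB => //; exact: (bmeas_Re_polyfun _).1.
  have i2' : intg (fun x => `|- (complex.Re (u (cis x)) - complex.Re (polyfun (r n.+1) (cis x)))| `^ p).
    by under [fun x => `|- _| `^ p]eq_fun do rewrite normrN.
  have [_ h] := intg_powR_add (ltW p0) (mr n) (measurable_funN (mr n.+1)) i1 i2'.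
  move: h; rewrite (_ : (fun x => `|_ + - _| `^ p) = fun x => `|complex.Re (polyfun (r n.+1 - r n) (cis x))| `^ p); last first.
    by apply/funext => x; rewrite polyfunB cReD cReN; congr (`|_| `^ _); ring.
  under [fun x => `|- _| `^ p]eq_fun do rewrite normrN.
  move=> h; have e2' := le_trans e2 (qS n).
  apply: le_trans (ler_wpM2l (ltW K0) (le_trans h (ler_wpM2l (ltW P2) (lerD e1 e2')))) _.
  rewrite le_eqVlt; apply/orP; left; apply/eqP; rewrite /c; field.
  by rewrite !gt_eqF.
have [g Lg [K' K'0 hg]] := Lp_complete p1' rate.
have small e : 0 < e -> exists n, K' * q ^+ n < e /\ q ^+ n / c < e.
  move=> e0; have [|n hn] := @geometric_to0 R q (K' + c^-1) _ e e0.
    by rewrite (ltW q0).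
  have qn : 0 < q ^+ n by exact: exprn_gt0.
  have [P1 P2'] : 0 < K' * q ^+ n /\ 0 < c^-1 * q ^+ n.
    by split; apply: mulr_gt0; rewrite ?invr_gt0.
  by move: hn; rewrite mulrDl => hn; exists n; split; [|rewrite mulrC]; lra.
exists g => //; split; last first.
  by move=> e /small[n [/ltW hn _]]; exists (analytic_part (r n)); exact: le_trans (hg n) hn.
have crf k : cint (fun t => (complex.Re (polyfun (r k) t))%:C%C).
  have [M _ rM] := polyfun_bounded (r k).
  apply: (@cint_bounded _ M); last by move=> t; rewrite normc_real; exact: le_trans (le_Re_normc _) (rM t).
  by split; [exact: (bmeas_Re_polyfun _).1|exact: measurable_cst].
move=> n; apply/eqP; rewrite -subr_eq0; apply/eqP.
apply: (@normc_le_eps _ _ 2) => // e e0.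
have [d d0 hd] := fourier_small p1' e0.
have [k [/ltW h1 /ltW h2]] := small _ d0.
rewrite -(subrK (fourier (polyfun (analytic_part (r k))) n) (fourier g n)) -addrA.
apply: le_trans (le_normcD _ _) _; rewrite (mulrDl 1 1 e) mul1r; apply: lerD.
  rewrite -fourierB; [|exact: Lp_cint p1' Lg|exact: cint_polyfun].
  apply: hd; last exact: le_trans (hg k) h1.
  by apply: LpB => //; exact: Lp_polyfun.
rewrite fourier_analytic_part; last exact: (hr k).1.
case: ifP => _; last by rewrite subrr normc0 ltW.
rewrite -normcN opprB -fourierB//; last exact: Lp_cint p1' Lu.
have E : modc (fun t => u t - (complex.Re (polyfun (r k) t))%:C%C) =
         fun x => `|complex.Re (u (cis x)) - complex.Re (polyfun (r k) (cis x))|.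
  by apply/funext => x; rewrite /modc uE -rmorphB normc_real.
have [_ [i1 e1]] := hr k.
apply: hd; last by rewrite E; exact: le_trans e1 h2.
apply/(LpP _ p0); split; last by rewrite E.
by apply: cmeasB => //; exact: (crf k).1.
Qed.

(** The real and imaginary parts of f are projected separately. The last clause
    is the source of the density of analytic polynomials in H^p. *)
Theorem riesz_exists p f : 1 < p -> Lp p%:E f ->
  exists2 g, Lp p%:E g & (forall n, fourier g n = if 0 <= n then fourier f n else 0) /\
    forall e, 0 < e -> exists r : {poly C},
      \int[mu]_x modc (fun t => g t - polyfun r t) x `^ p <= e.
Proof.
move=> p1 Lf; have p0 : 0 < p by exact: lt_trans p1.
have p1' := ltW p1; have P2 : 0 < 2 `^ p :> R by exact: powR_gt0.
pose u : F := fun t => (complex.Re (f t))%:C%C.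
pose v : F := fun t => (complex.Im (f t))%:C%C.
have mf := ((LpP f p0).1 Lf).1.
have Lu : Lp p%:E u.
  apply: (@Lp_ae_le _ p 1 u f) => //; first by split; [exact: mf.1|exact: measurable_cst].
  by apply: aeW => x; rewrite mul1r /modc normc_real le_Re_normc.
have Lv : Lp p%:E v.
  apply: (@Lp_ae_le _ p 1 v f) => //; first by split; [exact: mf.2|exact: measurable_cst].
  by apply: aeW => x; rewrite mul1r /modc normc_real le_Im_normc.
have fE : f = fun t => u t + 'i%C * v t.
  apply/funext => t; apply: complexP; rewrite /u /v /=; ring.
have [g Lg [g1 g2]] := riesz_real p1 (fun t => erefl : complex.Im (u t) = 0) Lu.
have [h Lh [h1 h2]] := riesz_real p1 (fun t => erefl : complex.Im (v t) = 0) Lv.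
have ci := Lp_cint p1'.
exists (fun t => g t + 'i%C * h t); first by apply: LpD => //; exact: LpZ.
split=> [n|e e0].
  rewrite fE !fourierD ?fourierZ; try (by [exact: ci|apply: cintZ; exact: ci]).
  by rewrite g1 h1; case: ifP; rewrite // mulr0 addr0.
pose e' := e / (2 `^ p * 2); have e'0 : 0 < e' by rewrite divr_gt0// mulr_gt0.
have [r hr] := g2 _ e'0; have [s hs] := h2 _ e'0.
exists (r + 'i%C *: s).
have L1 : Lp p%:E (fun t => g t - polyfun r t) by apply: LpB => //; exact: Lp_polyfun.
have L2 : Lp p%:E (fun t => h t - polyfun s t) by apply: LpB => //; exact: Lp_polyfun.
have L3 : Lp p%:E (fun t => 'i%C * (h t - polyfun s t)) by exact: LpZ.
rewrite (_ : (fun t => _) = fun t => (g t - polyfun r t) + 'i%C * (h t - polyfun s t)); last first.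
  by apply/funext => t; rewrite /polyfun hornerD hornerZ; ring.
apply: le_trans (LpD_int p0 L1 L3) _.
rewrite (_ : modc (fun t => 'i%C * _) = modc (fun t => h t - polyfun s t)); last first.
  by apply/funext => x; rewrite /modc normcM [normc 'i%C](_ : _ = 1) ?mul1r//= expr0n/= add0r expr1n sqrtr1.
apply: (@le_trans _ _ (2 `^ p * (e' + e'))); first by rewrite ler_pM2l// lerD.
rewrite le_eqVlt; apply/orP; left; apply/eqP; rewrite /e'; field.
by rewrite gt_eqF.
Qed.

End RieszProjection.

(** * Hardy spaces *)

Section HardyTheory.
Context {R : realType}.
Local Notation C := (R[i]).
Local Notation T := (measurableTypeR R).
Local Notation mu := (arc_length R).
Local Notation F := (circle R -> C).
Local Notation cint := cintegrable.
Implicit Types (p q : R) (f g h : F).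

(** ** Pointwise almost everywhere *)

Lemma aeq_trans f g h : aeq f g -> aeq g h -> aeq f h.
Proof. by apply: ae_imply2 => x -> ->. Qed.

Lemma Jop_cis f x : Jop f (cis x) = f (cis (- x)) * zexp (-1) (cis x).
Proof. by rewrite JopE tilde_cis. Qed.

Definition ebounded f := cmeasurable f /\
  exists M : R, {ae mu, forall x, modc f x <= M}.

Lemma Lp_ebounded f : Lp +oo%E f -> ebounded f.
Proof.
move=> [mf]; rewrite /Lp_norm unlock ifT; last first.
  by rewrite arc_lengthT lte_fin pi2_gt0.
set E := ess_sup_inf.ess_sup _ _ => Ey; split=> //.
have := @ess_sup_inf.ess_sup_ge _ _ _ mu (abse \o (fun x => (normc (f (cis x)))%:E)).
rewrite -/E => h; exists (fine E); apply: filterS h => x /= h.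
have E0 : (0 <= E)%E by apply: le_trans h; rewrite lee_fin.
move: h; rewrite /modc -[X in (_ <= X)%E -> _](@fineK _ E) ?ge0_fin_numE//.
by rewrite lee_fin ger0_norm ?normc_ge0.
Qed.

Lemma eboundedM f g : ebounded f -> ebounded g -> ebounded (fun t => f t * g t).
Proof.
move=> [mf [M fM]] [mg [N gN]]; split; first exact: cmeasM.
exists (M * N); apply: ae_imply2 fM gN => x fM gN.
by rewrite /modc normcM; apply: ler_pM; rewrite ?normc_ge0.
Qed.

Lemma ebounded_aeq f g : cmeasurable f -> aeq f g -> ebounded g -> ebounded f.
Proof.
move=> mf fg [_ [M gM]]; split=> //; exists M.
by apply: ae_imply2 fg gM => x; rewrite /modc => ->.
Qed.

Lemma ebounded_zexp n : ebounded (@zexp R n).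
Proof.
split; first exact: cmeas_zexp.
by exists 1; apply: aeW => x; rewrite /modc normc_zexp.
Qed.

Lemma ebounded_tilde f : ebounded f -> ebounded (tilde f).
Proof.
move=> [mf [M fM]]; split; first exact: cmeas_tilde.
by exists M; move: fM => /ae_opp; apply: ae_imply => x; rewrite /modc tilde_cis.
Qed.

Lemma Lp_eboundedM p f g : 0 < p -> ebounded f -> Lp p%:E g -> Lp p%:E (fun t => f t * g t).
Proof. by move=> p0 [mf [M fM]]; exact: LpM_bounded fM. Qed.

Lemma cint_eboundedM f g : ebounded f -> cint g -> cint (fun t => f t * g t).
Proof. by move=> [mf [M fM]]; exact: cintM_bounded fM. Qed.

Lemma Lp_ebounded_fin p f : 0 < p -> ebounded f -> Lp p%:E f.
Proof.
move=> p0 bf; rewrite (_ : f = fun t => f t * 1); last first.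
  by apply/funext => t; rewrite mulr1.
apply: Lp_eboundedM => //; apply: (@Lp_bounded _ p 1 (fun=> 1)) => //.
by move=> t; rewrite normc_real normr1.
Qed.

(** ** Hölder pairing *)

Section Pairing.
Context (p q : R) (p0 : 0 < p) (q0 : 0 < q) (pq : p^-1 + q^-1 = 1).

Lemma young (l a b : R) : 0 < l -> 0 <= a -> 0 <= b ->
  a * b <= l `^ p / p * a `^ p + (l^-1) `^ q / q * b `^ q.
Proof.
move=> l0 a0 b0.
have := @conjugate_powR _ (l * a) (l^-1 * b) p q _ _ p0 q0 pq.
rewrite !mulr_ge0 ?invr_ge0 ?(ltW l0)// => /(_ isT isT).
rewrite (_ : l * a * (l^-1 * b) = a * b); last by field; rewrite gt_eqF.
by rewrite !powRM ?invr_ge0 ?(ltW l0)// (mulrAC (l `^ p)) (mulrAC (_ `^ q)).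
Qed.

Lemma cintM f g : Lp p%:E f -> Lp q%:E g -> cint (fun t => f t * g t).
Proof.
move=> /(LpP _ p0)[mf jf] /(LpP _ q0)[mg jg].
apply: (cint_ae_le (cmeasM mf mg)
  (g := fun x => 1 `^ p / p * modc f x `^ p + (1^-1) `^ q / q * modc g x `^ q)).
  by apply: intgD; exact: intgZ.
by apply: aeW => x; rewrite /modc normcM; apply: young; rewrite ?normc_ge0.
Qed.

(** Continuity of the pairing of L^p and L^q, from Young's inequality with a
    scale l balancing the two factors. *)
Lemma int_modcM_small g : Lp q%:E g -> forall e, 0 < e -> exists2 d : R, 0 < d &
  forall f, Lp p%:E f -> \int[mu]_x modc f x `^ p <= d ->
  \int[mu]_x modc (fun t => f t * g t) x <= e.
Proof.
move=> Lg e e0; have [mg jg] := (LpP g q0).1 Lg.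
set G := \int[mu]_x modc g x `^ q.
have G0 : 0 <= G by apply: Rintegral_ge0 => x _; exact: powR_ge0.
(* chosen so that m^q G / q <= e / 2 *)
pose m := (e * q / (2 * (1 + G))) `^ q^-1.
have X0 : 0 < e * q / (2 * (1 + G)) by rewrite divr_gt0 ?mulr_gt0// ltr_wpDr.
have m0 : 0 < m by exact: powR_gt0.
have mq : m `^ q = e * q / (2 * (1 + G)).
  by rewrite /m -powRrM mulVf ?gt_eqF// powRr1// ltW.
pose l := m^-1; have l0 : 0 < l by rewrite invr_gt0.
have lp : 0 < l `^ p / p by rewrite divr_gt0// powR_gt0.
exists (e / 2 / (l `^ p / p)); first by rewrite !divr_gt0// powR_gt0.
move=> f Lf fd; have [mf jf] := (LpP f p0).1 Lf; have [_ jfg] := cintM Lf Lg.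
apply: (@le_trans _ _ (\int[mu]_x (l `^ p / p * modc f x `^ p + (l^-1) `^ q / q * modc g x `^ q))).
  apply: le_Rintegral => //; first by apply: intgD; exact: intgZ.
  by move=> x _; rewrite /modc normcM; apply: young; rewrite ?normc_ge0.
rewrite RintegralD//; [|exact: intgZ..]; rewrite !RintegralZl// -/G /l invrK mq -/l.
have h1 : l `^ p / p * \int[mu]_x modc f x `^ p <= e / 2.
  by rewrite mulrC -ler_pdivlMr.
have h2 : e * q / (2 * (1 + G)) / q * G <= e / 2.
  have -> : e * q / (2 * (1 + G)) / q * G = e / 2 * (G / (1 + G)).
    by field; rewrite !gt_eqF// ltr_wpDr.
  by rewrite ler_piMr ?divr_ge0 ?(ltW e0)// ler_pdivrMr ?mul1r ?ltr_wpDr// lerDr.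
by apply: le_trans (lerD h1 h2) _; rewrite -splitr.
Qed.

End Pairing.

(** ** The Riesz projection and density of polynomials *)

Lemma rieszP p f : 1 < p -> Lp p%:E f -> Lp p%:E (riesz p f) /\
  forall n, fourier (riesz p f) n = if 0 <= n then fourier f n else 0.
Proof.
move=> p1 Lf; rewrite /riesz; have [g Lg [g1 _]] := riesz_exists p1 Lf.
set S := [set g | _]; exact: (@xgetPex _ _ S (ex_intro S g (conj Lg g1))).
Qed.

Lemma Lp_cmeas p f : Lp p%:E f -> cmeasurable f. Proof. by case. Qed.

Lemma riesz_hardy p f : 1 < p -> Lp p%:E f -> Hardy p (riesz p f).
Proof.
move=> p1 Lf; have [L h] := rieszP p1 Lf; split=> // n n0.
by rewrite h leNgt n0.
Qed.

Lemma Lp_fourier_inj p f g : 1 <= p -> Lp p%:E f -> Lp p%:E g ->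
  (forall n, fourier f n = fourier g n) -> aeq f g.
Proof. by move=> p1 Lf Lg; apply: fourier_inj; exact: Lp_cint p1 _. Qed.

(** Here f need not be in L^p: this is applied to functions of L^q whose
    projection happens to be a polynomial. *)
Lemma riesz_uniq p f g : 1 <= p -> Lp p%:E g ->
  (forall n, fourier g n = if 0 <= n then fourier f n else 0) ->
  aeq (riesz p f) g.
Proof.
move=> p1 Lg gf.
have [L h] : Lp p%:E (riesz p f) /\
    forall n, fourier (riesz p f) n = if 0 <= n then fourier f n else 0.
  rewrite /riesz; set S := [set g | _].
  exact: (@xgetPex _ _ S (ex_intro S g (conj Lg gf))).
by apply: Lp_fourier_inj L Lg _ => // n; rewrite h gf.
Qed.

Lemma riesz_id p f : 1 <= p -> Hardy p f -> aeq (riesz p f) f.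
Proof.
move=> p1 [Lf f0]; apply: riesz_uniq => // n.
by case: leP => // n0; exact: f0.
Qed.

Lemma hardy_aeq p f g : 0 < p -> cmeasurable f -> aeq f g -> Hardy p g -> Hardy p f.
Proof.
move=> p0 mf fg [Lg g0]; split; first exact: Lp_aeq fg Lg.
by move=> n n0; rewrite -(g0 n n0); apply: fourier_aeq fg => //; exact: Lp_cmeas Lg.
Qed.

Lemma hardyD p f g : 1 <= p -> Hardy p f -> Hardy p g -> Hardy p (fun t => f t + g t).
Proof.
move=> p1 [Lf f0] [Lg g0]; have p0 : 0 < p by exact: lt_le_trans p1.
split=> [|n n0]; first exact: LpD.
by rewrite fourierD ?f0 ?g0 ?addr0//; exact: Lp_cint p1 _.
Qed.

Lemma hardyZ p (z : C) f : 1 <= p -> Hardy p f -> Hardy p (fun t => z * f t).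
Proof.
move=> p1 [Lf f0]; have p0 : 0 < p by exact: lt_le_trans p1.
split=> [|n n0]; first exact: LpZ.
by rewrite fourierZ ?f0 ?mulr0//; exact: Lp_cint p1 _.
Qed.

Lemma hardyB p f g : 1 <= p -> Hardy p f -> Hardy p g -> Hardy p (fun t => f t - g t).
Proof.
move=> p1 Hf Hg; rewrite (_ : (fun t => _) = fun t => f t + (-1) * g t).
  by apply: hardyD => //; exact: hardyZ.
by apply/funext => t; rewrite mulN1r.
Qed.

Lemma hardy_polyfun p (r : {poly C}) : 0 < p -> Hardy p (polyfun r).
Proof.
by move=> p0; split=> [|[]// n _]; [exact: Lp_polyfun|rewrite fourier_polyfun].
Qed.

Lemma hardy_dense p f : 1 < p -> Hardy p f -> forall e, 0 < e ->
  exists r : {poly C}, \int[mu]_x modc (fun t => f t - polyfun r t) x `^ p <= e.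
Proof.
move=> p1 [Lf f0] e e0; have p0 : 0 < p by exact: lt_trans p1.
have [g Lg [g1 g2]] := riesz_exists p1 Lf; have [r hr] := g2 e e0; exists r.
have fg : aeq f g.
  apply: (Lp_fourier_inj (ltW p1)) => // n; rewrite g1.
  by case: leP => // n0; exact: f0.
apply: le_trans hr; rewrite le_eqVlt; apply/orP; left; apply/eqP.
have mp h : cmeasurable h -> measurable_fun [set: T] (fun x => modc (fun t => h t - polyfun r t) x `^ p).
  move=> mh; apply: (measurableT_comp (measurable_powR p)); apply: cmeas_modc.
  by apply: cmeasB => //; exact: cmeas_polyfun.
apply: ae_eq_int; [exact: mp (Lp_cmeas Lf)|exact: mp (Lp_cmeas Lg)|].
by apply: ae_imply fg => x; rewrite /modc => ->.
Qed.

(** Additive functionals on H^p that are continuous at 0. Two of them agree as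
    soon as they agree on polynomials. *)
Definition hardy_cont p (L : F -> C) :=
  (forall f g, Hardy p f -> Hardy p g -> L (fun t => f t - g t) = L f - L g) /\
  forall e, 0 < e -> exists2 d : R, 0 < d &
    forall f, Hardy p f -> \int[mu]_x modc f x `^ p <= d -> normc (L f) <= e.

Lemma hardy_cont_eq p (L L' : F -> C) : 1 < p -> hardy_cont p L -> hardy_cont p L' ->
  (forall r : {poly C}, L (polyfun r) = L' (polyfun r)) ->
  forall f, Hardy p f -> L f = L' f.
Proof.
move=> p1 [LB Lc] [LB' Lc'] LL f Hf; have p0 : 0 < p by exact: lt_trans p1.
apply/eqP; rewrite -subr_eq0; apply/eqP; apply: (@normc_le_eps _ _ 2) => // e e0.
have [d d0 hd] := Lc _ e0; have [d' d'0 hd'] := Lc' _ e0.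
have [|r hr] := hardy_dense p1 Hf (e := Num.min d d'); first by rewrite lt_min d0.
have Hr := @hardy_polyfun p r p0; have Hfr := hardyB (ltW p1) Hf Hr.
have -> : L f - L' f = L (fun t => f t - polyfun r t) - L' (fun t => f t - polyfun r t).
  by rewrite LB// LB'// LL; ring.
apply: le_trans (le_normcD _ _) _; rewrite normcN (mulrDl 1 1 e) mul1r; apply: lerD.
  by apply: hd => //; apply: le_trans hr _; rewrite ge_min lexx.
by apply: hd' => //; apply: le_trans hr _; rewrite ge_min lexx orbT.
Qed.

Lemma hardy_cont0 p : hardy_cont p (fun=> 0).
Proof. by split=> [f g _ _|e e0]; [rewrite subr0|exists 1 => // f _ _; rewrite normc0 ltW]. Qed.

Lemma hardy_cont_mul p q g n : 1 < p -> 0 < q -> p^-1 + q^-1 = 1 -> Lp q%:E g ->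
  hardy_cont p (fun f => fourier (fun t => f t * g t) n).
Proof.
move=> p1 q0 pq Lg; have p0 : 0 < p by exact: lt_trans p1.
split=> [f h [Lf _] [Lh _]|e e0].
  rewrite (_ : (fun t => _) = fun t => f t * g t - h t * g t).
    by apply: fourierB; exact: (cintM p0 q0 pq).
  by apply/funext => t; rewrite mulrBl.
have [d d0 hd] := int_modcM_small p0 q0 pq Lg e0; exists d => // f [Lf _] fd.
by apply: le_trans (normc_fourier _ (cintM p0 q0 pq Lf Lg)) _; exact: hd.
Qed.

Lemma hardy_contZ p z (L : F -> C) : hardy_cont p L -> hardy_cont p (fun f => z * L f).
Proof.
move=> [LB Lc]; split=> [f g Hf Hg|e e0]; first by rewrite LB// mulrBr.
have z1 : 0 < normc z + 1 by rewrite ltr_wpDl ?normc_ge0.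
have [|d d0 hd] := Lc (e / (normc z + 1)); first by rewrite divr_gt0.
exists d => // f Hf fd; rewrite normcM.
apply: (@le_trans _ _ ((normc z + 1) * (e / (normc z + 1)))); last first.
  by rewrite mulrC divfK ?gt_eqF.
by apply: ler_pM; rewrite ?normc_ge0//; [rewrite lerDl|exact: hd].
Qed.

Lemma hardy_cont_fourier p n : 1 < p -> hardy_cont p (fourier ^~ n).
Proof.
move=> p1; split=> [f g [Lf _] [Lg _]|e e0].
  by apply: fourierB; exact: Lp_cint (ltW p1) _.
by have [d d0 hd] := fourier_small (ltW p1) e0; exists d => // f [Lf _]; exact: hd.
Qed.

Lemma hardy_cont_op p q (A : F -> F) g n : 1 < p -> 0 < q -> p^-1 + q^-1 = 1 ->
  bounded_op p A -> Lp q%:E g -> hardy_cont p (fun f => fourier (fun t => A f t * g t) n).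
Proof.
move=> p1 q0 pq [AH Al [M AM]] Lg; have p0 : 0 < p by exact: lt_trans p1.
have cA f : Hardy p f -> cint (fun t => A f t * g t).
  by move=> /AH[LA _]; exact: (cintM p0 q0 pq).
split=> [f h Hf Hh|e e0].
  have Hfh := hardyB (ltW p1) Hf Hh.
  rewrite -fourierB; [|exact: cA..]; apply: fourier_aeq.
  - exact: (cA _ Hfh).1.
  - by apply: cmeasB; [exact: (cA _ Hf).1|exact: (cA _ Hh).1].
  - rewrite (_ : (fun t => f t - h t) = fun t => (-1) * h t + f t); last first.
      by apply/funext => t; rewrite mulN1r addrC.
    by apply: ae_imply (Al (-1) _ _ Hh Hf) => x ->; ring.
have [d d0 hd] := int_modcM_small p0 q0 pq Lg e0.
pose N := `|M| + 1; have N0 : 0 < N by rewrite ltr_wpDl.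
exists (d / N `^ p); first by rewrite divr_gt0// powR_gt0.
move=> f Hf fd; have HA := AH _ Hf.
apply: le_trans (normc_fourier _ (cA _ Hf)) _; apply: hd; first exact: HA.1.
have := AM _ Hf; rewrite (Lp_normE p0 HA.1) (Lp_normE p0 Hf.1) -EFinM lee_fin.
set I := \int[mu]_x modc (A f) x `^ p; set J := \int[mu]_x modc f x `^ p => IJ.
have I0 : 0 <= I by apply: Rintegral_ge0 => x _; exact: powR_ge0.
have J0 : 0 <= J by apply: Rintegral_ge0 => x _; exact: powR_ge0.
have IJ' : I `^ p^-1 <= N * J `^ p^-1.
  apply: le_trans IJ _; rewrite ler_wpM2r ?powR_ge0//.
  by apply: le_trans (ler_norm M) _; rewrite lerDl.
have rt (x : R) : 0 <= x -> (x `^ p^-1) `^ p = x.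
  by move=> x0; rewrite -powRrM mulVf ?gt_eqF// powRr1.
rewrite -(rt I)//; apply: (@le_trans _ _ ((N * J `^ p^-1) `^ p)).
  apply: ge0_ler_powR; rewrite ?nnegrE ?powR_ge0 ?mulr_ge0 ?powR_ge0 ?(ltW N0)//.
  exact: ltW.
rewrite powRM ?powR_ge0 ?(ltW N0)// rt//.
by rewrite mulrC -ler_pdivlMr// powR_gt0.
Qed.

(** ** Products *)

Section Products.
Context (p q : R) (p1 : 1 < p) (q1 : 1 < q) (pq : p^-1 + q^-1 = 1).
Let p0 : 0 < p. Proof. exact: lt_trans p1. Qed.
Let q0 : 0 < q. Proof. exact: lt_trans q1. Qed.

Lemma cint_hardyM f g : Hardy p f -> Hardy q g -> cint (fun t => f t * g t).
Proof. by move=> [Lf _] [Lg _]; exact: (cintM p0 q0 pq). Qed.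

Lemma fourier_polyfunM (r : {poly C}) g n : cint g ->
  fourier (fun t => polyfun r t * g t) n = \sum_(i < size r) r`_i * fourier g (n - i%:Z).
Proof.
move=> cg; rewrite (_ : (fun t => _) = fun t => \sum_(i < size r) r`_i * (g t * zexp i%:Z t)).
  rewrite fourier_sum; last by move=> i; apply: cintZ; exact: cint_zexpM.
  apply: eq_bigr => i _; rewrite fourierZ ?fourier_shift//; exact: cint_zexpM.
apply/funext => t; rewrite polyfunE mulr_suml; apply: eq_bigr => i _.
by rewrite -mulrA (mulrC (zexp _ t)).
Qed.

(** For a polynomial f the product is a combination of forward shifts of g. *)
Lemma fourier_hardyM_neg f g n : n < 0 -> Hardy p f -> Hardy q g ->
  fourier (fun t => f t * g t) n = 0.
Proof.
move=> n0 Hf [Lg g0].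
apply: (hardy_cont_eq p1 (hardy_cont_mul n p1 q0 pq Lg) (hardy_cont0 p) _ Hf) => r.
rewrite fourier_polyfunM; last exact: Lp_cint (ltW q1) Lg.
apply: big1 => i _; rewrite g0 ?mulr0//.
by apply: le_lt_trans n0; rewrite gerBl.
Qed.

Lemma fourier_hardyM0 f g : Hardy p f -> Hardy q g ->
  fourier (fun t => f t * g t) 0 = fourier f 0 * fourier g 0.
Proof.
move=> Hf [Lg g0]; rewrite mulrC.
apply: (hardy_cont_eq p1 (hardy_cont_mul 0 p1 q0 pq Lg)
  (hardy_contZ (fourier g 0) (hardy_cont_fourier 0 p1)) _ Hf) => r.
rewrite fourier_polyfunM; last exact: Lp_cint (ltW q1) Lg.
rewrite fourier_polyfun; have [->|] := eqVneq r 0.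
  by rewrite size_poly0 big_ord0 /= coef0 mulr0.
rewrite -size_poly_gt0 => s0.
rewrite -(prednK s0) big_ord_recl /= subr0 big1 ?addr0 ?(mulrC (fourier _ _))// => i _.
by rewrite g0 ?mulr0// sub0r oppr_lt0.
Qed.

Lemma cohardy_tilde s f : 0 < s -> 1 <= s -> coHardy s f -> Hardy s (tilde f).
Proof.
move=> s0 s1 [Lf f0]; split; first exact: Lp_tilde.
by move=> n n0; rewrite fourier_tilde ?f0 ?oppr_gt0//; exact: Lp_cint Lf.
Qed.

Lemma fourier_cohardyM_pos f g n : 0 < n -> coHardy p f -> coHardy q g ->
  fourier (fun t => f t * g t) n = 0.
Proof.
move=> n0 Hf Hg; rewrite -(opprK n) -fourier_tilde.
  rewrite (_ : tilde _ = fun t => tilde f t * tilde g t)//.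
  by apply: fourier_hardyM_neg; rewrite ?oppr_lt0//; apply: cohardy_tilde => //; exact: ltW.
by apply: (cintM p0 q0 pq); [case: Hf|case: Hg].
Qed.

Lemma fourier_cohardyM0 f g : coHardy p f -> coHardy q g ->
  fourier (fun t => f t * g t) 0 = fourier f 0 * fourier g 0.
Proof.
move=> Hf Hg; have cf := Lp_cint (ltW p1) Hf.1; have cg := Lp_cint (ltW q1) Hg.1.
have E h : cint h -> fourier h 0 = fourier (tilde h) 0.
  by move=> ch; rewrite fourier_tilde// oppr0.
have cfg : cint (fun t => f t * g t) by apply: (cintM p0 q0 pq); [case: Hf|case: Hg].
rewrite (E _ cf) (E _ cg) (E _ cfg).
by apply: fourier_hardyM0; apply: cohardy_tilde => //; exact: ltW.
Qed.

End Products.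
End HardyTheory.

(** * The operator of a Wiener-Hopf factorization *)

Section WienerHopf.
Context {R : realType}.
Local Notation C := (R[i]).
Local Notation T := (measurableTypeR R).
Local Notation mu := (arc_length R).
Local Notation F := (circle R -> C).
Local Notation cint := cintegrable.
Context (p q : R) (p1 : 1 < p) (q1 : 1 < q) (pq : p^-1 + q^-1 = 1).
Implicit Types (f g h : F) (n j : int).

Let p0 : 0 < p. Proof. exact: lt_trans p1. Qed.
Let q0 : 0 < q. Proof. exact: lt_trans q1. Qed.

Lemma ae_and (P Q : R -> Prop) : {ae mu, forall x, P x} -> {ae mu, forall x, Q x} ->
  {ae mu, forall x, P x /\ Q x}.
Proof. by apply: ae_imply2. Qed.

Lemma fourier_cst (z : C) n : fourier (fun=> z) n = if n == 0 then z else 0.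
Proof.
rewrite (_ : (fun=> z) = polyfun z%:P); last by apply/funext => t; rewrite /polyfun hornerC.
by rewrite fourier_polyfun; case: n => // k; rewrite coefC.
Qed.

Lemma riesz_aeq f g : cmeasurable f -> aeq f g -> Hardy p g -> aeq (riesz p f) g.
Proof.
move=> mf fg Hg; have Hf := hardy_aeq p0 mf fg Hg.
by apply: aeq_trans (riesz_id (ltW p1) Hf) fg.
Qed.

Lemma toeplitz_aeq g f : ebounded g -> Hardy p f -> Hardy p (toeplitz p g f) /\
  forall n, fourier (toeplitz p g f) n = if 0 <= n then fourier (fun t => g t * f t) n else 0.
Proof.
move=> bg Hf; have L : Lp p%:E (fun t => g t * riesz p f t).
  by apply: Lp_eboundedM => //; exact: (riesz_hardy p1 Hf.1).1.
split; first exact: riesz_hardy.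
move=> n; rewrite (rieszP p1 L).2; case: ifP => // _; apply: fourier_aeq.
- exact: Lp_cmeas L.
- exact: Lp_cmeas (Lp_eboundedM p0 bg Hf.1).
- by apply: ae_imply (riesz_id (ltW p1) Hf) => x ->.
Qed.

Lemma toeplitz_zexp n f : Hardy p (fun t => f t * zexp n t) -> Hardy p f ->
  aeq (toeplitz p (zexp n) f) (fun t => f t * zexp n t).
Proof.
move=> Hnf Hf; apply: riesz_aeq => //.
  by apply: cmeasM; [exact: cmeas_zexp|exact: (riesz_hardy p1 Hf.1).1.1].
by apply: ae_imply (riesz_id (ltW p1) Hf) => x /= ->; rewrite mulrC.
Qed.

(** The product has no frequency beyond the degree of r. *)
Lemma cohardy_polyM h (r : {poly C}) : coHardy q h -> exists s : {poly C},
  forall n, fourier (polyfun s) n =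
    if 0 <= n then fourier (fun t => h t * polyfun r t) n else 0.
Proof.
move=> [Lh h0]; have ch := Lp_cint (ltW q1) Lh.
have E n : fourier (fun t => h t * polyfun r t) n =
    \sum_(i < size r) r`_i * fourier h (n - i%:Z).
  rewrite (_ : (fun t => _) = fun t => polyfun r t * h t); last first.
    by apply/funext => t; rewrite mulrC.
  exact: fourier_polyfunM.
exists (\poly_(k < size r) fourier (fun t => h t * polyfun r t) k%:Z) => n.
rewrite fourier_polyfun; case: n => //= k; rewrite coef_poly.
case: ltnP => // rk; rewrite E big1// => i _; rewrite h0 ?mulr0//.
by rewrite subr_gt0 ltz_nat; exact: leq_trans (ltn_ord i) rk.
Qed.

Section Factorization.
Context (g gm gp : F) (n : int) (H : wh_factorization p q g n gm gp).

Lemma wh_op_extension : wh_extension p gm gp (wh_op p gm gp).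
Proof.
have [A HA] := whf_bounded H; rewrite /wh_op.
exact: (@xgetPex _ _ [set A | wh_extension p gm gp A] (ex_intro _ A HA)).
Qed.

Lemma wh_op_hardy f : Hardy p f -> Hardy p (wh_op p gm gp f).
Proof. by have [[h _ _] _] := wh_op_extension; exact: h. Qed.

Lemma wh_op_polyfun (r : {poly C}) : exists2 s : {poly C},
  aeq (wh_op p gm gp (polyfun r)) (fun t => (gp t)^-1 * polyfun s t) &
  forall j, fourier (polyfun s) j =
    if 0 <= j then fourier (fun t => (gm t)^-1 * polyfun r t) j else 0.
Proof.
have [s hs] := cohardy_polyM r (whf_minusV H); exists s => //.
have [_ /(_ r)hA] := wh_op_extension; apply: aeq_trans hA _.
have := @riesz_uniq _ p (recip gm \* polyfun r) _ (ltW p1) (Lp_polyfun s p0) hs.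
by apply: ae_imply => x /= ->.
Qed.

(** Both g_+ and its inverse are analytic, and the product of their means is 1. *)
Lemma plus_mean_neq0 : fourier gp 0 != 0.
Proof.
have := fourier_hardyM0 p1 q1 pq (whf_plusV H) (whf_plus H).
have -> : fourier (fun t => recip gp t * gp t) 0 = fourier (fun=> 1) 0.
  apply: fourier_aeq; last by apply: ae_imply (whf_plus_neq0 H) => x; exact: mulVf.
  - exact: (cint_hardyM p1 q1 pq (whf_plusV H) (whf_plus H)).1.
  - exact: cmeas_cst.
by rewrite fourier_cst eqxx => h; apply/eqP => h0; move/eqP: h; rewrite h0 mulr0 oner_eq0.
Qed.

(** On a polynomial r, the operator gives y with g_+ y = P (g_-^-1 r), hence
    g_- g_+ y = r - g_- Q (g_-^-1 r) where the last term has only negative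
    frequencies. Both relations pass to all of H^p by density. *)
Lemma wh_op_fourier f j : ebounded g -> Hardy p f -> 0 <= j ->
  fourier (fun t => wh_op p gm gp f t * (g t * zexp (- n) t)) j = fourier f j.
Proof.
move=> bg Hf j0; have [bA _] := wh_op_extension.
have bgz : ebounded (fun t => g t * zexp (- n) t).
  by apply: eboundedM => //; exact: ebounded_zexp.
have Lgz := Lp_ebounded_fin q0 bgz.
apply: (hardy_cont_eq p1 (hardy_cont_op j p1 q0 pq bA Lgz) (hardy_cont_fourier j p1) _ Hf) => r.
have [s As sE] := wh_op_polyfun r.
have LVr : Lp q%:E (fun t => (gm t)^-1 * polyfun r t).
  have [M _ rM] := polyfun_bounded r.
  rewrite (_ : (fun t => _) = fun t => polyfun r t * recip gm t).
    apply: (LpM_bounded (M := M)) => //; first exact: cmeas_polyfun.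
      by apply: aeW => x; exact: rM.
    exact: (whf_minusV H).1.
  by apply/funext => t; rewrite mulrC.
pose eta t := (gm t)^-1 * polyfun r t - polyfun s t.
have Leta : Lp q%:E eta by apply: LpB => //; exact: Lp_polyfun.
have eta0 k : 0 <= k -> fourier eta k = 0.
  by move=> k0; rewrite fourierB ?sE ?k0 ?subrr//; [exact: Lp_cint (ltW q1) LVr|exact: cint_polyfun].
have Heta : coHardy q eta by split=> // k /ltW; exact: eta0.
have cge : cint (fun t => gm t * eta t) := cintM p0 q0 pq (whf_minus H).1 Leta.
have ge0 : fourier (fun t => gm t * eta t) j = 0.
  move: j0; rewrite le_eqVlt => /predU1P[<-|j0].
    by rewrite (fourier_cohardyM0 p1 q1 pq (whf_minus H) Heta) eta0// mulr0.
  exact: (fourier_cohardyM_pos p1 q1 pq j0 (whf_minus H) Heta).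
rewrite -[RHS]subr0 -ge0 -fourierB//; last exact: cint_polyfun.
apply: fourier_aeq.
- by apply: cmeasM; [exact: (wh_op_hardy (hardy_polyfun r p0)).1.1|exact: bgz.1].
- by apply: cmeasB; [exact: cmeas_polyfun|exact: cge.1].
- have n0 := ae_and (whf_plus_neq0 H) (whf_minus_neq0 H).
  apply: ae_imply3 (whf_eq H) As n0 => x /= -> -> [gp0 gm0].
  rewrite /eta zexpN_inv; field.
  by rewrite gp0 gm0 zexp_neq0.
Qed.

Lemma wh_op_plus f j : Hardy p f ->
  fourier (fun t => wh_op p gm gp f t * gp t) j =
  if 0 <= j then fourier (fun t => f t * (gm t)^-1) j else 0.
Proof.
move=> Hf; have [bA _] := wh_op_extension.
have c1 := hardy_cont_op j p1 q0 pq bA (whf_plus H).1.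
have c2 : hardy_cont p (fun f => if 0 <= j then fourier (fun t => f t * (gm t)^-1) j else 0).
  case: (0 <= j); last exact: hardy_cont0.
  exact: hardy_cont_mul (whf_minusV H).1.
apply: (hardy_cont_eq p1 c1 c2 _ Hf) => r; have [s As sE] := wh_op_polyfun r.
have -> : (fun t => polyfun r t * (gm t)^-1) = fun t => (gm t)^-1 * polyfun r t.
  by apply/funext => t; rewrite mulrC.
rewrite -sE; apply: fourier_aeq.
- by apply: cmeasM; [exact: (wh_op_hardy (hardy_polyfun r p0)).1.1|exact: (whf_plus H).1.1].
- exact: cmeas_polyfun.
- by apply: ae_imply2 As (whf_plus_neq0 H) => x -> g0; rewrite mulrAC mulVf// mul1r.
Qed.

(** ** One-sided inverses of Toeplitz operators *)

(** The n conditions make the first n coefficients of g_+ y vanish. As the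
    mean is multiplicative and g_+ has nonzero mean, the order of vanishing of
    y is that of g_+ y. *)
Lemma wh_op_order f : 0 < n -> Hardy p f ->
  (forall j, 0 <= j -> j < n -> fourier (fun t => f t * (gm t)^-1) j = 0) ->
  forall j, j < n -> fourier (wh_op p gm gp f) j = 0.
Proof.
move=> n0 Hf f0; have Hy := wh_op_hardy Hf; set y := wh_op _ _ _ _ in Hy *.
have cy := Lp_cint (ltW p1) Hy.1.
suff key (k : nat) : k%:Z <= n -> forall j, j < k%:Z -> fourier y j = 0.
  by move=> j jn; apply: (key `|n|%N) => //; rewrite gtz0_abs.
elim: k => [_ j j0|k IH kn j]; first exact: Hy.2.
have kn' : k%:Z < n by apply: lt_le_trans kn; rewrite ltz_nat.
rewrite -addn1 PoszD ltzD1 le_eqVlt => /predU1P[->|]; last by apply: IH; exact: ltW.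
have Hw : Hardy p (fun t => y t * zexp (- k%:Z) t).
  split=> [|i i0]; first by apply: Lp_zexpM => //; case: Hy.
  by rewrite fourier_shift opprK; apply: IH; [exact: ltW|rewrite gtrDr].
have := fourier_hardyM0 p1 q1 pq Hw (whf_plus H).
rewrite fourier_shift opprK add0r (_ : (fun t => _) = fun t => (y t * gp t) * zexp (- k%:Z) t); last first.
  by apply/funext => t; rewrite mulrAC.
have e0 : fourier (fun t => y t * gp t) k%:Z = 0.
  by rewrite wh_op_plus//= f0.
rewrite fourier_shift opprK add0r e0 => /esym/eqP.
by rewrite mulf_eq0 (negbTE plus_mean_neq0) orbF => /eqP.
Qed.

(** Because y vanishes to order n, its quotient by t^n is still in H^p, and
    wh_op_fourier says that T(g) sends it to f. *)
Lemma toeplitz_linvP f : 0 < n -> ebounded g -> Hardy p f ->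
  (forall j, 0 <= j -> j < n -> fourier (fun t => f t * (gm t)^-1) j = 0) ->
  Hardy p (toeplitz_linv p n gm gp f) /\
  forall j, 0 <= j -> fourier (fun t => toeplitz_linv p n gm gp f t * g t) j = fourier f j.
Proof.
move=> n0 bg Hf f0; have Hy := wh_op_hardy Hf; rewrite /toeplitz_linv.
have y0 := wh_op_order n0 Hf f0; set y := wh_op _ _ _ _ in Hy y0 *.
have Hty : Hardy p (fun t => y t * zexp (- n) t).
  split=> [|i i0]; first by apply: Lp_zexpM => //; case: Hy.
  by rewrite fourier_shift opprK y0// gtrDr.
have Ht : Hardy p (toeplitz p (zexp (- n)) y).
  by apply: (toeplitz_aeq _ Hy).1; exact: ebounded_zexp.
split=> // j j0; rewrite -(wh_op_fourier bg Hf j0) -/y; apply: fourier_aeq.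
- by apply: cmeasM; [exact: Ht.1.1|exact: bg.1].
- apply: cmeasM; first exact: Hy.1.1.
  by apply: cmeasM; [exact: bg.1|exact: cmeas_zexp].
- by apply: ae_imply (toeplitz_zexp Hty Hy) => x ->; rewrite -mulrA (mulrC (zexp _ _)).
Qed.

(** Here T(t^-n) is a forward shift, undone by the factor t^-n in
    wh_op_fourier. *)
Lemma toeplitz_rinvP f : n < 0 -> ebounded g -> Hardy p f ->
  Hardy p (toeplitz_rinv p n gm gp f) /\
  forall j, 0 <= j -> fourier (fun t => toeplitz_rinv p n gm gp f t * g t) j = fourier f j.
Proof.
move=> n0 bg Hf; rewrite /toeplitz_rinv.
have Ht : Hardy p (toeplitz p (zexp (- n)) f).
  by apply: (toeplitz_aeq _ Hf).1; exact: ebounded_zexp.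
have Htf : Hardy p (fun t => f t * zexp (- n) t).
  split=> [|i i0]; first by apply: Lp_zexpM => //; case: Hf.
  by rewrite fourier_shift opprK; apply: Hf.2; rewrite -[ltRHS]addr0 ltrD.
split=> [|j j0]; first exact: wh_op_hardy.
have jn : 0 <= j - n by rewrite subr_ge0; apply: le_trans j0; exact: ltW.
have := wh_op_fourier bg Ht jn.
rewrite (_ : (fun t => _) = fun t => (wh_op p gm gp (toeplitz p (zexp (- n)) f) t * g t) * zexp (- n) t); last first.
  by apply/funext => t; rewrite mulrA.
rewrite fourier_shift opprK subrK => ->.
transitivity (fourier (fun t => f t * zexp (- n) t) (j - n)); last first.
  by rewrite fourier_shift opprK subrK.
apply: fourier_aeq; [exact: Ht.1.1|exact: Htf.1.1|exact: toeplitz_zexp].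
Qed.

(** ** The factorization signature *)

(** The function g_- g_+~ has only nonpositive frequencies. When g g~ = 1 it
    equals (g_+)^-1 (g_-~)^-1, which has only nonnegative ones, so it is
    constant; its value is the product of the means 1 and g_+(0). *)
Lemma signatureP : aeq (fun t => g t * tilde g t) (fun=> 1) ->
  signature gp ^+ 2 = 1 /\ aeq (fun t => gm t * tilde gp t) (fun=> signature gp).
Proof.
move=> gg; have [Hgp HVgp] := (whf_plus H, whf_plusV H).
have [Hgm HVgm] := (whf_minus H, whf_minusV H).
have n0 := ae_and (whf_plus_neq0 H) (whf_minus_neq0 H).
have prod : {ae mu, forall x, gm (cis x) * gp (cis x) * (gm (cis (- x)) * gp (cis (- x))) = 1}.
  have e := ae_and (whf_eq H) (ae_opp (whf_eq H)).
  apply: ae_imply2 gg e => x; rewrite tilde_cis => h [e1 e2]; rewrite -h e1 e2 /=.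
  have -> : zexp n (cis (- x)) = (zexp n (cis x))^-1.
    by rewrite -zexpN_inv -zexp_inv -tilde_cis.
  by field; exact: zexp_neq0.
have Htgp : coHardy q (tilde gp).
  split=> [|j j0]; first by apply: Lp_tilde => //; case: Hgp.
  by rewrite fourier_tilde ?Hgp.2 ?oppr_lt0//; exact: Lp_cint (ltW q1) Hgp.1.
pose u t := gm t * tilde gp t.
have cu : cint u := cintM p0 q0 pq Hgm.1 Htgp.1.
have u0 : fourier u 0 = signature gp.
  rewrite (fourier_cohardyM0 p1 q1 pq Hgm Htgp) (whf_minus_infty H) mul1r.
  by rewrite fourier_tilde ?oppr0//; exact: Lp_cint (ltW q1) Hgp.1.
have upos j : 0 < j -> fourier u j = 0.
  by move=> j0; exact: (fourier_cohardyM_pos p1 q1 pq j0 Hgm Htgp).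
have HtV := cohardy_tilde q0 (ltW q1) HVgm.
have uneg j : j < 0 -> fourier u j = 0.
  move=> j0; rewrite -(fourier_hardyM_neg p1 q1 pq j0 HVgp HtV).
  apply: fourier_aeq; first exact: cu.1.
    exact: (cintM p0 q0 pq HVgp.1 HtV.1).1.
  apply: ae_imply3 prod n0 (ae_opp n0) => x h [a1 a2] [b1 b2].
  rewrite /u !tilde_cis /recip; apply: (mulIf a1); apply: (mulIf b2).
  transitivity (1 : C); first by rewrite -h; ring.
  by field; rewrite a1 b2.
have uc : aeq u (fun=> signature gp).
  apply: fourier_inj => //; first exact: cint_cst.
  move=> j; rewrite fourier_cst; case: (ltgtP j 0) => [|| ->] //; [exact: uneg|exact: upos].
split=> //; transitivity (fourier (fun=> signature gp ^+ 2) 0); first by rewrite fourier_cst.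
transitivity (fourier (fun=> 1 : C) 0); last by rewrite fourier_cst.
apply: fourier_aeq; [exact: cmeas_cst..|].
apply: ae_imply3 uc (ae_opp uc) prod => x; rewrite /u !tilde_cis opprK => e1 e2 h.
by rewrite expr2 -{1}e1 -e2 -h; ring.
Qed.

End Factorization.
End WienerHopf.

(** * Toeplitz plus Hankel operators with matching symbols *)

Section MatchingPair.
Context {R : realType}.
Local Notation C := (R[i]).
Local Notation T := (measurableTypeR R).
Local Notation mu := (arc_length R).
Local Notation F := (circle R -> C).
Local Notation cint := cintegrable.

Lemma conjugate_gt1 (p q : R) : 1 < p -> p^-1 + q^-1 = 1 -> 1 < q.
Proof.
move=> p1 pq; have p0 : 0 < p by exact: lt_trans p1.
have h : q^-1 = 1 - p^-1 by rewrite -pq addrC addKr.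
have h0 : 0 < q^-1 by rewrite h subr_gt0 invf_lt1.
have h1 : q^-1 < 1 by rewrite h gtrBl invr_gt0.
by rewrite -invf_lt1// -invr_gt0.
Qed.

Lemma Linfty_unitP (g : F) : Linfty_unit g ->
  [/\ ebounded g, ebounded (recip g) & {ae mu, forall x, g (cis x) != 0}].
Proof.
move=> [/Lp_ebounded bg [h /Lp_ebounded bh gh]].
have g0 : {ae mu, forall x, g (cis x) != 0}.
  apply: ae_imply gh => x /= e; apply/eqP => g0; move/eqP: e.
  by rewrite g0 mul0r eq_sym oner_eq0.
split=> //; apply: (ebounded_aeq (cmeas_recip bg.1) _ bh).
apply: ae_imply2 gh g0 => x /= e g0; rewrite /recip; apply: (mulfI g0).
by rewrite e mulfV.
Qed.

Lemma fourier_mulC (f g : F) n :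
  fourier (fun t => f t * g t) n = fourier (fun t => g t * f t) n.
Proof.
rewrite (_ : (fun t => f t * g t) = fun t => g t * f t)//.
by apply/funext => t; exact: mulrC.
Qed.

Lemma zexp_opp n (x : R) : zexp n (cis (- x)) = (zexp n (cis x))^-1.
Proof. by rewrite -tilde_cis /tilde zexp_inv zexpN_inv. Qed.

Lemma sum_fold_even (V : nmodType) (G : nat -> V) m :
  \sum_(0 <= i < m + m) G i = \sum_(0 <= k < m) (G (m - k.+1)%N + G (m + k)%N).
Proof.
rewrite (big_cat_nat (n := m)) ?leq_addr//= big_nat_rev /= big_split /=; congr (_ + _).
rewrite -{1}(add0n m) big_addn addnK.
by apply: eq_bigr => k _; rewrite addnC.
Qed.

Lemma sum_fold_odd (V : nmodType) (G : nat -> V) m :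
  \sum_(0 <= i < m + m.+1) G i = G m + \sum_(0 <= k < m) (G (m - k.+1)%N + G (m + k.+1)%N).
Proof.
rewrite (big_cat_nat (n := m)) ?leq_addr//= big_nat_rev /= big_split /=.
rewrite addrCA; congr (_ + _); rewrite -{1}(add0n m) big_addn addKn big_nat_recl//.
by congr (_ + _); apply: eq_bigr => k _; rewrite addnC.
Qed.

Section Operator.
Context (p q : R) (p1 : 1 < p) (pq : p^-1 + q^-1 = 1).
Context (a b : F) (mab : matching_pair a b).
Implicit Types (f g h phi psi s : F).
Local Notation c := (subord_c a b).
Local Notation d := (subord_d a b).

Let p0 : 0 < p. Proof. exact: lt_trans p1. Qed.
Let q1 : 1 < q. Proof. exact: conjugate_gt1 p1 pq. Qed.
Let q0 : 0 < q. Proof. exact: lt_trans q1. Qed.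

Lemma matching_ae : {ae mu, forall x,
  [/\ a (cis x) != 0, b (cis x) != 0, a (cis (- x)) != 0, b (cis (- x)) != 0 &
   a (cis x) * a (cis (- x)) = b (cis x) * b (cis (- x))]}.
Proof.
have [ua _ e] := mab; have [_ _ a0] := Linfty_unitP ua.
apply: ae_imply3 a0 (ae_opp a0) e => x a0 a0'; rewrite /= !tilde_cis => e.
by have := mulf_neq0 a0 a0'; rewrite e mulf_eq0 negb_or => /andP[].
Qed.

Lemma matching_bounded : [/\ ebounded a, ebounded b, ebounded (recip (tilde a)),
  ebounded c & ebounded d].
Proof.
have [ua /Lp_ebounded bb _] := mab; have [ba bVa _] := Linfty_unitP ua.
have bVta : ebounded (recip (tilde a)) by exact: ebounded_tilde bVa.
have bVb : ebounded (recip b).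
  have bt : ebounded (fun t => tilde b t * (recip a t * recip (tilde a) t)).
    by apply: eboundedM; [exact: ebounded_tilde|exact: eboundedM].
  apply: (ebounded_aeq (cmeas_recip bb.1) _ bt).
  apply: ae_imply matching_ae => x [a0 b0 a0' b0' e].
  rewrite /recip !tilde_cis.
  have -> : b (cis (- x)) = a (cis x) * a (cis (- x)) / b (cis x) by rewrite e mulrC mulKf.
  by field; rewrite a0 b0 a0'.
by split=> //; exact: eboundedM.
Qed.

Lemma subord_c_tilde : aeq (fun t => c t * tilde c t) (fun=> 1).
Proof.
apply: ae_imply matching_ae => x [a0 b0 a0' b0' e].
rewrite tilde_cis /subord_c /recip /= mulrACA -invfM -e mulfV// mulf_neq0//.
Qed.

(** For phi in H^p, J phi has only negative frequencies, so that Q does not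
    affect it and (T(a) + H(b)) phi is the Riesz projection of this function. *)
Definition unprojected phi : F := fun t => a t * phi t + b t * Jop phi t.

Lemma Lp_unprojected phi : Lp p%:E phi -> Lp p%:E (unprojected phi).
Proof.
have [ba bb _ _ _] := matching_bounded.
by move=> Lphi; apply: LpD => //; apply: Lp_eboundedM => //; exact: Lp_Jop.
Qed.

Lemma unprojectedD phi psi t : unprojected (fun t => phi t + psi t) t = unprojected phi t + unprojected psi t.
Proof. by rewrite /unprojected /Jop; ring. Qed.

Lemma unprojectedB phi psi t : unprojected (fun t => phi t - psi t) t = unprojected phi t - unprojected psi t.
Proof. by rewrite /unprojected /Jop; ring. Qed.

Lemma coriesz_Jop phi : Hardy p phi -> aeq (coriesz p (Jop phi)) (Jop phi).
Proof.
move=> Hphi; have L := Lp_Jop p0 Hphi.1.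
have : aeq (riesz p (Jop phi)) (fun=> 0).
  apply: (riesz_uniq (ltW p1)).
    by apply: (@Lp_bounded _ p 0) => // t; rewrite normc0.
  move=> n; rewrite fourier_cst; have -> : (if n == 0 then 0 else 0 : C) = 0 by case: ifP.
  rewrite fourier_Jop; last exact: Lp_cint (ltW p1) Hphi.1.
  by case: ifP => // n0; rewrite Hphi.2// subr_lt0; apply: le_lt_trans (ltr01); rewrite oppr_le0.
by apply: ae_imply => x; rewrite /coriesz /= => ->; rewrite subr0.
Qed.

Lemma toeplitz_hankel_fourier phi : Hardy p phi ->
  Hardy p (toeplitz p a phi \+ hankel p b phi) /\
  forall n, fourier (toeplitz p a phi \+ hankel p b phi) n =
    if 0 <= n then fourier (unprojected phi) n else 0.
Proof.
move=> Hphi; have [ba bb _ _ _] := matching_bounded.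
have Lj := Lp_Jop p0 Hphi.1; have cj := coriesz_Jop Hphi.
have Lcj : Lp p%:E (coriesz p (Jop phi)).
  by apply: LpB => //; exact: (rieszP p1 Lj).1.
have L2 : Lp p%:E (fun t => b t * coriesz p (Jop phi) t) by exact: Lp_eboundedM.
have [H1 h1] := toeplitz_aeq p1 ba Hphi.
have H2 : Hardy p (hankel p b phi) by exact: riesz_hardy.
have L2' : Lp p%:E (fun t => b t * Jop phi t) by exact: Lp_eboundedM.
have L1' : Lp p%:E (fun t => a t * phi t) by apply: Lp_eboundedM => //; case: Hphi.
have ci g : Lp p%:E g -> cint g := Lp_cint (ltW p1).
have c1 := ci _ H1.1; have c2 := ci _ H2.1; have c1' := ci _ L1'; have c2' := ci _ L2'.
have h2 n : fourier (hankel p b phi) n = if 0 <= n then fourier (fun t => b t * Jop phi t) n else 0.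
  rewrite (rieszP p1 L2).2; case: ifP => // _; apply: fourier_aeq.
  - exact: Lp_cmeas L2.
  - exact: Lp_cmeas L2'.
  - by apply: ae_imply cj => x ->.
split=> [|n]; first exact: hardyD (ltW p1) H1 H2.
rewrite (fourierD n c1 c2) h1 h2 (fourierD n c1' c2').
by case: ifP => // _; rewrite addr0.
Qed.

Lemma toeplitz_hankel_eq phi f : Hardy p phi -> Hardy p f ->
  aeq (toeplitz p a phi \+ hankel p b phi) f <->
  forall n, 0 <= n -> fourier (unprojected phi) n = fourier f n.
Proof.
move=> Hphi Hf; have [H h] := toeplitz_hankel_fourier Hphi.
split=> [e n n0|e].
  have := fourier_aeq n (Lp_cmeas H.1) (Lp_cmeas Hf.1) e.
  by rewrite h n0.
apply: (Lp_fourier_inj (ltW p1) H.1 Hf.1) => n; rewrite h.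
by case: leP => [/e//|n0]; rewrite Hf.2.
Qed.

(** J exchanges the negative and the nonnegative frequencies. *)
Lemma Jop_coriesz_hardy g : Lp p%:E g -> Hardy p (Jop (coriesz p g)).
Proof.
move=> Lg; have [Lr rE] := rieszP p1 Lg.
have L : Lp p%:E (coriesz p g) by exact: LpB.
have ci h : Lp p%:E h -> cint h := Lp_cint (ltW p1).
split=> [|n n0]; first exact: Lp_Jop.
rewrite fourier_Jop; last exact: ci.
rewrite fourierB ?rE; [|exact: ci..].
by rewrite ifT ?subrr//; lia.
Qed.

Lemma hardy_sum (I : Type) (l : seq I) (f : I -> F) : (forall i, Hardy p (f i)) ->
  Hardy p (fun t => \sum_(i <- l) f i t).
Proof.
move=> Hf; elim: l => [|i l IH].
  rewrite (_ : (fun t => _) = polyfun 0); first exact: hardy_polyfun.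
  by apply/funext => t; rewrite big_nil /polyfun horner0.
rewrite (_ : (fun t => _) = fun t => f i t + \sum_(i <- l) f i t).
  exact: (hardyD (ltW p1)).
by apply/funext => t; rewrite big_cons.
Qed.

(** ** A particular solution *)

(** As P (c s) = P (a~^-1 psi), the projections cancel, and the solution is
    s - c~ J s + a^-1 J psi. Its image simplifies to J psi + d psi, whose
    first term has only negative frequencies. *)
Lemma unprojected_particular s psi : Hardy p s -> Hardy p psi ->
  (forall n, 0 <= n -> fourier (fun t => s t * c t) n =
     fourier (fun t => recip (tilde a) t * psi t) n) ->
  let phi := fun t => s t - Jop (coriesz p (c \* s)) t
    + Jop (coriesz p (recip (tilde a) \* psi)) t in
  Hardy p phi /\ aeq (unprojected phi) (fun t => Jop psi t + d t * psi t).
Proof.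
move=> Hs Hpsi E phi; have [ba bb bVta bc bd] := matching_bounded.
have L1 : Lp p%:E (c \* s) by apply: Lp_eboundedM => //; case: Hs.
have L2 : Lp p%:E (recip (tilde a) \* psi) by apply: Lp_eboundedM => //; case: Hpsi.
split.
  apply: (hardyD (ltW p1)); last exact: Jop_coriesz_hardy.
  by apply: (hardyB (ltW p1)) => //; exact: Jop_coriesz_hardy.
have [R1 r1] := rieszP p1 L1; have [R2 r2] := rieszP p1 L2.
have e12 : aeq (riesz p (c \* s)) (riesz p (recip (tilde a) \* psi)).
  apply: (Lp_fourier_inj (ltW p1) R1 R2) => n; rewrite r1 r2; case: ifP => // n0.
  rewrite -E//; exact: fourier_mulC.
have aE y : recip (tilde a) (cis y) = (a (cis (- y)))^-1 by rewrite /recip tilde_cis.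
have phiE y : riesz p (c \* s) (cis (- y)) = riesz p (recip (tilde a) \* psi) (cis (- y)) ->
    phi (cis y) = s (cis y) - (a (cis (- y)) * (b (cis (- y)))^-1 * s (cis (- y)) -
      (a (cis y))^-1 * psi (cis (- y))) * zexp (-1) (cis y).
  move=> h; have -> : phi (cis y) = s (cis y) - coriesz p (c \* s) (cis (- y)) * zexp (-1) (cis y)
      + coriesz p (recip (tilde a) \* psi) (cis (- y)) * zexp (-1) (cis y).
    by rewrite -!Jop_cis.
  have -> : coriesz p (c \* s) (cis (- y)) = a (cis (- y)) * (b (cis (- y)))^-1 * s (cis (- y)) -
      riesz p (c \* s) (cis (- y)) by [].
  have -> : coriesz p (recip (tilde a) \* psi) (cis (- y)) =
      recip (tilde a) (cis (- y)) * psi (cis (- y)) -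
      riesz p (recip (tilde a) \* psi) (cis (- y)) by [].
  by rewrite aE opprK h; ring.
have dE y : d (cis y) = b (cis y) * (a (cis (- y)))^-1 by rewrite -aE.
have N := ae_and matching_ae (ae_and e12 (ae_opp e12)).
apply: ae_imply N => x [[a0 b0 a0' b0' e] [e1 e2]].
rewrite /unprojected !Jop_cis dE (phiE _ e2) (phiE (- x)) opprK// zexp_opp.
have -> : b (cis x) = a (cis x) * a (cis (- x)) / b (cis (- x)) by rewrite e mulfK.
by field; rewrite a0 b0' a0' zexp_neq0.
Qed.

(** Only d psi contributes nonnegative frequencies. *)
Lemma fourier_unprojected_particular phi psi f : cint (unprojected phi) -> Hardy p psi ->
  aeq (unprojected phi) (fun t => Jop psi t + d t * psi t) ->
  (forall n, 0 <= n -> fourier (fun t => psi t * d t) n = fourier f n) ->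
  forall n, 0 <= n -> fourier (unprojected phi) n = fourier f n.
Proof.
move=> cS Hpsi e h n n0; have [_ _ _ _ bd] := matching_bounded.
have cpsi := Lp_cint (ltW p1) Hpsi.1.
have cJ := cint_Jop cpsi; have cd := cint_eboundedM bd cpsi.
rewrite (fourier_aeq n cS.1 (cmeasD cJ.1 cd.1) e) fourierD// fourier_Jop//.
rewrite Hpsi.2 ?add0r; last first.
  by rewrite subr_lt0; apply: le_lt_trans ltr01; rewrite oppr_le0.
by rewrite -h//; exact: fourier_mulC.
Qed.

(** ** The kernel *)

Section Uniqueness.
Context (kd : int) (dm dp : F) (kd0 : kd < 0).
Context (Hd : wh_factorization p q d (- kd) dm dp).

(** If the image eta of phi has only negative frequencies, then from
    eta = d J eta one gets d_-^-1 eta = t^-kd d_+ J eta, whose left side has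
    nonpositive and right side positive frequencies. *)
Lemma unprojected_eq0 phi : Hardy p phi ->
  (forall n, 0 <= n -> fourier (unprojected phi) n = 0) -> aeq (unprojected phi) (fun=> 0).
Proof.
move=> Hphi eta0; have LS := Lp_unprojected Hphi.1; set eta := unprojected phi in eta0 LS *.
have ceta := Lp_cint (ltW p1) LS.
have HS : coHardy p eta by split=> // n /ltW; exact: eta0.
have HJ : Hardy p (Jop eta).
  split=> [|n n0]; first exact: Lp_Jop.
  by rewrite fourier_Jop// eta0//; lia.
have Hdp := whf_plus Hd; have HdV := whf_minusV Hd.
have c1 : cint (fun t => eta t * recip dm t) := cintM p0 q0 pq LS HdV.1.
have c2 : cint (fun t => Jop eta t * dp t) := cint_hardyM p1 q1 pq HJ Hdp.
have e : aeq (fun t => eta t * recip dm t) (fun t => Jop eta t * dp t * zexp (- kd) t).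
  have N := ae_and matching_ae (ae_and (whf_eq Hd) (whf_minus_neq0 Hd)).
  apply: ae_imply N => x [[a0 b0 a0' b0' e] [ed dm0]].
  have E : eta (cis x) = d (cis x) * Jop eta (cis x).
    rewrite /eta /unprojected !Jop_cis !opprK /subord_d /= /recip tilde_cis zexp_opp.
    have -> : b (cis x) = a (cis x) * a (cis (- x)) / b (cis (- x)) by rewrite e mulfK.
    by field; rewrite b0' a0' zexp_neq0.
  rewrite /recip E ed /=; field; exact: dm0.
have z : aeq (fun t => eta t * recip dm t) (fun=> 0).
  apply: fourier_uniqueness => // n; case: (ltP 0 n) => n0.
    exact: (fourier_cohardyM_pos p1 q1 pq n0 HS HdV).
  rewrite (fourier_aeq n c1.1 (cint_zexpM (- kd) c2).1 e) fourier_shift.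
  apply: (fourier_hardyM_neg p1 q1 pq _ HJ Hdp).
  by rewrite opprK -[ltRHS]addr0; apply: ler_ltD.
apply: ae_imply2 z (whf_minus_neq0 Hd) => x /eqP; rewrite mulf_eq0 => /orP[/eqP//|].
by rewrite /recip invr_eq0 => /eqP ->; rewrite eqxx.
Qed.

End Uniqueness.

Section Kernel.
Context (kc : int) (cm cp : F) (kc0 : 0 < kc).
Context (Hc : wh_factorization p q c (- kc) cm cp).
Local Notation sigma := (signature cp).

Lemma sigma_sqr : sigma ^+ 2 = 1.
Proof. exact: (signatureP p1 q1 pq Hc subord_c_tilde).1. Qed.

Lemma minus_plus_ae : {ae mu, forall x, cm (cis x) * cp (cis (- x)) = sigma}.
Proof.
have [_ e] := signatureP p1 q1 pq Hc subord_c_tilde.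
by apply: ae_imply e => x; rewrite tilde_cis.
Qed.

Lemma u_minusE (k : nat) : (k <= kappa1 `|kc|%N)%N -> exists i j : nat,
  (i + j).+1 = `|kc|%N /\
  forall t, u_minus sigma `|kc|%N k t = zexp i%:Z t - sigma * zexp j%:Z t.
Proof.
set N := `|kc|%N; have N0 : (0 < N)%N by rewrite absz_gt0 gt_eqF.
have := odd_double_half N; rewrite /kappa1 /u_minus; set m := N./2.
case: ifP => /= [_ Nm km|_ Nm km].
  exists (m + k)%N, (m - k)%N; split; first by rewrite -Nm -addnn; lia.
  by move=> t; rewrite PoszD subzn.
have m0 : (0 < m)%N by move: N0; rewrite -Nm; case: (m).
exists (m - k - 1)%N, (m + k)%N; split; first by rewrite -Nm -addnn; lia.
by move=> t; rewrite PoszD -!subzn//; lia.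
Qed.

Definition kernel_sum (r : 'I_(kappa1 `|kc|%N).+1 -> C) : F := fun t =>
  \sum_(k < (kappa1 `|kc|%N).+1) r k * u_minus sigma `|kc|%N k t.

Lemma kernel_hardy r : Hardy p (fun t => (cp t)^-1 * kernel_sum r t).
Proof.
have HV := whf_plusV Hc.
have Hz (i : nat) : Hardy p (fun t => recip cp t * zexp i%:Z t).
  split=> [|n n0]; first by apply: Lp_zexpM => //; case: HV.
  by rewrite fourier_shift HV.2//; apply: le_lt_trans n0; rewrite gerBl.
rewrite (_ : (fun t => _) = fun t => \sum_(k < (kappa1 `|kc|%N).+1)
    (r k * (recip cp t * u_minus sigma `|kc|%N k t))); last first.
  by apply/funext => t; rewrite mulr_sumr; apply: eq_bigr => k _; rewrite mulrCA.
apply: hardy_sum => k; apply: (hardyZ _ (ltW p1)).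
have [//|i [j [_ uE]]] := @u_minusE k; first by rewrite -ltnS.
rewrite (_ : (fun t => _) = fun t => recip cp t * zexp i%:Z t - sigma * (recip cp t * zexp j%:Z t)).
  by apply: (hardyB (ltW p1)) => //; exact: (hardyZ _ (ltW p1)).
by apply/funext => t; rewrite uE mulrBr mulrCA.
Qed.

(** The two exponents in each u_k add up to kappa_c - 1, and sigma^2 = 1. *)
Lemma kernel_sum_opp r x :
  kernel_sum r (cis (- x)) = - sigma * zexp (1 - kc) (cis x) * kernel_sum r (cis x).
Proof.
rewrite /kernel_sum mulr_sumr; apply: eq_bigr => k _.
have [//|i [j [ij uE]]] := @u_minusE k; first by rewrite -ltnS.
have kE : kc = (i + j).+1%:Z by rewrite ij gtz0_abs.
rewrite !uE mulrCA; congr (_ * _).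
have -> : zexp (1 - kc) (cis x) = (zexp i%:Z (cis x))^-1 * (zexp j%:Z (cis x))^-1.
  by rewrite -!zexpN_inv -zexpD; congr (zexp _ _); rewrite kE; lia.
rewrite !zexp_opp; move: (zexp_neq0 i%:Z (cis x)) (zexp_neq0 j%:Z (cis x)).
set X := zexp i%:Z _; set Y := zexp j%:Z _ => X0 Y0.
transitivity (sigma ^+ 2 * X^-1 - sigma * Y^-1); first by rewrite sigma_sqr mul1r.
by field; rewrite X0 Y0.
Qed.

(** By c_- = sigma / c_+~ and the reflection formula, both terms are the same
    function with opposite signs. *)
Lemma unprojected_kernel r : aeq (unprojected (fun t => (cp t)^-1 * kernel_sum r t)) (fun=> 0).
Proof.
have cp0 := whf_plus_neq0 Hc.
have N := ae_and matching_ae (ae_and (whf_eq Hc) minus_plus_ae).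
apply: ae_imply3 N cp0 (ae_opp cp0) => x [[a0 b0 a0' b0' e] [ec es]] p0' p0''.
rewrite /unprojected Jop_cis kernel_sum_opp.
have -> : a (cis x) = b (cis x) * (cm (cis x) * zexp (- kc) (cis x) * cp (cis x)).
  by rewrite -[X in b _ * X]ec /subord_c /= /recip mulrC divfK.
have -> : cm (cis x) = sigma / cp (cis (- x)) by rewrite -es mulfK.
have -> : zexp (1 - kc) (cis x) = zexp (- kc) (cis x) * (zexp (-1) (cis x))^-1.
  by rewrite -zexpN_inv -zexpD; congr (zexp _ _); lia.
by field; rewrite p0' p0'' zexp_neq0.
Qed.

(** The exponents i and j = kappa_c - 1 - i of a pair share one coefficient of
    the sum. For odd kappa_c the middle exponent m is paired with itself, and
    u_0 = (1 - sigma) t^m while (1 - sigma) v_m = 2 v_m, whence the division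
    by 2. *)
Lemma kernel_sum_exists (v : nat -> C) :
  (forall i j : nat, (i + j).+1 = `|kc|%N -> sigma * v i = - v j) ->
  exists r, forall t, kernel_sum r t = \sum_(i < `|kc|%N) v i * zexp i%:Z t.
Proof.
set N := `|kc|%N => hv; have N0 : (0 < N)%N by rewrite absz_gt0 gt_eqF.
have v2 i j : (i + j).+1 = N -> v i = - (sigma * v j).
  by move=> ij; rewrite -[LHS]mul1r -sigma_sqr expr2 -mulrA (hv i j ij) mulrN.
have := odd_double_half N; set m := N./2 => Nm.
have zB k t : (k <= m)%N -> zexp (m%:Z - k%:Z) t = zexp (m - k)%N%:Z t :> C.
  by move=> km; rewrite subzn.
have [oN|eN] := boolP (odd N).
  have NE : N = (m + m.+1)%N by rewrite -[LHS]Nm oN -addnn; lia.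
  pose w (k : nat) : C := if k == 0%N then v m / 2 else v (m + k)%N.
  exists (fun k : 'I_(kappa1 N).+1 => w k) => t; rewrite /kernel_sum -/N.
  rewrite /u_minus /kappa1 -/m oN.
  rewrite -(big_mkord xpredT (fun k => w k * (zexp (m%:Z + k%:Z) t - sigma * zexp (m%:Z - k%:Z) t))).
  rewrite -(big_mkord xpredT (fun i => v i * zexp i%:Z t)).
  rewrite NE sum_fold_odd big_nat_recl//= addr0 ?subr0; congr (_ + _).
    rewrite {1}/w /= (_ : _ * _ = (v m - sigma * v m) / 2 * zexp m%:Z t); last by ring.
    by rewrite (hv m m) ?opprK; [field|lia].
  apply: eq_big_nat => k /andP[_ km]; rewrite /w /=.
  rewrite (v2 (m - k.+1)%N (m + k.+1)%N); last by lia.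
  by rewrite zB// -PoszD; ring.
have NE : N = (m + m)%N by rewrite -[LHS]Nm (negbTE eN) -addnn.
have m0 : (0 < m)%N by lia.
exists (fun k : 'I_(kappa1 N).+1 => v (m - k.+1)%N) => t; rewrite /kernel_sum -/N.
rewrite /u_minus /kappa1 -/m (negbTE eN) (prednK m0).
rewrite -(big_mkord xpredT (fun k => v (m - k.+1)%N * (zexp (m%:Z - k%:Z - 1) t - sigma * zexp (m%:Z + k%:Z) t))).
rewrite -(big_mkord xpredT (fun i => v i * zexp i%:Z t)) NE sum_fold_even.
apply: eq_big_nat => k /andP[_ km].
rewrite (v2 (m + k)%N (m - k.+1)%N); last by lia.
have -> : m%:Z - k%:Z - 1 = m%:Z - k.+1%:Z by lia.
by rewrite zB// -PoszD; ring.
Qed.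

(** Dividing a phi + b J phi = 0 by b gives c phi = - J phi. With the
    factorization of c and c_- = sigma / c_+~ this becomes
    sigma t^(-kappa_c) u = - J u for u = c_+ phi, that is
    sigma u_(n + kappa_c) = - u_(- n - 1): u is a polynomial of degree less
    than kappa_c with the symmetry of the kernel sums. *)
Lemma unprojected_kernel_complete phi : Hardy p phi -> aeq (unprojected phi) (fun=> 0) ->
  exists r, aeq phi (fun t => (cp t)^-1 * kernel_sum r t).
Proof.
move=> Hphi S0; have Hcp := whf_plus Hc; pose u t := phi t * cp t.
have cu : cint u := cint_hardyM p1 q1 pq Hphi Hcp.
have cp0 := whf_plus_neq0 Hc.
have e : aeq (fun t => sigma * (u t * zexp (- kc) t)) (fun t => - Jop u t).
  have N := ae_and matching_ae (ae_and (whf_eq Hc) minus_plus_ae).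
  apply: ae_imply2 N S0 => x [[a0 b0 a0' b0' e] [ec es]].
  rewrite /unprojected Jop_cis /u !Jop_cis -es => S.
  have E : c (cis x) * phi (cis x) = - (phi (cis (- x)) * zexp (-1) (cis x)).
    apply: (mulfI b0); apply/eqP; rewrite mulrN -subr_eq0 opprK -[X in _ == X]S.
    by rewrite /subord_c /= /recip !mulrA (mulrAC (b _)) mulfV// mul1r.
  transitivity (cp (cis (- x)) * (c (cis x) * phi (cis x))).
    by rewrite ec /=; ring.
  by rewrite E; ring.
have cJ := cint_Jop cu; have cz := cint_zexpM (- kc) cu.
have eF n : sigma * fourier u (n + kc) = - fourier u (- n - 1).
  have := fourier_aeq n (cmeasZ sigma cz.1) (cmeasN cJ.1) e.
  by rewrite fourierZ// fourier_shift opprK fourierN// fourier_Jop.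
have u0 n : n < 0 -> fourier u n = 0.
  by move=> n0; exact: (fourier_hardyM_neg p1 q1 pq n0 Hphi Hcp).
have s0 : sigma != 0.
  by apply/eqP => h; have /eqP := sigma_sqr; rewrite h expr0n eq_sym oner_eq0.
set N := `|kc|%N; have kE : kc = N%:Z by rewrite gtz0_abs.
have uN n : kc <= n -> fourier u n = 0.
  move=> kn; apply: (mulfI s0); rewrite mulr0 -(subrK kc n) eF u0 ?oppr0//; lia.
have [|r hr] := @kernel_sum_exists (fun i => fourier u i%:Z).
  move=> i j; rewrite -/N => ij.
  have -> : i%:Z = (i%:Z - kc) + kc by rewrite subrK.
  by rewrite eF; congr (- fourier u _); lia.
exists r.
have uE : aeq u (kernel_sum r).
  have -> : kernel_sum r = polyfun (\poly_(i < N) fourier u i%:Z).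
    apply/funext => t; rewrite hr /polyfun horner_poly; apply: eq_bigr => i _.
    by rewrite /zexp -exprnP.
  apply: fourier_inj => //; first exact: cint_polyfun.
  move=> n; rewrite fourier_polyfun; case: n => [n|n]; last exact: u0.
  rewrite coef_poly; case: ltnP => // nN; rewrite uN// kE; lia.
apply: ae_imply2 uE cp0 => x <- c0.
by rewrite /u mulrC mulfK.
Qed.

End Kernel.
End Operator.
End MatchingPair.

Theorem theorem3p4 (R : realType) (p q : R) (a b : circle R -> R[i])
  (kc kd : int) (cm cp dm dp f : circle R -> R[i]) :
  1 < p -> p^-1 + q^-1 = 1 ->
  matching_pair a b ->
  let c := subord_c a b in
  let d := subord_d a b in
  fredholm_of_index p (toeplitz p c) kc ->
  fredholm_of_index p (toeplitz p d) kd ->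
  0 < kc -> kd < 0 ->
  wh_factorization p q c (- kc) cm cp ->
  wh_factorization p q d (- kd) dm dp ->
  Hardy p f ->
  (forall j : nat, j%:Z <= - kd - 1 ->
    circle_int
      (fun t => ((dm t)^-1)^*%C * (val t) ^+ j * (f t)^*%C) = 0) ->
  let TaHb phi := toeplitz p a phi \+ hankel p b phi in
  let psi := toeplitz_linv p (- kd) dm dp f in
  let s := toeplitz_rinv p (- kc) cm cp
             (toeplitz p (recip (tilde a)) psi) in
  let N := `|kc|%N in
  let phi (r : 'I_(kappa1 N).+1 -> R[i]) : circle R -> R[i] := fun t =>
    s t - Jop (coriesz p (c \* s)) t
    + Jop (coriesz p (recip (tilde a) \* psi)) t
    + (cp t)^-1 * \sum_(k < (kappa1 N).+1)
                    r k * u_minus (signature cp) N k t in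
  (exists2 h, Hardy p h & aeq (TaHb h) f) /\
  (forall r, Hardy p (phi r) /\ aeq (TaHb (phi r)) f) /\
  (forall h, Hardy p h -> aeq (TaHb h) f -> exists r, aeq h (phi r)).
Proof.
move=> p1 pq mab c d _ _ kc0 kd0 Hc Hd Hf orth TaHb psi s N phi.
have p0 : 0 < p by exact: lt_trans p1.
have q1 := conjugate_gt1 p1 pq; have q0 : 0 < q by exact: lt_trans q1.
have [ba bb bVta bc bd] := matching_bounded mab.
have f0 j : 0 <= j -> j < - kd -> fourier (fun t => f t * (dm t)^-1) j = 0.
  case: j => // j _ jk; have cfd := cintM p0 q0 pq Hf.1 (whf_minusV Hd).1.
  rewrite fourierE; have := orth j; rewrite (_ : (fun t => _) =
    fun t => ((f t * (dm t)^-1) * zexp (- j%:Z) t)^*%C); last first.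
    apply/funext => t; rewrite !rmorphM /= conj_zexp opprK /zexp -exprnP; ring.
  rewrite circle_int_conj; last exact: cint_zexpM.
  move=> h; have {h} := h (_ : j%:Z <= - kd - 1) => h.
  by rewrite -[X in _ * X]conjcK h ?conjc0 ?mulr0//; lia.
have [Hpsi psiE] : Hardy p psi /\
    forall j, 0 <= j -> fourier (fun t => psi t * d t) j = fourier f j.
  by apply: (toeplitz_linvP p1 q1 pq Hd) => //; rewrite oppr_gt0.
have [Hw wE] := toeplitz_aeq p1 bVta Hpsi.
have kc0' : - kc < 0 by rewrite oppr_lt0.
have [Hs sE] := toeplitz_rinvP p1 q1 pq Hc kc0' bc Hw.
pose phi0 t := s t - Jop (coriesz p (c \* s)) t + Jop (coriesz p (recip (tilde a) \* psi)) t.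
have [H0 S0] : Hardy p phi0 /\ aeq (unprojected a b phi0) (fun t => Jop psi t + d t * psi t).
  by apply: (unprojected_particular p1 pq mab Hs Hpsi) => n n0; rewrite sE// wE n0.
have cS g : Hardy p g -> cintegrable (unprojected a b g).
  by move=> Hg; apply: Lp_cint (ltW p1) _; apply: (Lp_unprojected p1 mab); exact: Hg.1.
pose phi1 r t := (cp t)^-1 * @kernel_sum R kc cp r t.
have phiE r : phi r = fun t => phi0 t + phi1 r t by [].
have H1 r : Hardy p (phi1 r) by exact: (kernel_hardy p1 pq kc0 Hc).
have Hphi r : Hardy p (phi r) by exact: (hardyD (ltW p1) H0 (H1 r)).
have Sphi r : aeq (unprojected a b (phi r)) (fun t => Jop psi t + d t * psi t).
  apply: ae_imply2 S0 (unprojected_kernel p1 pq mab kc0 Hc r) => x <- S1.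
  by rewrite phiE unprojectedD [X in _ + X]S1 addr0.
have sol r : aeq (TaHb (phi r)) f.
  apply/(toeplitz_hankel_eq p1 mab (Hphi r) Hf).
  by apply: (fourier_unprojected_particular p1 mab (cS _ (Hphi r)) Hpsi (Sphi r) psiE).
split; first by exists (phi (fun=> 0)).
split=> [r|h Hh hf]; first by split.
have hE := (toeplitz_hankel_eq p1 mab Hh Hf).1 hf.
have Hd0 : Hardy p (fun t => h t - phi0 t) := hardyB (ltW p1) Hh H0.
have z : aeq (unprojected a b (fun t => h t - phi0 t)) (fun=> 0).
  apply: (unprojected_eq0 p1 pq mab kd0 Hd Hd0) => n n0.
  rewrite (_ : unprojected a b _ = fun t => unprojected a b h t - unprojected a b phi0 t); last first.
    by apply/funext => t; exact: unprojectedB.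
  rewrite fourierB ?hE//; [|exact: cS..].
  by rewrite (fourier_unprojected_particular p1 mab (cS _ H0) Hpsi S0 psiE)// subrr.
have [r hr] := unprojected_kernel_complete p1 pq mab kc0 Hc Hd0 z.
exists r; apply: ae_imply hr => x e.
by rewrite phiE /phi1 -e addrC subrK.
Qed.
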